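(* Let $F_{p,X}[h^{-1},h]$ be the VOA generated by $D$ $\beta$-$\gamma$ systems $p_i,X^i$ ($i=1,\dots,D$), $\mathfrak g$ a Lie algebra, and $\eta^{ij}$ a constant symmetric invertible $D\times D$ matrix with inverse $\eta_{ij}$; use the flat background deformation defined by $\eta$ and $f_i=cp_i$. Then the Yang–Mills equation for $F_{p,X}$ and $\mathfrak g$, i.e. the generalized Maurer–Cartan equation $$Q^\eta\Psi+\mu_0^\eta(\Psi,\Psi)+n_0^\eta(\Psi,\Psi,\Psi)=0$$ for $\Psi\in\mathcal F_1\otimes\mathfrak g$, that is, $\Psi=(\mathbf A,\mathbf B,v)\in(TM\oplus T^*M\oplus\mathcal O_M)\otimes\mathfrak g$, is equivalent to the following system of equations ($k=1,\dots,D$): $$\sum_{i,j}\eta^{ij}[\nabla_i,[\nabla_j,\nabla_k]]=\sum_{i,j}\eta^{ij}[[\nabla_k,\Phi_i],\Phi_j],\qquad \sum_{i,j}\eta^{ij}[\nabla_i,[\nabla_j,\Phi_k]]=\sum_{i,j}\eta^{ij}[\Phi_i,[\Phi_j,\Phi_k]],$$ where $\Phi_i=B_i-\sum_jA^j\eta_{ij}$, $\mathcal A_i=B_i+\sum_jA^j\eta_{ij}$ and $\nabla_i=\partial_i+\mathcal A_i$. Here $B_i$ are the components of $\mathbf B\in T^*M\otimes\mathfrak g$ and $A^i$ are the components of $\mathbf A\in TM\otimes\mathfrak g$. The gauge symmetries $\Psi\mapsto\Psi+\epsilon\big(Q^\eta u+\mu_0^\eta(\Psi,u)-\mu_0^\eta(u,\Psi)\big)$,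 $u\in\mathcal F_0\otimes\mathfrak g=\mathcal O_M\otimes\mathfrak g$, $\epsilon$ infinitesimal, correspond to the following transformation of fields: $$\mathcal A_i\mapsto\mathcal A_i+\epsilon(\partial_iu+[\mathcal A_i,u]),\qquad \Phi_i\mapsto\Phi_i+\epsilon[\Phi_i,u].$$
   Context: **$\beta$-$\gamma$ VOA.** $X^i(z)=\sum_nX^i_nz^{-n}$ and $p_i(z)=\sum_np_{i,n}z^{-n-1}$ have conformal dimensions $0$ and $1$, with $X^i(z)p_j(w)\sim\frac{h\delta_{ij}}{z-w}$, $X^i(z)X^j(w)\sim0$, $p_i(z)p_j(w)\sim0$, where $h$ is a formal parameter. Underlying space $V[h^{-1},h]$ with $V=F_{p,X}=\mathbb C[[X_0^1,\dots,X_0^D]]\otimes\mathbb C[p_{i,-n},X^i_{-n}]_{n>0}$; Virasoro field $L(z)=-\frac1h\sum_i{:}p_i\partial X^i{:}$. Let $V^0,V^1$ be the subspaces of $V$ of conformal weight $0$ and $1$. With $M=\mathrm{Spf}(\mathbb C[[X_0^1,\dots,X_0^D]])$, $V^0=\mathcal O_M$ (power series $u(X)$) and $V^1=TM\oplus T^*M$ (sections): $\mathbf A=(A^i)$ corresponds to $\sum_i{:}A^i(X)p_i{:}$ and $\mathbf B=(B_j)$ to $\sum_jB_j(X)\partial X^j$. $\partial_i=\partial/\partial X_0^i$. **Ghosts and BRST.** $\Lambda$ is the Fock module of $\{b_n,c_m\}=\delta_{n+m,0}$ with vacuum $\mathbf 1$, $c_k\mathbf 1=0$ for $k\ge2$,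 $b_k\mathbf 1=0$ for $k\ge-1$; $b(z)=\sum b_mz^{-m-2}$, $c(z)=\sum c_nz^{-n+1}$. On $V[h^{-1},h]\otimes\Lambda$ put $Q=\mathrm{Res}_z\big(cL+{:}c\,\partial c\,b{:}+\tfrac32\partial^2c\big)(z)$. Ghost number $|a|$ counts $c$ with $+1$, $b$ with $-1$. Writing states via their operators, $\mathcal F=\mathcal F_0\oplus\mathcal F_1\oplus\mathcal F_2\oplus\mathcal F_3$ with $\mathcal F_0=V^0$, $\mathcal F_1=cV^1\oplus h\,\partial c\,V^0$, $\mathcal F_2=h\,c\,\partial c\,V^1\oplus h\,c\,\partial^2c\,V^0$, $\mathcal F_3=h^2c\,\partial c\,\partial^2c\,V^0$. An element of $\mathcal F_1$ is written $(\mathbf A,\mathbf B,v)$, meaning $c(\mathbf A+\mathbf B)+h\,\partial c\,v$. **Quasiclassical operations.** $\mu(a_1,a_2)=\mathrm{Res}_z\frac{a_1(z)a_2}{z}$, $\{a_1,a_2\}=(-1)^{|a_1|}\mathrm{Res}_z(b_{-1}a_1)(z)a_2$, $m(a_1,a_2)=\sum_{i\ge0}\frac{(-1)^i}{i+1}\mathrm{Res}_w\mathrm{Res}_{z-w}(z-w)^iw^{-i-1}b_{-1}(a_1(z-w)a_2)(w)\mathbf 1$, $n(a_1,a_2,a_3)=\sum_{i\ge0}\frac1{i+1}\mathrm{Res}_z\mathrm{Res}_w\,w^iz^{-i-1}(b_{-1}a_1)(z)a_2(w)a_3+(-1)^{|a_1||a_2|}\sum_{i\ge0}\frac1{i+1}\mathrm{Res}_w\mathrm{Res}_z\,z^iw^{-i-1}(b_{-1}a_2)(w)a_1(z)a_3$;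 on $\mathcal F$: $\mu=\mu_0+O(h)$, $m=m_0+O(h)$, $n=n_0+O(h)$, $\{\cdot,\cdot\}=h\{\cdot,\cdot\}_0+O(h^2)$. **Deformation.** With $f_i=cp_i$: $R_0^\eta=\sum_{i,j}\eta^{ij}\mu_0(f_i,\{f_j,\cdot\}_0)$, $Q^\eta=Q+R_0^\eta$, $\mu_0^\eta=\mu_0+\nu_0^\eta$ with $\nu_0^\eta(a_1,a_2)=\sum_{i,j}\eta^{ij}\big(n_0(f_i,\{f_j,a_1\}_0,a_2)-m_0(f_i,a_1)\{f_j,a_2\}_0\big)$ (in the last term, the product $\mu_0$ of $m_0(f_i,a_1)$ with $\{f_j,a_2\}_0$), and $n_0^\eta=n_0$. These are extended to $\mathcal F\otimes U(\mathfrak g)$, with $U(\mathfrak g)$ the universal enveloping algebra, by multiplying the $U(\mathfrak g)$ factors in order, e.g. $\mu_0^\eta(a_1\otimes x_1,a_2\otimes x_2)=\mu_0^\eta(a_1,a_2)\otimes x_1x_2$; the equation is an equation in $\mathcal F\otimes U(\mathfrak g)$.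
   Formalization: 𝒜_i and Φ_i carry a factor 1/2, since as written 𝒜_i varies by 2∂_iu+[𝒜_i,u]. v ranges over O_M⊗U(g), since the equation puts −½Σ(A^iB_i+B_iA^i) in v, not in O_M⊗g. Equivalence: (A,B) extends to a solution, with unique v, iff the system holds. *)

(* Defs.v *)
From HB Require Import structures.
From mathcomp Require Import all_boot all_order all_algebra.
From mathcomp Require Import finmap multiset monalg.
From mathcomp Require Import boolp classical_sets functions fsbigop reals.
From mathcomp Require Import complex.

Set Implicit Arguments.
Unset Strict Implicit.
Unset Printing Implicit Defensive.

Import GRing.Theory.

Local Open Scope classical_set_scope.
Local Open Scope ring_scope.
Local Open Scope quotient_scope.

Section Tensor.
Context (K : fieldType).

Definition bilin (M N W : lmodType K) (f : M -> N -> W) : Prop :=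
  (forall n, linear (fun m => f m n)) /\ (forall m, linear (f m)).

Section Construction.
Context (M N : lmodType K).

(* [s] stands for \sum_((a, x) <- s) a (x) x; two formal sums are the same
   tensor when no bilinear map separates them. *)
Definition tens_eqv : rel (seq (M * N)) := fun s t =>
  `[< forall (W : lmodType K) (f : M -> N -> W), bilin f ->
      \sum_(p <- s) f p.1 p.2 = \sum_(p <- t) f p.1 p.2 >].

Lemma tens_eqv_refl : reflexive tens_eqv.
Proof. by move=> s; apply/asboolP. Qed.

Lemma tens_eqv_sym : symmetric tens_eqv.
Proof.
by move=> s t; apply/asboolP/asboolP => h W f /h.
Qed.

Lemma tens_eqv_trans : transitive tens_eqv.
Proof.
move=> t s u /asboolP st /asboolP tu; apply/asboolP => W f bf.
by rewrite st ?tu.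
Qed.

Canonical tens_equiv :=
  EquivRel tens_eqv tens_eqv_refl tens_eqv_sym tens_eqv_trans.

Definition tensor := {eq_quot tens_equiv}.
HB.instance Definition _ := Choice.on tensor.
HB.instance Definition _ := EqQuotient.on tensor.

Definition tens (a : M) (x : N) : tensor := \pi_tensor [:: (a, x)].

Definition tlift (W : lmodType K) (f : M -> N -> W) (t : tensor) : W :=
  \sum_(p <- repr t) f p.1 p.2.

Lemma tlift_pi (W : lmodType K) (f : M -> N -> W) s : bilin f ->
  tlift f (\pi_tensor s) = \sum_(p <- s) f p.1 p.2.
Proof.
move=> bf; rewrite /tlift.
have /eqmodP/asboolP : repr (\pi_tensor s) = s %[mod tensor] by rewrite reprK.
exact.
Qed.

Lemma tensorP (s t : tensor) :
  (forall (W : lmodType K) (f : M -> N -> W), bilin f -> tlift f s = tlift f t)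
  <-> s = t.
Proof.
split=> [h|->//]; rewrite -(reprK s) -(reprK t).
by apply/eqmodP/asboolP => W f bf; rewrite -!tlift_pi ?reprK //; apply: h.
Qed.

Lemma tlift_tens (W : lmodType K) (f : M -> N -> W) a x : bilin f ->
  tlift f (tens a x) = f a x.
Proof. by move=> bf; rewrite tlift_pi // big_seq1. Qed.

Definition tens0 : tensor := \pi_tensor [::].
Definition tensD (s t : tensor) : tensor := \pi_tensor (repr s ++ repr t).
Definition tensZ (c : K) (s : tensor) : tensor :=
  \pi_tensor [seq (c *: p.1, p.2) | p <- repr s].
Definition tensN (s : tensor) : tensor := tensZ (-1) s.

Lemma tlift0 (W : lmodType K) (f : M -> N -> W) : bilin f -> tlift f tens0 = 0.
Proof. by move=> bf; rewrite tlift_pi // big_nil. Qed.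

Lemma tliftD (W : lmodType K) (f : M -> N -> W) s t : bilin f ->
  tlift f (tensD s t) = tlift f s + tlift f t.
Proof. by move=> bf; rewrite tlift_pi // big_cat. Qed.

Lemma tliftZ (W : lmodType K) (f : M -> N -> W) c s : bilin f ->
  tlift f (tensZ c s) = c *: tlift f s.
Proof.
move=> bf; rewrite tlift_pi // big_map scaler_sumr; apply: eq_bigr => p _ /=.
exact: (scalable_linear (bf.1 p.2)).
Qed.

Lemma tensDA : associative tensD.
Proof. by move=> s t u; apply/tensorP => W f bf; rewrite !tliftD // addrA. Qed.

Lemma tensDC : commutative tensD.
Proof. by move=> s t; apply/tensorP => W f bf; rewrite !tliftD // addrC. Qed.

Lemma tens0D : left_id tens0 tensD.
Proof. by move=> s; apply/tensorP => W f bf; rewrite tliftD // tlift0 // add0r. Qed.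

Lemma tensND : left_inverse tens0 tensN tensD.
Proof.
move=> s; apply/tensorP => W f bf.
by rewrite tliftD // tliftZ // tlift0 // scaleN1r addNr.
Qed.

HB.instance Definition _ :=
  GRing.isZmodule.Build tensor tensDA tensDC tens0D tensND.

Lemma tensZA a b s : tensZ a (tensZ b s) = tensZ (a * b) s.
Proof. by apply/tensorP => W f bf; rewrite !tliftZ // scalerA. Qed.

Lemma tens1Z : left_id 1 tensZ.
Proof. by move=> s; apply/tensorP => W f bf; rewrite tliftZ // scale1r. Qed.

Lemma tensZDr : right_distributive tensZ +%R.
Proof.
by move=> c s t; apply/tensorP => W f bf; rewrite !(tliftZ, tliftD) // scalerDr.
Qed.

Lemma tensZDl s : {morph tensZ^~ s : a b / a + b}.
Proof.
by move=> a b; apply/tensorP => W f bf; rewrite !(tliftZ, tliftD) // scalerDl.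
Qed.

HB.instance Definition _ :=
  GRing.Zmodule_isLmodule.Build K tensor tensZA tens1Z tensZDr tensZDl.

End Construction.

(* Extensions to tensor products of a map f (x) g, and of a pair of bilinear
   (trilinear) maps: (a (x) x, b (x) y) |-> op a b (x) m x y, and so on. *)
Definition tmap (M N M' N' : lmodType K) (f : M -> M') (g : N -> N')
    (t : tensor M N) : tensor M' N' :=
  tlift (fun a x => tens (f a) (g x)) t.

Definition tmap2 (M1 M2 M3 N1 N2 N3 : lmodType K)
    (op : M1 -> M2 -> M3) (m : N1 -> N2 -> N3)
    (s : tensor M1 N1) (t : tensor M2 N2) : tensor M3 N3 :=
  tlift (fun a x => tmap (op a) (m x) t) s.

Definition tmap3 (M1 M2 M3 M4 N1 N2 N3 N4 : lmodType K)
    (op : M1 -> M2 -> M3 -> M4) (m : N1 -> N2 -> N3 -> N4)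
    (s : tensor M1 N1) (t : tensor M2 N2) (r : tensor M3 N3) : tensor M4 N4 :=
  tlift (fun a x => tmap2 (op a) (m x) t r) s.

End Tensor.

Record lieBracket (K : fieldType) (g : lmodType K) := LieBracket {
  lie_op :> g -> g -> g;
  lie_bilin : bilin lie_op;
  lie_alt : forall x, lie_op x x = 0;
  lie_jacobi : forall x y z,
    lie_op x (lie_op y z) + lie_op y (lie_op z x) + lie_op z (lie_op x y) = 0
}.

Definition lie_to_assoc (K : fieldType) (g : lmodType K) (br : lieBracket g)
    (U : algType K) (f : {linear g -> U}) : Prop :=
  forall x y, f (br x y) = f x * f y - f y * f x.

Definition enveloping (K : fieldType) (g : lmodType K) (br : lieBracket g)
    (U : algType K) (iota : {linear g -> U}) : Prop :=
  lie_to_assoc br iota /\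
  forall (A : algType K) (f : {linear g -> A}), lie_to_assoc br f ->
    exists2 phi : {lrmorphism U -> A}, (forall x, phi (iota x) = f x) &
      forall psi : {lrmorphism U -> A},
        (forall x, psi (iota x) = f x) -> psi =1 phi.

Section BetaGamma.
Context (K : fieldType) (D : nat).

Definition mindex := {ffun 'I_D -> nat}.

(* Only the vector space structure is inherited from functions: the ring
   structure of functions is pointwise, whereas series multiply by [psmul]. *)
Definition pseries := mindex -> K^o.
HB.instance Definition _ := GRing.Lmodule.copy pseries (mindex -> K^o).

Definition psmul (u v : pseries) : pseries := fun a =>
  \sum_(p \in [set p : mindex * mindex | [ffun i => (p.1 i + p.2 i)%N] = a])
    (u p.1 * v p.2).

Definition psone : pseries := fun a => (a == [ffun=> 0%N])%:R.

Definition pscoord (i : 'I_D) : pseries := fun a =>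
  (a == [ffun j => (j == i) : nat])%:R.

Definition pderiv (i : 'I_D) (u : pseries) : pseries := fun a =>
  (a i).+1%:R * u [ffun j => (a j + (j == i))%N].

(* The Taylor coefficient (1 / a!) d^a u. *)
Definition taylor (a : mindex) (u : pseries) : pseries :=
  ((\prod_(i < D) (a i)`!)%:R^-1 : K) *:
    foldr (fun i => iter (a i) (pderiv i)) u (enum 'I_D).

(* [inl (i, n)] is p_{i, -n-1} and [inr (i, n)] is X^i_{-n-1}. *)
Definition mgen := ('I_D * nat + 'I_D * nat)%type.
(* [inl n] is b_{-n-2} and [inr n] is c_{1-n}. *)
Definition ggen := (nat + nat)%type.

(* The key (r, m, S) stands for h^r times the monomial m in the p_{i,-n} and
   X^i_{-n} (n > 0) times the product of the ghost modes in S, taken in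
   increasing order of [gcode] and applied to the ghost vacuum. *)
Definition basis := (int * {mset mgen}%mset * {fset ggen})%type.

Definition gcode (e : ggen) : nat :=
  match e with inr n => n.*2 | inl n => n.*2.+1 end.

Definition state := {malg pseries[basis]}.
HB.instance Definition _ := GRing.Zmodule.on state.

Definition stZ (c : K) (x : state) : state :=
  [malg k in msupp x => c *: x@_k].

Lemma stZE c x k : (stZ c x)@_k = c *: x@_k.
Proof. by rewrite mcoeffE; case: msuppP; rewrite ?scaler0. Qed.

Lemma stZA a b x : stZ a (stZ b x) = stZ (a * b) x.
Proof. by apply/malgP => k; rewrite !stZE scalerA. Qed.

Lemma st1Z : left_id 1 stZ.
Proof. by move=> x; apply/malgP => k; rewrite stZE scale1r. Qed.

Lemma stZDr : right_distributive stZ +%R.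
Proof. by move=> c x y; apply/malgP => k; rewrite !(stZE, mcoeffD) scalerDr. Qed.

Lemma stZDl x : {morph stZ^~ x : a b / a + b}.
Proof. by move=> a b; apply/malgP => k; rewrite !(stZE, mcoeffD) scalerDl. Qed.

HB.instance Definition _ :=
  GRing.Zmodule_isLmodule.Build K state stZA st1Z stZDr stZDl.

Definition mono (r : int) (m : seq mgen) (S : seq ggen) (u : pseries) : state :=
  << u *g (r, seq_mset m, [fset e in S]%fset) >>.

Definition vac : state := mono 0 [::] [::] psone.

Definition hpow (r : int) (x : state) : state :=
  \sum_(k <- msupp x) << x@_k *g (k.1.1 + r, k.1.2, k.2) >>.

Definition onps (f : pseries -> pseries) (x : state) : state :=
  \sum_(k <- msupp x) << f x@_k *g k >>.

Definition mcreate (g : mgen) (x : state) : state :=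
  \sum_(k <- msupp x) << x@_k *g (k.1.1, (g +` k.1.2)%mset, k.2) >>.

Definition mderiv (g : mgen) (x : state) : state :=
  \sum_(k <- msupp x)
    << (k.1.2 g)%:R *: x@_k *g (k.1.1, (k.1.2 `\ g)%mset, k.2) >>.

Definition gsign (e : ggen) (S : {fset ggen}) : K :=
  (-1) ^+ count (fun f => gcode f < gcode e)%N S.

Definition gcreate (e : ggen) (x : state) : state :=
  \sum_(k <- msupp x | e \notin k.2)
    << gsign e k.2 *: x@_k *g (k.1, (e |` k.2)%fset) >>.

Definition gdelete (e : ggen) (x : state) : state :=
  \sum_(k <- msupp x | e \in k.2)
    << gsign e k.2 *: x@_k *g (k.1, (k.2 `\ e)%fset) >>.

(* [X^i_n, p_{j,m}] = h delta_{ij} delta_{n+m,0}, i.e. X^i(z) p_j(w) ~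
   h delta_{ij} / (z - w); in particular p_{i,0} = - h d/dX_0^i. *)
Definition Xmode (i : 'I_D) (n : int) (x : state) : state :=
  match n with
  | Negz m => mcreate (inr (i, m)) x
  | Posz 0 => onps (psmul (pscoord i)) x
  | Posz m.+1 => hpow 1 (mderiv (inl (i, m)) x)
  end.

Definition pmode (i : 'I_D) (n : int) (x : state) : state :=
  match n with
  | Negz m => mcreate (inl (i, m)) x
  | Posz 0 => - hpow 1 (onps (pderiv i) x)
  | Posz m.+1 => - hpow 1 (mderiv (inr (i, m)) x)
  end.

Definition bmode (n : int) (x : state) : state :=
  match n with
  | Negz m.+1 => gcreate (inl m) x
  | Negz 0 => gdelete (inr 0%N) x
  | Posz m => gdelete (inr m.+1) x
  end.

Definition cmode (n : int) (x : state) : state :=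
  match n with
  | Negz m => gcreate (inr m.+2) x
  | Posz 0 => gcreate (inr 1%N) x
  | Posz 1 => gcreate (inr 0%N) x
  | Posz m.+2 => gdelete (inl m) x
  end.

(* [F n] is the coefficient of z^n. All sums over infinite index sets below are
   locally finite (finitely many nonzero terms on each state). *)
Definition field := int -> state -> state.

Definition Xfield (i : 'I_D) : field := fun n => Xmode i (- n).
Definition pfield (i : 'I_D) : field := fun n => pmode i (- n - 1).
Definition bfield : field := fun n => bmode (- n - 2).
Definition cfield : field := fun n => cmode (1 - n).

Definition fderiv (F : field) : field := fun n x => (n + 1)%:~R *: F (n + 1) x.
Definition fdivd (k : nat) (F : field) : field := fun n x =>
  (k`!%:R^-1 : K) *: iter k fderiv F n x.

(* :A B: = A_+ B + (-1)^{|A||B|} B A_-, where A_+ collects the powers z^n,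
   n >= 0, and A_- the powers z^n, n < 0; [odd] is the truth value of
   "A and B are both odd". *)
Definition nprod (odd : bool) (A B : field) : field := fun n x =>
  \sum_(k \in [set: nat]) A k%:Z (B (n - k%:Z) x) +
  (-1) ^+ odd *: \sum_(k \in [set: nat]) B (n + k.+1%:Z) (A (- k.+1%:Z) x).

Definition idfield : field := fun n x => if n == 0 then x else 0.

(* X^i(z) - X^i_0. *)
Definition Xosc (i : 'I_D) : field := fun n x =>
  if n == 0 then 0 else Xfield i n x.

(* u(X(z)) by Taylor expansion around X_0. *)
Definition psfield (u : pseries) : field := fun n x =>
  \sum_(a \in [set: mindex])
    onps (psmul (taylor a u))
      (foldr (fun i => iter (a i) (nprod false (Xosc i))) idfield
         (enum 'I_D) n x).

(* The fields of the states p_{i,-n-1} 1, X^i_{-n-1} 1, b_{-n-2} 1, c_{1-n} 1. *)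
Definition mgfield (g : mgen) : field :=
  match g with
  | inl (i, n) => fdivd n (pfield i)
  | inr (i, n) => fdivd n.+1 (Xfield i)
  end.

Definition ggfield (e : ggen) : field :=
  match e with inl n => fdivd n bfield | inr n => fdivd n cfield end.

Definition mnprod (m : seq mgen) (F : field) : field :=
  foldr (fun g => nprod false (mgfield g)) F m.

Fixpoint gnprod (s : seq ggen) (F : field) : field :=
  if s is e :: s' then nprod (odd (size s')) (ggfield e) (gnprod s' F) else F.

Definition gsort (S : {fset ggen}) : seq ggen :=
  sort (fun e f => gcode e <= gcode f)%N S.

(* Y(a_1 ... a_r u 1, z) = :a_1(z) ... a_r(z) u(X(z)):, a_j(z) being the field of
   the mode a_j, with nested normal ordering. *)
Definition Y (a : state) : field := fun n x =>
  \sum_(k <- msupp a)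
    hpow k.1.1 (gnprod (gsort k.2) (mnprod (enum_mset k.1.2) (psfield a@_k)) n x).

Definition Lfield : field := fun n x =>
  - hpow (-1) (\sum_(i < D) nprod false (pfield i) (fderiv (Xfield i)) n x).

Definition brst (x : state) : state :=
  nprod false cfield Lfield (-1) x
  + nprod false cfield (nprod true (fderiv cfield) bfield) (-1) x
  + (3%:R / 2%:R : K) *: fderiv (fderiv cfield) (-1) x.

(* The natural number arguments are ghost numbers. *)
Definition mu_op (a1 a2 : state) : state := Y a1 0 a2.

Definition br_op (k1 : nat) (a1 a2 : state) : state :=
  (-1) ^+ k1 *: Y (bmode (-1) a1) (-1) a2.

Definition m_op (a1 a2 : state) : state :=
  \sum_(i \in [set: nat]) ((-1) ^+ i / i.+1%:R : K) *:
    bmode (-1) (Y (Y a1 (- i.+1%:Z) a2) i%:Z vac).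

Definition n_op (k1 k2 : nat) (a1 a2 a3 : state) : state :=
  \sum_(i \in [set: nat]) (i.+1%:R^-1 : K) *:
    Y (bmode (-1) a1) i%:Z (Y a2 (- i.+1%:Z) a3)
  + (-1) ^+ (k1 * k2) *: \sum_(i \in [set: nat]) (i.+1%:R^-1 : K) *:
    Y (bmode (-1) a2) i%:Z (Y a1 (- i.+1%:Z) a3).

Definition vect := 'I_D -> pseries.
HB.instance Definition _ := GRing.Lmodule.copy vect ('I_D -> pseries).

(* V^0 x (V^1 x V^0) x (V^1 x V^0) x V^0, the components being F_0, ..., F_3,
   and V^1 = TM x T*M. *)
Definition lightF :=
  (pseries * (vect * vect * pseries) * (vect * vect * pseries) * pseries)%type.
HB.instance Definition _ := GRing.Lmodule.copy lightF
  (pseries * (vect * vect * pseries) * (vect * vect * pseries) * pseries)%type.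

Definition F0 (a : lightF) : pseries := a.1.1.1.
Definition F1 (a : lightF) : vect * vect * pseries := a.1.1.2.
Definition F2 (a : lightF) : vect * vect * pseries := a.1.2.
Definition F3 (a : lightF) : pseries := a.2.

Definition ghost_part (k : 'I_4) (a : lightF) : lightF :=
  match val k with
  | 0 => (F0 a, 0, 0, 0)
  | 1 => (0, F1 a, 0, 0)
  | 2 => (0, 0, F2 a, 0)
  | _ => (0, 0, 0, F3 a)
  end.

Definition pgen (i : 'I_D) : mgen := inl (i, 0%N).
Definition dXgen (i : 'I_D) : mgen := inr (i, 0%N).
Definition c_ : ggen := inr 0%N.
Definition dc_ : ggen := inr 1%N.
(* The state of d^2 c is 2 c_{-1} 1, whence the factors 2 below. *)
Definition hd2c_ : ggen := inr 2%N.

Definition V1mono (r : int) (S : seq ggen) (AB : vect * vect) : state :=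
  \sum_(i < D) mono r [:: pgen i] S (AB.1 i)
  + \sum_(i < D) mono r [:: dXgen i] S (AB.2 i).

Definition Fstate (a : lightF) : state :=
  mono 0 [::] [::] (F0 a)
  + (V1mono 0 [:: c_] (F1 a).1 + mono 1 [::] [:: dc_] (F1 a).2)
  + (V1mono 1 [:: c_; dc_] (F2 a).1
     + 2%:R *: mono 1 [::] [:: c_; hd2c_] (F2 a).2)
  + 2%:R *: mono 2 [::] [:: c_; dc_; hd2c_] (F3 a).

Definition scoef (r : int) (m : seq mgen) (S : seq ggen) (x : state) : pseries :=
  x@_(r, seq_mset m, [fset e in S]%fset).

(* The coefficient of h^r of an element of F[h^-1, h]. The states of F[h^-1, h]
   are those of total conformal weight 0, and the operations above preserve this
   weight, so nothing is lost by reading off these components only. Q maps F to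
   itself; mu, m, n map F to F[h] and { , } maps F to h F[h], so that [mu0],
   [m0], [n0] and [br0] are the leading coefficients. *)
Definition hcoef (r : int) (x : state) : lightF :=
  (scoef r [::] [::] x,
   (fun i => scoef r [:: pgen i] [:: c_] x,
    fun i => scoef r [:: dXgen i] [:: c_] x,
    scoef (r + 1) [::] [:: dc_] x),
   (fun i => scoef (r + 1) [:: pgen i] [:: c_; dc_] x,
    fun i => scoef (r + 1) [:: dXgen i] [:: c_; dc_] x,
    (2%:R^-1 : K) *: scoef (r + 1) [::] [:: c_; hd2c_] x),
   (2%:R^-1 : K) *: scoef (r + 2) [::] [:: c_; dc_; hd2c_] x).

Definition QF (a : lightF) : lightF := hcoef 0 (brst (Fstate a)).

Definition mu0 (a b : lightF) : lightF :=
  hcoef 0 (mu_op (Fstate a) (Fstate b)).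

Definition br0 (a b : lightF) : lightF :=
  \sum_(k < 4) hcoef 1 (br_op k (Fstate (ghost_part k a)) (Fstate b)).

Definition m0 (a b : lightF) : lightF :=
  hcoef 0 (m_op (Fstate a) (Fstate b)).

Definition n0 (a b c : lightF) : lightF :=
  \sum_(k < 4) \sum_(l < 4)
    hcoef 0 (n_op k l (Fstate (ghost_part k a)) (Fstate (ghost_part l b))
               (Fstate c)).

Definition single (i : 'I_D) (u : pseries) : vect :=
  fun j => if j == i then u else 0.

Definition inF0 (u : pseries) : lightF := (u, 0, 0, 0).
Definition inA (i : 'I_D) (u : pseries) : lightF := (0, (single i u, 0, 0), 0, 0).
Definition inB (i : 'I_D) (u : pseries) : lightF := (0, (0, single i u, 0), 0, 0).
Definition inv1 (u : pseries) : lightF := (0, (0, 0, u), 0, 0).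

Definition fbg (i : 'I_D) : lightF := inA i psone.

Context (eta : 'M[K]_D).

Definition R0eta (a : lightF) : lightF :=
  \sum_i \sum_j eta i j *: mu0 (fbg i) (br0 (fbg j) a).

Definition Qeta (a : lightF) : lightF := QF a + R0eta a.

Definition nu0eta (a b : lightF) : lightF :=
  \sum_i \sum_j eta i j *:
    (n0 (fbg i) (br0 (fbg j) a) b - mu0 (m0 (fbg i) a) (br0 (fbg j) b)).

Definition mu0eta (a b : lightF) : lightF := mu0 a b + nu0eta a b.

Definition n0eta : lightF -> lightF -> lightF -> lightF := n0.

Section Fields.
Context (g : lmodType K) (U : algType K) (iota : g -> U).

Definition QetaU (s : tensor lightF U) : tensor lightF U := tmap Qeta id s.

Definition mu0etaU (s t : tensor lightF U) : tensor lightF U :=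
  tmap2 mu0eta *%R s t.

Definition n0etaU (s t r : tensor lightF U) : tensor lightF U :=
  tmap3 n0eta (fun x y z => x * y * z) s t r.

Definition embU (s : tensor pseries g) : tensor pseries U := tmap id iota s.

(* c (A + B) + h dc v. The component v is auxiliary and takes values in U: the
   c d^2c component of the Yang-Mills equation reads
   v = - 1/2 \sum_i (d_i A^i + \sum_j eta^{ij} d_i B_j + A^i B_i + B_i A^i),
   whose last two terms do not lie in g. *)
Definition Psi (A B : 'I_D -> tensor pseries g) (v : tensor pseries U) :
    tensor lightF U :=
  \sum_i tmap (inA i) id (embU (A i)) + \sum_i tmap (inB i) id (embU (B i))
  + tmap inv1 id v.

Definition gauge0 (u : tensor pseries g) : tensor lightF U :=
  tmap inF0 id (embU u).

End Fields.

(* The fields A_i (calA) and Phi_i of the components (A, B). The factor 1/2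
   normalizes the gauge variation: Q^eta u has components A^i = \sum_j eta^{ij}
   d_j u and B_i = d_i u, so that B_i + \sum_j eta_{ij} A^j varies by 2 d_i u. *)
Definition calA (N : lmodType K) (A B : 'I_D -> tensor pseries N) (i : 'I_D) :
    tensor pseries N :=
  (2%:R^-1 : K) *: (B i + \sum_j invmx eta i j *: A j).

Definition Phi (N : lmodType K) (A B : 'I_D -> tensor pseries N) (i : 'I_D) :
    tensor pseries N :=
  (2%:R^-1 : K) *: (B i - \sum_j invmx eta i j *: A j).

Definition dtens (N : lmodType K) (i : 'I_D) (s : tensor pseries N) :
    tensor pseries N := tmap (pderiv i) id s.

Definition liemul (g : lmodType K) (br : lieBracket g)
  (s t : tensor pseries g) : tensor pseries g := tmap2 psmul br s t.

(* nabla_i = d_i + A_i acts on O_M (x) U, which is a faithful module, so that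
   commutators of such operators determine the commutators in the algebra. *)
Definition opmul (U : algType K) (s t : tensor pseries U) : tensor pseries U :=
  tmap2 psmul *%R s t.

Definition opnabla (U : algType K) (cA : 'I_D -> tensor pseries U) (i : 'I_D)
  (s : tensor pseries U) : tensor pseries U := dtens i s + opmul (cA i) s.

Definition opcomm (V : zmodType) (f h : V -> V) (s : V) : V :=
  f (h s) - h (f s).

End BetaGamma.

(* Main.v *)
(* All the operations are bilinear or trilinear, so they are determined by their
   leading coefficients on series A, B, v; these come from finitely many
   contractions. In the algebra T = O_M (x) U, with A = eta a, X = A + eta B and
   N = \sum_l (A^l B_l + B_l A^l), the components of the generalized Maurer-Cartan
   equation along T*M and (after lowering the index) TM are, for C = B and C = a,
     P_k + eta^{ij} d_i d_j C_k + [X^j, d_j C_k] + [C_k, v] + C_k N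
       - \sum_l (A^l C_k B_l + B_l C_k A^l) = 0,
     P_k = d_k v + \sum_l (d_k A^l B_l + d_k B_l A^l),
   while the remaining one reads v = - eta^{ij} (d_i calA_j + calA_i calA_j
   - Phi_i Phi_j). Apart from P_k the equation is linear in C; substituting v, it
   becomes eta^{ij} ([nabla_i, [nabla_j, C_k]] - [Phi_i, [Phi_j, C_k]]). Half the
   difference of the two equations is this for C = Phi, the second Yang-Mills
   equation, and half their sum is P_k plus this for C = calA, the first one.
   Since T is unital, operators of multiplication on T determine their symbols. *)

From HB Require Import structures.
Require Import Defs.
From mathcomp Require Import all_boot all_order all_algebra.
From mathcomp Require Import finmap multiset monalg.
From mathcomp Require Import boolp classical_sets functions cardinality fsbigop reals.
From mathcomp Require Import complex zify ring.
From Stdlib Require Ncring Ncring_tac.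

Set Implicit Arguments.
Unset Strict Implicit.
Unset Printing Implicit Defensive.

Import Order.TTheory GRing.Theory Num.Theory.

Local Open Scope classical_set_scope.
Local Open Scope ring_scope.
Local Open Scope quotient_scope.

(** * Linear maps and states *)

(** The sums over infinite index sets take the default value 0 when their support is infinite, so
    even additivity of an operation needs local finiteness. For u(X(z)) this comes from the weight
    of the p's: contracting X(z) with p_{i,-n} uses up weight n and lowers the power of z by n, so
    on a given state and for a given power of z only finitely many Taylor terms survive. The second
    device is the filtration by powers of h: matter contractions never lower the power of h and each
    ghost sector of F is read at a fixed power, so a correction is discarded once its order and
    sector are known. Only L escapes, because of its prefactor 1/h, and its modes are computed
    exactly. The ghost c lowers the order of poles, which reduces the series in m and n to their
    first term. The final noncommutative identities hold only after symmetrizing the two indices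
    contracted with eta, hence the use of the symmetry of eta and of division by 2; this symmetry
    also gives X = 2 eta calA, so that the first order terms see the connection alone. *)

Section LinearMaps.
Context (K : fieldType).
Implicit Types V W X : lmodType K.

Section One.
Context (V W : lmodType K) (f : V -> W) (lf : linear f).

Lemma linD x y : f (x + y) = f x + f y.
Proof. by rewrite -[x in x + y]scale1r lf scale1r. Qed.

Lemma lin0 : f 0 = 0.
Proof. by apply: (addrI (f 0)); rewrite -linD !addr0. Qed.

Lemma linZ a x : f (a *: x) = a *: f x.
Proof. by rewrite -[a *: x]addr0 lf lin0 addr0. Qed.

Lemma linN x : f (- x) = - f x.
Proof. by rewrite -scaleN1r linZ scaleN1r. Qed.

Lemma linB x y : f (x - y) = f x - f y.
Proof. by rewrite linD linN. Qed.

Lemma lin_sum I (s : seq I) P (F : I -> V) :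
  f (\sum_(i <- s | P i) F i) = \sum_(i <- s | P i) f (F i).
Proof. by elim/big_rec2: _ => [|i y x _ <-]; rewrite ?lin0 ?linD. Qed.

End One.

Lemma lin_const0 V W : linear (fun _ : V => 0 : W).
Proof. by move=> a x y; rewrite scaler0 addr0. Qed.

Lemma lin_id V : linear (fun x : V => x).
Proof. by []. Qed.

Lemma lin_comp V W X (g : W -> X) (f : V -> W) :
  linear g -> linear f -> linear (fun x => g (f x)).
Proof. by move=> lg lf a x y; rewrite lf lg. Qed.

Lemma lin_add V W (f g : V -> W) :
  linear f -> linear g -> linear (fun x => f x + g x).
Proof.
by move=> lf lg a x y; rewrite lf lg scalerDr !addrA; congr (_ + _); rewrite addrAC.
Qed.

Lemma lin_scale V W (c : K) (f : V -> W) : linear f -> linear (fun x => c *: f x).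
Proof. by move=> lf a x y; rewrite lf scalerDr !scalerA mulrC. Qed.

Lemma lin_opp V W (f : V -> W) : linear f -> linear (fun x => - f x).
Proof. by move=> lf a x y; rewrite lf opprD scalerN. Qed.

Lemma lin_sub V W (f g : V -> W) :
  linear f -> linear g -> linear (fun x => f x - g x).
Proof. by move=> lf lg; apply: lin_add => //; apply: lin_opp. Qed.

Lemma lin_bigsum V W I (s : seq I) P (f : I -> V -> W) :
  (forall i, linear (f i)) -> linear (fun x => \sum_(i <- s | P i) f i x).
Proof.
move=> lf a x y; rewrite scaler_sumr -big_split /=.
by apply: eq_bigr => i _; rewrite lf.
Qed.

Lemma lin_ext V W (f g : V -> W) : f =1 g -> linear f -> linear g.
Proof. by move=> fg lf a x y; rewrite -!fg lf. Qed.

Lemma lin_iter V (f : V -> V) n : linear f -> linear (iter n f).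
Proof. by move=> lf; elim: n => [//|n IH] a x y /=; rewrite IH lf. Qed.

End LinearMaps.

Lemma fsum_seq (V : zmodType) (I : choiceType) (s : seq I) (F : I -> V) :
  uniq s -> (forall i, i \notin s -> F i = 0) ->
  \sum_(i \in [set: I]) F i = \sum_(i <- s) F i.
Proof.
move=> us F0; rewrite (fsbigE s) //; first by apply: eq_bigl => i; rewrite in_setT.
by move=> i _; exact: F0.
Qed.

(** A finitely supported sum with infinite support is 0 by convention, so such sums are not additive
    in general. Every manipulation below first truncates all sums involved at one common bound. *)
Lemma fsum_nat_trunc (V : zmodType) (f : nat -> V) N :
  (forall k, (N <= k)%N -> f k = 0) ->
  \sum_(k \in [set: nat]) f k = \sum_(k < N) f k.
Proof.
move=> f0; rewrite -(big_mkord xpredT) (fsum_seq (s := index_iota 0 N)) ?iota_uniq // => k.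
by rewrite mem_index_iota /= -leqNgt; exact: f0.
Qed.

Lemma fsum_closed (V : zmodType) (I : choiceType) (S : set I) (P : V -> Prop) F :
  P 0 -> (forall x y, P x -> P y -> P (x + y)) -> (forall i, P (F i)) ->
  P (\sum_(i \in S) F i).
Proof. by move=> P0 PD PF; apply: big_ind. Qed.

(* Locked copies of [mcoeff] and of the singletons of [malg]: they fix the
   algebraic structure found on [pseries], which unification otherwise has to
   rediscover by unfolding. *)
HB.lock Definition coef (K : fieldType) (D : nat) (k : basis D) (x : state K D) :
  pseries K D := x@_k.
HB.lock Definition sng (K : fieldType) (D : nat) (k : basis D) (u : pseries K D) :
  state K D := << u *g k >>.

(** * Coefficients and supports of states *)

Section States.
Context (K : fieldType) (D : nat).
Local Notation state := (state K D).
Local Notation pseries := (pseries K D).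
Local Notation basis := (basis D).
Local Notation mono := (@mono K D).
Implicit Types (x y : state) (k : basis) (u v : pseries) (r : int).

Lemma coefD k x y : coef k (x + y) = coef k x + coef k y.
Proof. rewrite coef.unlock; exact: mcoeffD. Qed.

Lemma coefZ k c x : coef k (c *: x) = c *: coef k x.
Proof. rewrite coef.unlock; exact: stZE. Qed.

Lemma coef_linear k : linear (@coef K D k).
Proof. by move=> a x y; rewrite coefD coefZ. Qed.

Lemma coef_sng k l u : coef k (sng l u) = if l == k then u else 0.
Proof.
have -> : coef k (sng l u) = u *+ (l == k) by rewrite coef.unlock sng.unlock; exact: mcoeffU.
by case: eqP.
Qed.

Lemma coef_sngE k u : coef k (sng k u) = u.
Proof. by rewrite coef_sng eqxx. Qed.

Lemma coefP x y : (forall k, coef k x = coef k y) -> x = y.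
Proof. by rewrite coef.unlock => h; apply/malgP. Qed.

Lemma sng_linear k : linear (@sng K D k).
Proof.
move=> a u v; apply: coefP => l; rewrite coefD coefZ !coef_sng.
by case: eqP => _ //; rewrite scaler0 addr0.
Qed.

Lemma coef_out k x : k \notin msupp x -> coef k x = 0.
Proof. by rewrite coef.unlock; exact: mcoeff_outdom. Qed.

Lemma msupp_coef k x : (k \in msupp x) = (coef k x != 0).
Proof. by rewrite coef.unlock mcoeff_neq0. Qed.

Lemma state_sum x : x = \sum_(k <- msupp x) sng k (coef k x).
Proof. by rewrite coef.unlock sng.unlock; exact: monalgE. Qed.

Section Lift.
Variable G : basis -> pseries -> state.
Hypothesis lG : forall k, linear (G k).

(** Cancellation makes the support of a linear combination unpredictable; summing over any larger
    finite set of keys gives the same value, and one such set serves all terms of a combination. *)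
Lemma msupp_sum_widen x (A : {fset basis}) : (msupp x `<=` A)%fset ->
  \sum_(k <- msupp x) G k (coef k x) = \sum_(k <- A) G k (coef k x).
Proof.
move=> xA; apply: big_fset_incl => // k _ kx.
by rewrite coef_out // (lin0 (lG k)).
Qed.

Lemma msupp_sum_linear : linear (fun x => \sum_(k <- msupp x) G k (coef k x)).
Proof.
move=> a x y.
pose A := (msupp (a *: x + y) `|` (msupp x `|` msupp y))%fset.
rewrite (@msupp_sum_widen (a *: x + y) A) ?fsubsetUl //.
rewrite (@msupp_sum_widen x A); last by rewrite fsubsetU // fsubsetUl orbT.
rewrite (@msupp_sum_widen y A); last by rewrite fsubsetU // fsubsetUr orbT.
rewrite scaler_sumr -big_split /=; apply: eq_bigr => k _.
by rewrite coefD coefZ lG.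
Qed.

Lemma msupp_sum_sng u k :
  \sum_(l <- msupp (sng k u)) G l (coef l (sng k u)) = G k u.
Proof.
have sk : (msupp (sng k u) `<=` [fset k])%fset by rewrite sng.unlock msuppU_le.
by rewrite (msupp_sum_widen sk) big_seq_fset1 coef_sngE.
Qed.

End Lift.

Lemma state_ext (V : lmodType K) (f h : state -> V) : linear f -> linear h ->
  (forall k u, f (sng k u) = h (sng k u)) -> f =1 h.
Proof.
move=> lf lh fh x; rewrite [x]state_sum (lin_sum lf) (lin_sum lh).
by apply: eq_bigr.
Qed.

(** All filtrations used below (bounded modes, weight of the p's, order in h within a ghost sector)
    have this form, so an operator is tracked only through its effect on keys. *)
Definition supp_in (P : basis -> Prop) x := forall k, coef k x != 0 -> P k.

Lemma supp_in0 P : supp_in P 0.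
Proof. by move=> k; rewrite (lin0 (coef_linear k)) eqxx. Qed.

Lemma supp_inD P x y : supp_in P x -> supp_in P y -> supp_in P (x + y).
Proof.
move=> Px Py k; rewrite coefD; case: (eqVneq (coef k x) 0) => [->|/Px //].
by rewrite add0r; exact: Py.
Qed.

Lemma supp_inZ P c x : supp_in P x -> supp_in P (c *: x).
Proof.
move=> Px k; rewrite coefZ => xk; apply: Px.
by apply: contra_neq xk => ->; rewrite scaler0.
Qed.

Lemma supp_inN P x : supp_in P x -> supp_in P (- x).
Proof. by rewrite -scaleN1r; exact: supp_inZ. Qed.

Lemma supp_in_sum P I (s : seq I) (Q : pred I) (F : I -> state) :
  (forall i, Q i -> supp_in P (F i)) -> supp_in P (\sum_(i <- s | Q i) F i).
Proof. by move=> PF; apply: big_ind => //; [exact: supp_in0|exact: supp_inD]. Qed.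

Lemma supp_in_fsum P (I : choiceType) (S : set I) (F : I -> state) :
  (forall i, supp_in P (F i)) -> supp_in P (\sum_(i \in S) F i).
Proof. by move=> PF; apply: fsum_closed => //; [exact: supp_in0|exact: supp_inD]. Qed.

Lemma supp_in_sng (P : basis -> Prop) k u : P k -> supp_in P (sng k u).
Proof. by move=> Pk l; rewrite coef_sng; case: (k =P l) => [<- //|_ /eqP]. Qed.

Lemma supp_in_msupp_sum (P Q : basis -> Prop) (G : basis -> pseries -> state) x :
  supp_in P x -> (forall k u, P k -> supp_in Q (G k u)) ->
  supp_in Q (\sum_(k <- msupp x) G k (coef k x)).
Proof.
move=> Px PQ; rewrite big_seq_cond; apply: supp_in_sum => k.
by rewrite andbT msupp_coef => /Px; exact: PQ.
Qed.

Lemma sub_supp_in (P Q : basis -> Prop) x :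
  (forall k, P k -> Q k) -> supp_in P x -> supp_in Q x.
Proof. by move=> PQ Px k /Px; exact: PQ. Qed.

End States.

(** * Power series *)

Section PowerSeries.
Context (K : fieldType) (D : nat).
Local Notation mindex := (mindex D).
Local Notation pseries := (pseries K D).
Implicit Types (a b c : mindex) (u v w : pseries) (i j : 'I_D).

Definition mzero : mindex := [ffun=> 0%N].
Definition munit j : mindex := [ffun i => (i == j) : nat].
Definition madd a b : mindex := [ffun i => (a i + b i)%N].

Lemma pseriesP u v : (forall a, u a = v a) -> u = v.
Proof. by move=> uv; apply/funext. Qed.

Lemma psD u v a : (u + v) a = u a + v a. Proof. by []. Qed.
Lemma psZ (x : K) u a : (x *: u) a = x * u a. Proof. by []. Qed.

Section Box.
Variable N : nat.
Local Notation box := {ffun 'I_D -> 'I_N}.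
Definition boxval (f : box) : mindex := [ffun i => val (f i)].

Lemma boxval_inj : injective boxval.
Proof.
move=> f g /ffunP fg; apply/ffunP => i; apply: val_inj.
by have := fg i; rewrite !ffunE.
Qed.

Lemma boxvalP a : (forall i, (a i < N)%N) -> exists f, boxval f = a.
Proof.
move=> aN; exists [ffun i => Ordinal (aN i)].
by apply/ffunP => i; rewrite !ffunE.
Qed.

Lemma boxval_le (f : box) i : (boxval f i < N)%N.
Proof. by rewrite ffunE; exact: ltn_ord. Qed.

(** The coefficient at [a] only involves indices dominated by [a]. Confining them to a box turns the
    Cauchy product into ordinary sums over a finite type, with the constraint kept as a 0/1
    factor. *)
Lemma psmul_box u v a : (forall i, (a i < N)%N) ->
  psmul u v a =
    \sum_(f : box) \sum_(g : box)
      (madd (boxval f) (boxval g) == a)%:R * (u (boxval f) * v (boxval g)).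
Proof.
move=> aN; rewrite /psmul.
pose h (p : box * box) := (boxval p.1, boxval p.2).
have hinj : injective h.
  by case=> f g; case=> f1 g1 [fg gg]; rewrite (boxval_inj fg) (boxval_inj gg).
rewrite (fsbigE [seq h p | p <- enum {: box * box} &
                           madd (h p).1 (h p).2 == a]); first last.
- move=> [b c] /= bc /negP[]; have [i|f fb] := @boxvalP b.
    by rewrite (leq_ltn_trans _ (aN i)) // -bc ffunE leq_addr.
  have [i|g gc] := @boxvalP c.
    by rewrite (leq_ltn_trans _ (aN i)) // -bc ffunE leq_addl.
  apply/mapP; exists (f, g); last by rewrite /h fb gc.
  by rewrite mem_filter mem_enum andbT /h /= fb gc; apply/eqP.
- by move=> p /= /mapP[q]; rewrite mem_filter => /andP[/eqP qa _] ->.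
- by rewrite map_inj_uniq // filter_uniq // enum_uniq.
rewrite big_map big_filter_cond /=.
rewrite (eq_bigl (fun p => madd (h p).1 (h p).2 == a)); last first.
  move=> p; apply/andP/idP => [[]//|pa]; split=> //.
  by apply/mem_set/eqP.
rewrite big_enum_cond /= pair_big /= [LHS]big_mkcond /=.
by apply: eq_bigr => p _; case: eqP => _; rewrite ?mul1r ?mul0r.
Qed.

End Box.

Lemma mbound a : exists N, forall i, (a i < N)%N.
Proof. by exists (\max_i a i).+1 => i; rewrite ltnS (leq_bigmax i). Qed.

Lemma psmulC u v : psmul u v = psmul v u.
Proof.
apply: pseriesP => a; have [N aN] := mbound a.
rewrite !(psmul_box _ _ aN) exchange_big /=.
apply: eq_bigr => f _; apply: eq_bigr => g _; rewrite [u _ * _]mulrC.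
by congr ((_ == _)%:R * _); apply/ffunP => i; rewrite !ffunE addnC.
Qed.

Lemma psmul_linear_r u : linear (psmul u).
Proof.
move=> x v w; apply: pseriesP => a; have [N aN] := mbound a.
rewrite psD psZ !(psmul_box _ _ aN) mulr_sumr -big_split /=.
apply: eq_bigr => f _; rewrite mulr_sumr -big_split /=.
by apply: eq_bigr => g _; rewrite psD psZ; ring.
Qed.

Lemma psmul_linear_l v : linear (fun u => psmul u v).
Proof.
by apply: (lin_ext (f := psmul v)); [move=> u; rewrite psmulC|exact: psmul_linear_r].
Qed.

Lemma psmulA u v w : psmul u (psmul v w) = psmul (psmul u v) w.
Proof.
apply: pseriesP => a; have [N aN] := mbound a.
rewrite !(psmul_box _ _ aN).
pose t (f g h : {ffun 'I_D -> 'I_N}) : K :=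
  (madd (boxval f) (madd (boxval g) (boxval h)) == a)%:R *
  (u (boxval f) * v (boxval g) * w (boxval h)).
(* The intermediate index of an iterated product is dominated by [a], hence lies in the box, and the
   sum over it against a Kronecker delta collapses. *)
have pick (b : mindex) (P : mindex -> K) :
    (forall c, P c != 0 -> forall i, (c i < N)%N) ->
    \sum_(e : {ffun 'I_D -> 'I_N}) (b == boxval e)%:R * P (boxval e) = P b.
  move=> PN; case: (eqVneq (P b) 0) => [Pb0|/PN bN].
    rewrite Pb0 big1 // => e _.
    by case: eqP => [<-|_]; rewrite ?Pb0 ?mulr0 ?mul0r.
  have [e eb] := boxvalP bN; rewrite (bigD1 e) //= eb eqxx mul1r big1 ?addr0 //.
  move=> f fe; case: eqP => [bf|_]; last by rewrite mul0r.
  by case/eqP: fe; apply: boxval_inj; rewrite -bf eb.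
transitivity (\sum_f \sum_g \sum_h t f g h).
  apply: eq_bigr => f _.
  under eq_bigr => e _.
    rewrite (psmul_box _ _ (@boxval_le N e)) !mulr_sumr.
    under eq_bigr => g _ do rewrite !mulr_sumr.
    over.
  rewrite exchange_big /=; apply: eq_bigr => g _.
  rewrite exchange_big /=; apply: eq_bigr => h _.
  rewrite /t -[in RHS](pick (madd (boxval g) (boxval h)) (fun c =>
     (madd (boxval f) c == a)%:R * (u (boxval f) * v (boxval g) * w (boxval h)))).
    by apply: eq_bigr => e _; ring.
  move=> c; case: (madd _ c =P a) => [fca _ i|_]; last by rewrite mul0r eqxx.
  by rewrite (leq_ltn_trans _ (aN i)) // -fca ffunE leq_addl.
transitivity (\sum_h \sum_f \sum_g t f g h); last first.
  rewrite [RHS]exchange_big /=; apply: eq_bigr => h _.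
  under [RHS]eq_bigr => e _.
    rewrite (psmul_box _ _ (@boxval_le N e)) mulr_suml mulr_sumr.
    under eq_bigr => g _ do rewrite mulr_suml mulr_sumr.
    over.
  rewrite [RHS]exchange_big /=; apply: eq_bigr => f _.
  rewrite [RHS]exchange_big /=; apply: eq_bigr => g _.
  have maddA : madd (boxval f) (madd (boxval g) (boxval h)) =
               madd (madd (boxval f) (boxval g)) (boxval h).
    by apply/ffunP => i; rewrite !ffunE addnA.
  rewrite /t maddA -[in LHS](pick (madd (boxval f) (boxval g)) (fun c =>
     (madd c (boxval h) == a)%:R * (u (boxval f) * v (boxval g) * w (boxval h)))).
    by apply: eq_bigr => e _; ring.
  move=> c; case: (madd c _ =P a) => [cha _ i|_]; last by rewrite mul0r eqxx.
  by rewrite (leq_ltn_trans _ (aN i)) // -cha ffunE leq_addr.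
rewrite [RHS]exchange_big; apply: eq_bigr => f _; exact: exchange_big.
Qed.

Lemma psmul1 u : psmul u (@psone K D) = u.
Proof.
apply: pseriesP => a; have [N aN] := mbound a.
rewrite (psmul_box _ _ aN); have [e ea] := boxvalP aN.
(* For D = 0 the bound N may itself be 0; positivity of N is only required when some coordinate i
   exists, and then e i is an element of 'I_N. *)
have N0 (z : 'I_N) : (0 < N)%N by case: N z {aN e ea} => [[]|].
have [z zb] : exists z : {ffun 'I_D -> 'I_N}, boxval z = mzero.
  by apply: boxvalP => i; rewrite ffunE; apply: N0; exact: (e i).
rewrite (bigD1 e) //= (bigD1 z) //= !big1 ?addr0.
- rewrite ea zb /psone eqxx mulr1.
  have -> : madd a mzero == a by apply/eqP/ffunP => i; rewrite !ffunE addn0.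
  by rewrite mul1r.
- move=> f fe; apply: big1 => g _; rewrite /psone.
  case: (boxval g =P _) => [->|_]; last by rewrite !mulr0.
  case: eqP => [fa|_]; last by rewrite mul0r.
  case/eqP: fe; apply: boxval_inj; rewrite ea -fa.
  by apply/ffunP => i; rewrite !ffunE addn0.
- move=> g gz; rewrite /psone; case: (boxval g =P _) => [g0|_]; last by rewrite !mulr0.
  by case/eqP: gz; apply: boxval_inj; rewrite zb g0.
Qed.

Lemma ps1mul u : psmul (@psone K D) u = u.
Proof. by rewrite psmulC psmul1. Qed.

Lemma pderiv_linear i : linear (@pderiv K D i).
Proof. by move=> x u v; apply: pseriesP => a; rewrite /pderiv !psD !psZ; ring. Qed.

Lemma pderivC i j u : pderiv i (pderiv j u) = pderiv j (pderiv i u).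
Proof.
apply: pseriesP => a; rewrite /pderiv !ffunE !mulrA; congr (_ * u _); last first.
  by apply/ffunP => k; rewrite !ffunE addnAC.
rewrite [j == i]eq_sym; case: (i =P j) => [-> //|_].
by rewrite !addn0 mulrC.
Qed.

Let sums a : set (mindex * mindex) := [set p | madd p.1 p.2 = a].

Lemma finite_sums a : finite_set (sums a).
Proof.
have [N aN] := mbound a.
apply: (@sub_finite_set _ _ ((fun f : {ffun 'I_D -> 'I_N} * {ffun 'I_D -> 'I_N} =>
   (boxval f.1, boxval f.2)) @` setT)); last first.
  by apply: finite_image; exact: finite_finset.
move=> [b c] /= bc; have [i|f fb] := @boxvalP N b.
  by rewrite (leq_ltn_trans _ (aN i)) // -bc ffunE leq_addr.
have [i|g gc] := @boxvalP N c.
  by rewrite (leq_ltn_trans _ (aN i)) // -bc ffunE leq_addl.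
by exists (f, g) => //=; rewrite fb gc.
Qed.

(** The Leibniz rule rests on a_i + 1 = b_i + c_i for each decomposition of a + e_i into b + c. This
    is the half weighted by b_i: terms with b_i = 0 vanish, and the others correspond to
    decompositions of a by lowering b_i. Exchanging b and c gives the other half. *)
Lemma pderiv_psmul_half i u v a :
  \sum_(p \in sums (madd a (munit i))) ((p.1 i)%:R * u p.1 * v p.2) =
  psmul (pderiv i u) v a.
Proof.
pose h (p : mindex * mindex) := (madd p.1 (munit i), p.2).
have hinj : set_inj (sums a) h.
  move=> [b c] [b' c'] _ _ /pair_equal_spec[/ffunP bb /= ->]; congr (_, _).
  by apply/ffunP => k; have := bb k; rewrite !ffunE; exact: addIn.
rewrite -(fsbig_widen (h @` sums a)).
- rewrite (fsbig_image _ _ _ hinj); apply: eq_fsbigr => -[b c] _ /=.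
  rewrite /pderiv !ffunE eqxx addn1; congr (_ * u _ * _).
  by apply/ffunP => k; rewrite !ffunE.
- move=> _ [[b c] /= bc <-]; rewrite /sums /= -bc.
  by apply/ffunP => k; rewrite !ffunE addnAC.
- move=> [b c] [/= bc nim] /=; case: (posnP (b i)) => [->|bi]; first by rewrite !mul0r.
  case: nim; exists ([ffun k => (b k - (k == i))%N], c); rewrite /h /=.
    apply/ffunP => k; move/ffunP/(_ k): bc; rewrite !ffunE.
    case: eqP => [->|_] /=; last by rewrite subn0 addn0.
    by move: bi; case: (b i) => // n _; rewrite subn1 addn1 addSn => -[].
  congr (_, _); apply/ffunP => k; rewrite !ffunE.
  by case: eqP => [->|_] /=; rewrite ?subn0 ?addn0 // subnK.
Qed.

Lemma pderivM i u v :
  pderiv i (psmul u v) = psmul (pderiv i u) v + psmul u (pderiv i v).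
Proof.
apply: pseriesP => a; rewrite psD [psmul u (pderiv i v)]psmulC -!pderiv_psmul_half.
pose sw (p : mindex * mindex) := (p.2, p.1).
rewrite [X in _ = _ + X](reindex_fsbig sw (sums (madd a (munit i)))); last first.
  split=> [[b c] /= <-|[b c] [b' c'] _ _ /pair_equal_spec[/= -> ->] //|[b c] /= bc].
    by apply/ffunP => k; rewrite !ffunE addnC.
  by exists (c, b) => //; rewrite -bc; apply/ffunP => k; rewrite !ffunE addnC.
rewrite -fsbig_split; last exact: finite_sums.
rewrite /= /pderiv /psmul.
have -> : [ffun j => (a j + (j == i))%N] = madd a (munit i).
  by apply/ffunP => k; rewrite !ffunE.
rewrite -/(sums _) mulr_fsumr; apply: eq_fsbigr => -[b c]; rewrite inE /= => bc.
have <- : (b i + c i)%N = (a i).+1.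
  by move/ffunP/(_ i): bc; rewrite !ffunE eqxx addn1.
by rewrite natrD; ring.
Qed.

Lemma taylor_linear a : linear (@taylor K D a).
Proof.
apply: lin_scale; elim: (enum _) => [//|i s IH] /=.
by apply: lin_comp IH; apply: lin_iter; exact: pderiv_linear.
Qed.

Lemma taylor0 u : taylor mzero u = u.
Proof.
rewrite /taylor big1 ?invr1 ?scale1r; last by move=> i _; rewrite ffunE.
by elim: (enum _) => [//|i s IH] /=; rewrite ffunE.
Qed.

Lemma foldr_munit T (F : 'I_D -> T -> T) x j :
  foldr (fun i => iter (munit j i) (F i)) x (enum 'I_D) = F j x.
Proof.
have : j \in enum 'I_D by rewrite mem_enum.
have := enum_uniq 'I_D; elim: (enum _) => [//|i s IH] /= /andP[is_ us].
rewrite inE ffunE => /predU1P[ji|js]; [subst j|].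
  rewrite eqxx /=; congr (F _ _); elim: s is_ {IH us} => [//|k s IH] /=.
  by rewrite inE negb_or ffunE => /andP[ik /IH]; rewrite [k == i]eq_sym (negPf ik).
by rewrite IH //; case: eqP js is_ => // -> ->.
Qed.

Lemma taylor_munit j u : taylor (munit j) u = pderiv j u.
Proof.
rewrite /taylor foldr_munit big1 ?invr1 ?scale1r // => i _.
by rewrite ffunE; case: eqP.
Qed.

End PowerSeries.

(** * Modes and fields *)

Section Modes.
Context (K : fieldType) (D : nat).
Local Notation state := (state K D).
Local Notation pseries := (pseries K D).
Local Notation basis := (basis D).
Implicit Types (x y : state) (k : basis) (u v : pseries) (r n : int).

Lemma hpowE r x :
  hpow r x = \sum_(k <- msupp x) sng (k.1.1 + r, k.1.2, k.2) (coef k x).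
Proof. by rewrite coef.unlock sng.unlock. Qed.

Lemma onpsE f x : onps f x = \sum_(k <- msupp x) sng k (f (coef k x)).
Proof. by rewrite coef.unlock sng.unlock. Qed.

Lemma mcreateE g x :
  mcreate g x = \sum_(k <- msupp x) sng (k.1.1, (g +` k.1.2)%mset, k.2) (coef k x).
Proof. by rewrite coef.unlock sng.unlock. Qed.

Lemma mderivE g x :
  mderiv g x = \sum_(k <- msupp x)
    sng (k.1.1, (k.1.2 `\ g)%mset, k.2) ((k.1.2 g)%:R *: coef k x).
Proof. by rewrite coef.unlock sng.unlock. Qed.

Lemma gcreateE e x :
  gcreate e x = \sum_(k <- msupp x)
    (if e \notin k.2 then sng (k.1, (e |` k.2)%fset) (gsign K e k.2 *: coef k x)
     else 0).
Proof. by rewrite coef.unlock sng.unlock -big_mkcond. Qed.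

Lemma gdeleteE e x :
  gdelete e x = \sum_(k <- msupp x)
    (if e \in k.2 then sng (k.1, (k.2 `\ e)%fset) (gsign K e k.2 *: coef k x)
     else 0).
Proof. by rewrite coef.unlock sng.unlock -big_mkcond. Qed.

Lemma lin_sngZ k (c : K) : linear (fun u => sng k (c *: u)).
Proof. by apply: lin_comp; [exact: sng_linear|apply: lin_scale]. Qed.

Lemma hpow_linear r : linear (@hpow K D r).
Proof.
apply: lin_ext (fun x => esym (hpowE r x)) _.
apply: (msupp_sum_linear (G := fun k u => sng (k.1.1 + r, k.1.2, k.2) u)) => k.
exact: sng_linear.
Qed.

Lemma hpow_sng r k u : hpow r (sng k u) = sng (k.1.1 + r, k.1.2, k.2) u.
Proof.
rewrite hpowE (msupp_sum_sng (G := fun k u => sng (k.1.1 + r, k.1.2, k.2) u)) //.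
by move=> l; exact: sng_linear.
Qed.

Section Onps.
Variable f : pseries -> pseries.
Hypothesis lf : linear f.

Let lG k : linear (fun u => sng k (f u)).
Proof. by apply: lin_comp => //; exact: sng_linear. Qed.

Lemma onps_linear : linear (@onps K D f).
Proof. by apply: lin_ext (fun x => esym (onpsE f x)) _; exact: (msupp_sum_linear lG). Qed.

Lemma onps_sng k u : onps f (sng k u) = sng k (f u).
Proof. by rewrite onpsE (msupp_sum_sng lG). Qed.

End Onps.

Lemma mcreate_linear g : linear (@mcreate K D g).
Proof.
apply: lin_ext (fun x => esym (mcreateE g x)) _.
apply: (msupp_sum_linear (G := fun k u => sng (k.1.1, (g +` k.1.2)%mset, k.2) u)) => k.
exact: sng_linear.
Qed.

Lemma mcreate_sng g k u :
  mcreate g (sng k u) = sng (k.1.1, (g +` k.1.2)%mset, k.2) u.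
Proof.
rewrite mcreateE
  (msupp_sum_sng (G := fun k u => sng (k.1.1, (g +` k.1.2)%mset, k.2) u)) //.
by move=> l; exact: sng_linear.
Qed.

Lemma mderiv_linear g : linear (@mderiv K D g).
Proof.
apply: lin_ext (fun x => esym (mderivE g x)) _.
apply: (msupp_sum_linear (G := fun k u =>
  sng (k.1.1, (k.1.2 `\ g)%mset, k.2) ((k.1.2 g)%:R *: u))) => k.
exact: lin_sngZ.
Qed.

Lemma mderiv_sng g k u :
  mderiv g (sng k u) = sng (k.1.1, (k.1.2 `\ g)%mset, k.2) ((k.1.2 g)%:R *: u).
Proof.
rewrite mderivE (msupp_sum_sng (G := fun k u =>
  sng (k.1.1, (k.1.2 `\ g)%mset, k.2) ((k.1.2 g)%:R *: u))) //.
by move=> l; exact: lin_sngZ.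
Qed.

Let gcG e k u : state :=
  if e \notin k.2 then sng (k.1, (e |` k.2)%fset) (gsign K e k.2 *: u) else 0.

Let gcG_linear e k : linear (gcG e k).
Proof. by rewrite /gcG; case: (e \notin k.2); [exact: lin_sngZ|exact: lin_const0]. Qed.

Lemma gcreate_linear e : linear (@gcreate K D e).
Proof.
apply: lin_ext (fun x => esym (gcreateE e x)) _.
exact: (msupp_sum_linear (gcG_linear e)).
Qed.

Lemma gcreate_sng e k u : gcreate e (sng k u) =
  if e \notin k.2 then sng (k.1, (e |` k.2)%fset) (gsign K e k.2 *: u) else 0.
Proof. by rewrite gcreateE (msupp_sum_sng (gcG_linear e)). Qed.

Let gdG e k u : state :=
  if e \in k.2 then sng (k.1, (k.2 `\ e)%fset) (gsign K e k.2 *: u) else 0.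

Let gdG_linear e k : linear (gdG e k).
Proof. by rewrite /gdG; case: (e \in k.2); [exact: lin_sngZ|exact: lin_const0]. Qed.

Lemma gdelete_linear e : linear (@gdelete K D e).
Proof.
apply: lin_ext (fun x => esym (gdeleteE e x)) _.
exact: (msupp_sum_linear (gdG_linear e)).
Qed.

Lemma gdelete_sng e k u : gdelete e (sng k u) =
  if e \in k.2 then sng (k.1, (k.2 `\ e)%fset) (gsign K e k.2 *: u) else 0.
Proof. by rewrite gdeleteE (msupp_sum_sng (gdG_linear e)). Qed.

Lemma Xmode_linear i n : linear (@Xmode K D i n).
Proof.
case: n => [[|m]|m] /=; last exact: mcreate_linear.
  exact/onps_linear/psmul_linear_r.
by apply: lin_comp; [exact: hpow_linear|exact: mderiv_linear].
Qed.

Lemma pmode_linear i n : linear (@pmode K D i n).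
Proof.
case: n => [[|m]|m] /=; last exact: mcreate_linear.
  apply/lin_opp/lin_comp; first exact: hpow_linear.
  exact/onps_linear/pderiv_linear.
by apply/lin_opp/lin_comp; [exact: hpow_linear|exact: mderiv_linear].
Qed.

Lemma bmode_linear n : linear (@bmode K D n).
Proof.
by case: n => [m|[|m]] /=; [exact: gdelete_linear|exact: gdelete_linear
  |exact: gcreate_linear].
Qed.

Lemma cmode_linear n : linear (@cmode K D n).
Proof.
by case: n => [[|[|m]]|m] /=; [exact: gcreate_linear|exact: gcreate_linear
  |exact: gdelete_linear|exact: gcreate_linear].
Qed.

Definition idxm (g : mgen D) : nat := match g with inl p => p.2 | inr p => p.2 end.
Definition idxg (e : ggen) : nat := match e with inl m => m | inr m => m end.
(** Annihilators of index at least N kill such a key. Every state is bounded for some N, which gives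
    the fields finitely many negative powers of z on each state. *)
Definition bounded (N : nat) (k : basis) : Prop :=
  (forall g, (N <= idxm g)%N -> k.1.2 g = 0%N) /\
  (forall e, (N <= idxg e)%N -> e \notin k.2).

Lemma ex_supp_in (P : nat -> basis -> Prop) x :
  (forall N M k, (N <= M)%N -> P N k -> P M k) -> (forall k, exists N, P N k) ->
  exists N, supp_in (P N) x.
Proof.
move=> Pmon Pex.
have [N PN] : exists N, forall k, k \in (msupp x : seq _) -> P N k.
  elim: (msupp x : seq _) => [|k s [N IH]]; first by exists 0%N.
  have [M PM] := Pex k; exists (maxn M N) => l; rewrite inE => /predU1P[->|ls].
    by apply: Pmon PM; exact: leq_maxl.
  by apply: Pmon (IH _ ls); exact: leq_maxr.
by exists N => k; rewrite -msupp_coef => /PN.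
Qed.

Lemma ex_bounded x : exists N, supp_in (bounded N) x.
Proof.
apply: ex_supp_in => [N M k NM [mk gk]|k].
  by split=> [g|e] /(leq_trans NM); [exact: mk|exact: gk].
pose N1 := (\max_(g <- enum_mset k.1.2) (idxm g).+1)%N.
pose N2 := (\max_(e <- enum_fset k.2) (idxg e).+1)%N.
exists (maxn N1 N2); split=> [g|e].
  rewrite geq_max => /andP[gN _]; apply/eqP; rewrite mset_eq0; apply/negP => gk.
  move: gN; rewrite leqNgt => /negP; apply.
  by rewrite (leq_bigmax_seq (F := fun g => (idxm g).+1)).
rewrite geq_max => /andP[_ eN]; apply/negP => ek.
move: eN; rewrite leqNgt => /negP; apply.
by rewrite (leq_bigmax_seq (F := fun e => (idxg e).+1)).
Qed.

Lemma mderiv_bounded N x g : supp_in (bounded N) x -> (N <= idxm g)%N ->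
  mderiv g x = 0.
Proof.
move=> bx Ng; rewrite mderivE big_seq big1 // => k; rewrite msupp_coef => /bx[mk _].
by rewrite mk // scale0r (lin0 (sng_linear _)).
Qed.

Lemma gdelete_bounded N x e : supp_in (bounded N) x -> (N <= idxg e)%N ->
  gdelete e x = 0.
Proof.
move=> bx Ne; rewrite gdeleteE big_seq big1 // => k; rewrite msupp_coef => /bx[_ gk].
by rewrite (negPf (gk _ Ne)).
Qed.

End Modes.

(** * Lower-truncated fields and their normal ordered products *)

Section Fields.
Context (K : fieldType) (D : nat).
Local Notation state := (state K D).
Local Notation pseries := (pseries K D).
Local Notation basis := (basis D).
Local Notation field := (field K D).
Implicit Types (x y : state) (k : basis) (u v : pseries) (r n : int) (A B F : field).

(** The vertex algebra notion of a field: linear modes, and F(z) x is a Laurent series in z for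
    every state x. Both parts are needed together, since linearity of a normal ordered product
    relies on truncation of its factors. *)
Record good F : Prop := Good {
  good_linear : forall n, linear (F n);
  good_trunc : forall x, exists N : nat, forall n, n < - N%:Z -> F n x = 0 }.

Lemma lt_negz n (N : nat) : n < - N%:Z -> exists2 m : nat, n = Negz m & (N <= m)%N.
Proof. by case: n => m; [lia|exists m => //; lia]. Qed.

Lemma good_Xfield i : good (@Xfield K D i).
Proof.
split=> [n|x]; first exact: Xmode_linear.
have [N bx] := ex_bounded x; exists N => n /lt_negz[m -> Nm].
rewrite /Xfield (_ : - Negz m = Posz m.+1); last by lia.
by rewrite /= (mderiv_bounded bx) // (lin0 (hpow_linear _)).
Qed.

Lemma good_pfield i : good (@pfield K D i).
Proof.
split=> [n|x]; first exact: pmode_linear.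
have [N bx] := ex_bounded x; exists N.+1 => n /lt_negz[[//|m] -> Nm].
rewrite /pfield (_ : - Negz m.+1 - 1 = Posz m.+1); last by lia.
by rewrite /= (mderiv_bounded bx) // (lin0 (hpow_linear _)) oppr0.
Qed.

Lemma good_bfield : good (@bfield K D).
Proof.
split=> [n|x]; first exact: bmode_linear.
have [N bx] := ex_bounded x; exists N.+1 => n /lt_negz[[//|m] -> Nm].
rewrite /bfield (_ : - Negz m.+1 - 2 = Posz m); last by lia.
by rewrite /= (gdelete_bounded bx) //=; lia.
Qed.

Lemma good_cfield : good (@cfield K D).
Proof.
split=> [n|x]; first exact: cmode_linear.
have [N bx] := ex_bounded x; exists N => n /lt_negz[m -> Nm].
rewrite /cfield (_ : 1 - Negz m = Posz m.+2); last by lia.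
by rewrite /= (gdelete_bounded bx).
Qed.

Lemma good_idfield : good (@idfield K D).
Proof.
split=> [n|x]; first by rewrite /idfield; case: eqP => _ //; exact: lin_const0.
by exists 0%N => n n0; rewrite /idfield; case: eqP => // ne; lia.
Qed.

Lemma good_Xosc i : good (@Xosc K D i).
Proof.
have [lX tX] := good_Xfield i; split=> [n|x]; rewrite /Xosc.
  by case: eqP => _; [exact: lin_const0|exact: lX].
by have [N XN] := tX x; exists N => n /XN ->; case: eqP.
Qed.

Lemma good_fderiv F : good F -> good (fderiv F).
Proof.
move=> [lF tF]; split=> [n|x]; first exact/lin_scale/lF.
have [N FN] := tF x; exists N.+1 => n nN.
by rewrite /fderiv FN ?scaler0 //; lia.
Qed.

Lemma good_fdivd m F : good F -> good (fdivd m F).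
Proof.
move=> gF; have : good (iter m (@fderiv K D) F).
  by elim: m => [//|m IH] /=; exact: good_fderiv.
case=> lF tF; split=> [n|x]; first exact/lin_scale/lF.
have [N FN] := tF x; exists N => n nN.
by rewrite /fdivd FN ?scaler0.
Qed.

Lemma good_sum I (s : seq I) (F : I -> field) : (forall i, good (F i)) ->
  good (fun n x => \sum_(i <- s) F i n x).
Proof.
move=> gF; split=> [n|x].
  by apply: lin_bigsum => i; exact: (good_linear (gF i)).
elim: s => [|i s [N IH]]; first by exists 0%N => n _; rewrite big_nil.
have [M FM] := good_trunc (gF i) x; exists (maxn M N) => n nN.
by rewrite big_cons FM ?IH ?addr0 //; lia.
Qed.

Lemma good_comp F (f : state -> state) : linear f -> good F ->
  good (fun n x => f (F n x)).
Proof.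
move=> lf [lF tF]; split=> [n|x]; first exact: lin_comp.
by have [N FN] := tF x; exists N => n /FN ->; rewrite (lin0 lf).
Qed.

Lemma nprod_trunc o A B n x N1 N2 :
  (forall k : nat, (N1 <= k)%N -> A k%:Z (B (n - k%:Z) x) = 0) ->
  (forall k : nat, (N2 <= k)%N -> B (n + k.+1%:Z) (A (- k.+1%:Z) x) = 0) ->
  nprod o A B n x = \sum_(k < N1) A k%:Z (B (n - k%:Z) x) +
    (-1) ^+ o *: \sum_(k < N2) B (n + k.+1%:Z) (A (- k.+1%:Z) x).
Proof.
move=> h1 h2; rewrite /nprod.
by rewrite (fsum_nat_trunc h1) (fsum_nat_trunc h2).
Qed.

Lemma nprod_bound A B n x : good A -> good B -> exists N : nat,
  (forall k : nat, (N <= k)%N -> A k%:Z (B (n - k%:Z) x) = 0) /\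
  (forall k : nat, (N <= k)%N -> B (n + k.+1%:Z) (A (- k.+1%:Z) x) = 0).
Proof.
move=> gA gB; have [NA hA] := good_trunc gA x; have [NB hB] := good_trunc gB x.
exists (NA + `|n| + NB).+1; split=> k Nk.
  by rewrite hB ?(lin0 (good_linear gA _)) //; lia.
by rewrite hA ?(lin0 (good_linear gB _)) //; lia.
Qed.

Lemma good_nprod o A B : good A -> good B -> good (nprod o A B).
Proof.
move=> gA gB; split=> [n a x y|x].
  have [N1 [h1 h1']] := nprod_bound n x gA gB.
  have [N2 [h2 h2']] := nprod_bound n y gA gB.
  have [N3 [h3 h3']] := nprod_bound n (a *: x + y) gA gB.
  pose N := maxn N1 (maxn N2 N3).
  rewrite !(nprod_trunc _ (N1 := N) (N2 := N));
    try by move=> k Nk; first [apply: h1|apply: h1'|apply: h2|apply: h2'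
                               |apply: h3|apply: h3']; lia.
  move: a x y {h1 h1' h2 h2' h3 h3'}; apply: lin_add.
    by apply: lin_bigsum => k; apply: lin_comp; exact: good_linear.
  by apply/lin_scale/lin_bigsum => k; apply: lin_comp; exact: good_linear.
have [NA hA] := good_trunc gA x; have [NB hB] := good_trunc gB x.
(* Only the finitely many vectors A_{-k-1} x with k < NA are nonzero, so one bound M truncates B on
   all of them. *)
have [M hM] : exists M : nat, forall k : nat, (k < NA)%N ->
    forall n, n < - M%:Z -> B n (A (- k.+1%:Z) x) = 0.
  elim: (NA) => [|m [M IH]]; first by exists 0%N.
  have [M' h'] := good_trunc gB (A (- m.+1%:Z) x); exists (maxn M M') => k.
  rewrite ltnS leq_eqVlt => /predU1P[->|km] n nM; first by apply: h'; lia.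
  by apply: IH => //; lia.
exists (NB + M + NA).+1 => n nN; rewrite /nprod !fsbig1 ?scaler0 ?addr0 // => k _.
  case: (ltnP k NA) => kN; last by rewrite hA ?(lin0 (good_linear gB _)) //; lia.
  by apply: hM => //; lia.
by rewrite hB ?(lin0 (good_linear gA _)) //; lia.
Qed.

Lemma nprod_linear_r (W : lmodType K) o A (B : W -> field) n x :
  good A -> (forall w, good (B w)) -> (forall m y, linear (fun w => B w m y)) ->
  linear (fun w => nprod o A (B w) n x).
Proof.
move=> gA gB lB a v w.
have [N1 [h1 h1']] := nprod_bound n x gA (gB v).
have [N2 [h2 h2']] := nprod_bound n x gA (gB w).
have [N3 [h3 h3']] := nprod_bound n x gA (gB (a *: v + w)).
pose N := maxn N1 (maxn N2 N3).
rewrite !(nprod_trunc _ (N1 := N) (N2 := N));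
  try by move=> k Nk; first [apply: h1|apply: h1'|apply: h2|apply: h2'
                             |apply: h3|apply: h3']; lia.
move: a v w {h1 h1' h2 h2' h3 h3'}; apply: lin_add.
  by apply: lin_bigsum => k; apply: lin_comp; [exact: good_linear|exact: lB].
by apply/lin_scale/lin_bigsum => k; exact: lB.
Qed.

End Fields.

(** * Weight of the p's, Taylor expansion of u(X(z)) and fields of states *)

Section StateFields.
Context (K : fieldType) (D : nat).
Local Notation state := (state K D).
Local Notation pseries := (pseries K D).
Local Notation basis := (basis D).
Local Notation field := (field K D).
Local Notation mindex := (mindex D).
Implicit Types (x y : state) (k : basis) (u v : pseries) (r n : int) (A B F : field).

Section SuppIn.
Variables (P Q : basis -> Prop) (x : state).
Hypothesis Px : supp_in P x.

Lemma supp_in_hpow r :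
  (forall k, P k -> Q (k.1.1 + r, k.1.2, k.2)) -> supp_in Q (hpow r x).
Proof.
move=> PQ; rewrite hpowE.
apply: (supp_in_msupp_sum (G := fun k u => sng (k.1.1 + r, k.1.2, k.2) u) Px) => k u Pk.
by apply: supp_in_sng; exact: PQ.
Qed.

Lemma supp_in_onps f : (forall k, P k -> Q k) -> supp_in Q (onps f x).
Proof.
move=> PQ; rewrite onpsE.
apply: (supp_in_msupp_sum (G := fun k u => sng k (f u)) Px) => k u Pk.
by apply: supp_in_sng; exact: PQ.
Qed.

Lemma supp_in_mcreate g :
  (forall k, P k -> Q (k.1.1, (g +` k.1.2)%mset, k.2)) -> supp_in Q (mcreate g x).
Proof.
move=> PQ; rewrite mcreateE; apply: (supp_in_msupp_sum
  (G := fun k u => sng (k.1.1, (g +` k.1.2)%mset, k.2) u) Px) => k u Pk.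
by apply: supp_in_sng; exact: PQ.
Qed.

Lemma supp_in_mderiv g :
  (forall k, P k -> g \in k.1.2 -> Q (k.1.1, (k.1.2 `\ g)%mset, k.2)) ->
  supp_in Q (mderiv g x).
Proof.
move=> PQ; rewrite mderivE; apply: (supp_in_msupp_sum (G := fun k u =>
  sng (k.1.1, (k.1.2 `\ g)%mset, k.2) ((k.1.2 g)%:R *: u)) Px) => k u Pk.
case: (boolP (g \in k.1.2)) => [gk|]; first by apply: supp_in_sng; exact: PQ.
rewrite -mset_eq0 => /eqP ->.
by rewrite scale0r (lin0 (sng_linear _)); exact: supp_in0.
Qed.

Lemma supp_in_gcreate e :
  (forall k, P k -> Q (k.1, (e |` k.2)%fset)) -> supp_in Q (gcreate e x).
Proof.
move=> PQ; rewrite gcreateE; apply: (supp_in_msupp_sum (G := fun k u =>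
  if e \notin k.2 then sng (k.1, (e |` k.2)%fset) (gsign K e k.2 *: u)
  else 0) Px) => k u Pk.
by case: (e \notin k.2); [apply: supp_in_sng; exact: PQ|exact: supp_in0].
Qed.

End SuppIn.

(** The total weight bounds the number of powers of z that contractions of the X^i(z) with the p's
    present can remove; modes of X count 0 since X has no contraction with X. *)
Definition pweight (g : mgen D) : nat := if g is inl p then p.2.+1 else 0%N.
Definition pwt k : nat := \sum_(g <- enum_mset k.1.2) pweight g.

Lemma pwt_add (g : mgen D) (m : {mset mgen D}%mset) :
  (\sum_(f <- enum_mset (g +` m)%mset) pweight f =
   pweight g + \sum_(f <- enum_mset m) pweight f)%N.
Proof.
have -> : (g +` m)%mset = seq_mset (g :: enum_mset m) by rewrite mset_cons seq_mset_id.
by rewrite (perm_big _ (perm_eq_seq_mset _)) big_cons.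
Qed.

Lemma pwt_sub (g : mgen D) (m : {mset mgen D}%mset) : g \in m ->
  (\sum_(f <- enum_mset m) pweight f =
   pweight g + \sum_(f <- enum_mset (m `\ g)%mset) pweight f)%N.
Proof. by move=> gm; rewrite -pwt_add msetB1K. Qed.

Definition pwt_le (w : int) x := supp_in (fun k => (pwt k)%:Z <= w) x.

Lemma pwt_le_neg w x : w < 0 -> pwt_le w x -> x = 0.
Proof.
move=> w0 xw; apply: coefP => k; rewrite (lin0 (coef_linear k)).
by apply/eqP; apply: contraT => /xw; lia.
Qed.

Lemma ex_pwt_le x : exists w : nat, pwt_le w%:Z x.
Proof.
apply: ex_supp_in => [N M k NM|k]; first by lia.
by exists (pwt k).
Qed.

Lemma pwt_le_Xosc i n w x : pwt_le w x ->
  pwt_le (if n < 0 then w + n else w) (Xosc i n x).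
Proof.
move=> wx; rewrite /Xosc; case: eqP => [_|n0]; first exact: supp_in0.
rewrite /Xfield; case: n n0 => [[//|m] _|m _].
  rewrite (_ : - Posz m.+1 = Negz m); last by lia.
  have -> : (Posz m.+1 < 0) = false by lia.
  apply: (supp_in_mcreate wx) => k kw.
  by rewrite /pwt pwt_add /=; exact: kw.
rewrite (_ : - Negz m = Posz m.+1); last by lia.
apply: (supp_in_hpow (P := fun k => (pwt k)%:Z <= w + Negz m)) => //.
apply: (supp_in_mderiv wx) => k kw gk.
by move: kw; rewrite /pwt (pwt_sub gk) /=; lia.
Qed.

(* A product of [m] oscillators of the X^i lowers z-powers by at most the weight
   of the available p's, so that it needs at least [m - 2 w] powers of z. *)
Definition osc_order (m : int) F :=
  forall n w x, pwt_le w x -> n + 2%:Z * w < m -> F n x = 0.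

Lemma osc_order_id : osc_order 0 (@idfield K D).
Proof.
move=> n w x wx; rewrite /idfield; case: eqP => [->|//] w0.
by apply: (@pwt_le_neg w) => //; lia.
Qed.

Lemma osc_order_nprod m i F : osc_order m F ->
  osc_order (m + 1) (nprod false (@Xosc K D i) F).
Proof.
move=> mF n w x wx nw; rewrite /nprod !fsbig1 ?scaler0 ?addr0 // => k _.
  (* An annihilator of index k + 1 raises the power left to the other factors by k + 1 and lowers
     the weight by k + 1. The factor 2 in front of w leaves a net gain of at least one, which pays
     for the extra oscillator. *)
  have := @pwt_le_Xosc i (- k.+1%:Z) w x wx; have -> : (- k.+1%:Z < 0) by lia.
  by move=> /mF; apply; lia.
case: k => [|k]; first by rewrite /Xosc.
by rewrite (mF (n - k.+1%:Z) w x wx) ?(lin0 (good_linear (good_Xosc K i) _)) //; lia.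
Qed.

Definition oscs (a : mindex) : field :=
  foldr (fun i => iter (a i) (nprod false (@Xosc K D i))) (@idfield K D) (enum 'I_D).

Lemma oscs_ind (P : int -> field -> Prop) (a : mindex) :
  P 0 (@idfield K D) ->
  (forall m i F, P m F -> P (m + 1) (nprod false (@Xosc K D i) F)) ->
  P (\sum_i a i)%:Z (oscs a).
Proof.
move=> P0 PS; rewrite /oscs -big_enum /=.
elim: (enum _) => [|i s IH]; first by rewrite big_nil.
rewrite big_cons /=; elim: (a i) => [|m IHm]; first by rewrite add0n.
by rewrite addSn -addn1 PoszD; exact: PS.
Qed.

Lemma good_oscs a : good (oscs a).
Proof.
apply: (@oscs_ind (fun=> (@good K D))) => [|m i F gF]; first exact: good_idfield.
by apply: good_nprod => //; exact: (good_Xosc K).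
Qed.

Lemma oscs_order a : osc_order (\sum_i (a : mindex) i)%:Z (oscs a).
Proof.
apply: (oscs_ind (P := osc_order)); first exact: osc_order_id.
by move=> m i F; exact: osc_order_nprod.
Qed.

Lemma psfieldE u n x : psfield u n x =
  \sum_(a \in [set: mindex]) onps (psmul (taylor a u)) (oscs a n x).
Proof. by []. Qed.

Lemma onps_psmul_linear u : linear (@onps K D (psmul u)).
Proof. exact/onps_linear/psmul_linear_r. Qed.

Lemma onps0 f : onps f (0 : state) = 0.
Proof. by rewrite onpsE msupp0 big_seq_fset0. Qed.

(** A multi-index outside the box has total degree at least N, more oscillators than the power of z
    and the weight of the state allow. This is the local finiteness of the Taylor expansion. *)
Lemma psfield_box u n w x (N : nat) : pwt_le w x -> n + 2%:Z * w < N%:Z ->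
  psfield u n x = \sum_(f : {ffun 'I_D -> 'I_N})
    onps (psmul (taylor (boxval f) u)) (oscs (boxval f) n x).
Proof.
move=> wx nw; rewrite psfieldE.
rewrite (fsum_seq (s := [seq boxval f | f <- enum {: {ffun 'I_D -> 'I_N}}])).
- by rewrite big_map big_enum.
- by rewrite map_inj_uniq ?enum_uniq //; exact: boxval_inj.
move=> a /negP aN; rewrite (@oscs_order a _ w) ?onps0 //.
apply: (lt_le_trans nw); rewrite leNgt; apply/negP => aN'; apply: aN.
have [|f fa] := @boxvalP D N a; last by apply/mapP; exists f; rewrite ?mem_enum.
move=> i; move: aN'; rewrite ltz_nat; apply: leq_ltn_trans.
by rewrite (bigD1 i) //= leq_addr.
Qed.

Lemma good_psfield u : good (psfield u).
Proof.
split=> [n a x y|x].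
  have [w1 h1] := ex_pwt_le x; have [w2 h2] := ex_pwt_le y.
  have [w3 h3] := ex_pwt_le (a *: x + y).
  pose N := (`|n| + w1.*2 + w2.*2 + w3.*2).+1.
  rewrite (@psfield_box _ _ _ _ N h1) ?(@psfield_box _ _ _ _ N h2)
    ?(@psfield_box _ _ _ _ N h3) /N; try lia.
  move: a x y {h1 h2 h3}; apply: lin_bigsum => f.
  by apply: lin_comp; [exact: onps_psmul_linear|exact: good_linear (good_oscs _) _].
have [w h] := ex_pwt_le x; exists w.*2 => n nw; rewrite psfieldE fsbig1 // => a _.
by rewrite (@oscs_order a _ w) ?onps0 //; lia.
Qed.

Lemma onps_psmul_lin_l x : linear (fun u => onps (psmul u) x).
Proof.
move=> a u v; rewrite !onpsE scaler_sumr -big_split /=; apply: eq_bigr => k _.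
by rewrite psmul_linear_l sng_linear.
Qed.

Lemma psfield_linear n x : linear (fun u => psfield u n x).
Proof.
have [w h] := ex_pwt_le x; pose N := (`|n| + w.*2).+1 => a u v.
rewrite !(@psfield_box _ n w x N) //; try by rewrite /N; lia.
move: a u v; apply: lin_bigsum => f.
apply: (lin_comp (g := fun u => onps (psmul u) _)); first exact: onps_psmul_lin_l.
exact: taylor_linear.
Qed.

Lemma good_mgfield g : good (@mgfield K D g).
Proof. by case: g => [[i n]|[i n]]; apply: good_fdivd; [exact: good_pfield|exact: good_Xfield]. Qed.

Lemma good_ggfield e : good (@ggfield K D e).
Proof. by case: e => n; apply: good_fdivd; [exact: good_bfield|exact: good_cfield]. Qed.

Lemma good_mnprod m F : good F -> good (mnprod m F).
Proof.
by move=> gF; elim: m => [//|g m IH]; apply: good_nprod => //; exact: good_mgfield.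
Qed.

Lemma good_gnprod s F : good F -> good (gnprod s F).
Proof.
by move=> gF; elim: s => [//|e s IH]; apply: good_nprod => //; exact: good_ggfield.
Qed.

Lemma mnprod_linear (F : pseries -> field) m n x : (forall u, good (F u)) ->
  (forall n x, linear (fun u => F u n x)) -> linear (fun u => mnprod m (F u) n x).
Proof.
move=> gF lF; elim: m n x => [//|g m IH] n x /=.
by apply: nprod_linear_r => //; [exact: good_mgfield|move=> u; exact: good_mnprod].
Qed.

Lemma gnprod_linear (F : pseries -> field) s n x : (forall u, good (F u)) ->
  (forall n x, linear (fun u => F u n x)) -> linear (fun u => gnprod s (F u) n x).
Proof.
move=> gF lF; elim: s n x => [//|e s IH] n x /=.
by apply: nprod_linear_r => //; [exact: good_ggfield|move=> u; exact: good_gnprod].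
Qed.

Definition Ymono k u : field := fun n x =>
  hpow k.1.1 (gnprod (gsort k.2) (mnprod (enum_mset k.1.2) (psfield u)) n x).

Lemma YE a n x : Y a n x = \sum_(k <- msupp a) Ymono k (coef k a) n x.
Proof. by rewrite /Ymono coef.unlock. Qed.

Lemma good_Ymono k u : good (Ymono k u).
Proof.
apply: good_comp; first exact: hpow_linear.
by apply/good_gnprod/good_mnprod/good_psfield.
Qed.

Lemma Ymono_linear k n x : linear (fun u => Ymono k u n x).
Proof.
apply: lin_comp; first exact: hpow_linear.
apply: gnprod_linear => [u|m y]; first exact/good_mnprod/good_psfield.
by apply: mnprod_linear => [u|j z]; [exact: good_psfield|exact: psfield_linear].
Qed.

Lemma good_Y (a : state) : good (Y a).
Proof.
have : good (fun n x => \sum_(k <- msupp a) Ymono k (coef k a) n x).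
  by apply: good_sum => k; exact: good_Ymono.
case=> lY tY; split=> [n|x].
  by apply: lin_ext (lY n) => x; rewrite YE.
by have [N YN] := tY x; exists N => n nN; rewrite YE YN.
Qed.

Lemma Y_linear n x : linear (fun a => Y a n x).
Proof.
apply: lin_ext (fun a => esym (YE a n x)) _.
exact: (msupp_sum_linear (G := fun k u => Ymono k u n x) (fun k => Ymono_linear k n x)).
Qed.

End StateFields.

(** * Multilinearity of the operations *)

Section Multilinearity.
Context (K : fieldType) (D : nat).
Local Notation state := (state K D).
Local Notation pseries := (pseries K D).
Local Notation lightF := (lightF K D).
Local Notation vect := (vect K D).
Implicit Types (x y : state) (u v : pseries) (r n : int).

Lemma fsum_linear (V W : lmodType K) (f : nat -> V -> W) :
  (forall i, linear (f i)) ->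
  (forall v : V, exists N, forall i, (N <= i)%N -> f i v = 0) ->
  linear (fun v : V => \sum_(i \in [set: nat]) f i v).
Proof.
move=> lf tf a v w; have [N1 h1] := tf v; have [N2 h2] := tf w.
have [N3 h3] := tf (a *: v + w); pose N := maxn N1 (maxn N2 N3).
rewrite !(fsum_nat_trunc (N := N));
  try by move=> k Nk; first [apply: h1|apply: h2|apply: h3]; lia.
by move: a v w {h1 h2 h3}; apply: lin_bigsum.
Qed.

Lemma good_Lfield : good (@Lfield K D).
Proof.
apply: (good_comp (f := fun x => - hpow (-1) x)).
  by apply: lin_opp; exact: hpow_linear.
apply: good_sum => i; apply: good_nprod; first exact: good_pfield.
by apply: good_fderiv; exact: good_Xfield.
Qed.

Lemma brst_linear : linear (@brst K D).
Proof.
have gc := good_cfield K D; apply: lin_add.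
  apply: lin_add; first exact: (good_linear (good_nprod false gc good_Lfield)).
  apply: (good_linear (good_nprod false gc _)).
  by apply: good_nprod; [exact: good_fderiv|exact: good_bfield].
by apply: lin_scale; apply: good_linear; do 2! apply: good_fderiv.
Qed.

Lemma Y_trunc (a b : state) :
  exists N : nat, forall i, (N <= i)%N -> Y a (- i.+1%:Z) b = 0.
Proof.
have [N YN] := good_trunc (good_Y a) b; exists N => i Ni.
by apply: YN; lia.
Qed.

Lemma Y0l n (b : state) : Y 0 n b = 0.
Proof. exact: (lin0 (Y_linear n b)). Qed.

Lemma Y0r n (a : state) : Y a n 0 = 0.
Proof. exact: (lin0 (good_linear (good_Y a) n)). Qed.

Lemma m_op_linear_r (a : state) : linear (m_op a).
Proof.
apply: fsum_linear => [i|b].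
  apply/lin_scale/lin_comp; first exact: bmode_linear.
  apply: (lin_comp (g := fun z => Y z _ _)); first exact: Y_linear.
  exact: good_linear (good_Y a) _.
have [N YN] := Y_trunc a b; exists N => i /YN ->.
by rewrite Y0l (lin0 (bmode_linear _)) scaler0.
Qed.

Lemma n_op_linear1 k l (b c : state) : linear (fun a : state => n_op k l a b c).
Proof.
apply: lin_add; last apply: lin_scale; apply: fsum_linear => [i|a].
- apply/lin_scale/(lin_comp (g := fun z => Y z _ _)); first exact: Y_linear.
  exact: bmode_linear.
- by have [N YN] := Y_trunc b c; exists N => i /YN ->; rewrite Y0r scaler0.
- apply/lin_scale/lin_comp; first exact: (good_linear (good_Y _)).
  exact: Y_linear.
- by have [N YN] := Y_trunc a c; exists N => i /YN ->; rewrite Y0r scaler0.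
Qed.

Lemma n_op_linear2 k l (a c : state) : linear (fun b : state => n_op k l a b c).
Proof.
apply: lin_add; last apply: lin_scale; apply: fsum_linear => [i|b].
- apply/lin_scale/lin_comp; first exact: (good_linear (good_Y _)).
  exact: Y_linear.
- by have [N YN] := Y_trunc b c; exists N => i /YN ->; rewrite Y0r scaler0.
- apply/lin_scale/(lin_comp (g := fun z => Y z _ _)); first exact: Y_linear.
  exact: bmode_linear.
- by have [N YN] := Y_trunc a c; exists N => i /YN ->; rewrite Y0r scaler0.
Qed.

Lemma n_op_linear3 k l (a b : state) : linear (n_op k l a b).
Proof.
apply: lin_add; last apply: lin_scale; apply: fsum_linear => [i|c].
- apply/lin_scale/lin_comp; exact: (good_linear (good_Y _)).
- by have [N YN] := Y_trunc b c; exists N => i /YN ->; rewrite Y0r scaler0.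
- apply/lin_scale/lin_comp; exact: (good_linear (good_Y _)).
- by have [N YN] := Y_trunc a c; exists N => i /YN ->; rewrite Y0r scaler0.
Qed.

Lemma monoE r m S u : mono r m S u = sng (r, seq_mset m, [fset e in S]%fset) u.
Proof. by rewrite sng.unlock. Qed.

Lemma mono_linear r m S : linear (@mono K D r m S).
Proof. by move=> a u v; rewrite !monoE sng_linear. Qed.

Lemma lin_pair (V W X : lmodType K) (f : V -> W) (h : V -> X) :
  linear f -> linear h -> linear (fun x : V => (f x, h x)).
Proof. by move=> lf lh a x y; rewrite lf lh. Qed.

Lemma lin_vect (V : lmodType K) (f : 'I_D -> V -> pseries) :
  (forall i, linear (f i)) -> linear (fun x : V => (fun i => f i x) : vect).
Proof. by move=> lf a x y; apply/funext => i; rewrite lf. Qed.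

Lemma scoef_linear r m S : linear (@scoef K D r m S).
Proof.
move=> a x y; rewrite /scoef.
by have := coef_linear (r, seq_mset m, [fset e in S]%fset) a x y; rewrite coef.unlock.
Qed.

Lemma hcoef_linear r : linear (@hcoef K D r).
Proof.
by repeat first [apply: lin_pair|apply: lin_vect => ?|exact: scoef_linear|
  apply: lin_scale].
Qed.

Lemma V1mono_linear r S : linear (@V1mono K D r S).
Proof.
apply: lin_add; apply: lin_bigsum => i.
  by apply: (lin_comp (f := fun AB : vect * vect => AB.1 i)); first exact: mono_linear.
by apply: (lin_comp (f := fun AB : vect * vect => AB.2 i)); first exact: mono_linear.
Qed.

Lemma lin_fst (V W : lmodType K) : linear (@fst V W).
Proof. by []. Qed.

Lemma lin_snd (V W : lmodType K) : linear (@snd V W).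
Proof. by []. Qed.

Let W1 := (vect * vect * pseries)%type.

Lemma F0_linear : linear (@F0 K D).
Proof.
exact: (lin_comp (lin_fst (V := pseries) (W := W1))
  (lin_comp (lin_fst (V := (pseries * W1)%type) (W := W1))
            (lin_fst (V := (pseries * W1 * W1)%type) (W := pseries)))).
Qed.

Lemma F1_linear : linear (@F1 K D).
Proof.
exact: (lin_comp (lin_snd (V := pseries) (W := W1))
  (lin_comp (lin_fst (V := (pseries * W1)%type) (W := W1))
            (lin_fst (V := (pseries * W1 * W1)%type) (W := pseries)))).
Qed.

Lemma F2_linear : linear (@F2 K D).
Proof.
exact: (lin_comp (lin_snd (V := (pseries * W1)%type) (W := W1))
            (lin_fst (V := (pseries * W1 * W1)%type) (W := pseries))).
Qed.

Lemma F3_linear : linear (@F3 K D).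
Proof. exact: (lin_snd (V := (pseries * W1 * W1)%type) (W := pseries)). Qed.

Lemma Fstate_linear : linear (@Fstate K D).
Proof.
have l1 := lin_fst (V := (vect * vect)%type) (W := pseries).
have l2 := lin_snd (V := (vect * vect)%type) (W := pseries).
apply: lin_add; [apply: lin_add; [apply: lin_add|]|].
- exact: lin_comp (mono_linear _ _ _) F0_linear.
- apply: lin_add.
    exact: lin_comp (V1mono_linear _ _) (lin_comp l1 F1_linear).
  exact: lin_comp (mono_linear _ _ _) (lin_comp l2 F1_linear).
- apply: lin_add.
    exact: lin_comp (V1mono_linear _ _) (lin_comp l1 F2_linear).
  exact: lin_scale (lin_comp (mono_linear _ _ _) (lin_comp l2 F2_linear)).
- exact: lin_scale (lin_comp (mono_linear _ _ _) F3_linear).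
Qed.

Lemma ghost_part_linear (k : 'I_4) : linear (@ghost_part K D k : lightF -> lightF).
Proof.
case: k => [[|[|[|[|//]]]] k4]; rewrite /ghost_part /=;
  (apply: lin_pair; [apply: lin_pair; [apply: lin_pair|]|]);
  by [exact: lin_const0|exact: F0_linear|exact: F1_linear|exact: F2_linear
     |exact: F3_linear].
Qed.

Lemma QF_linear : linear (@QF K D).
Proof.
apply: lin_comp; first exact: hcoef_linear.
by apply: lin_comp; [exact: brst_linear|exact: Fstate_linear].
Qed.

Lemma mu0_linear_l (b : lightF) : linear (fun a => mu0 a b).
Proof.
apply: lin_comp; first exact: hcoef_linear.
apply: (lin_comp (g := fun x => mu_op x _)); first exact: Y_linear.
exact: Fstate_linear.
Qed.

Lemma mu0_linear_r (a : lightF) : linear (mu0 a).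
Proof.
apply: lin_comp; first exact: hcoef_linear.
apply: lin_comp; last exact: Fstate_linear.
exact: good_linear (good_Y _) _.
Qed.

Lemma br0_linear_r (a : lightF) : linear (br0 a).
Proof.
apply: lin_bigsum => k; apply: lin_comp; first exact: hcoef_linear.
apply: lin_scale; apply: lin_comp; last exact: Fstate_linear.
exact: good_linear (good_Y _) _.
Qed.

Lemma m0_linear_r (a : lightF) : linear (m0 a).
Proof.
apply: lin_comp; first exact: hcoef_linear.
by apply: lin_comp; [exact: m_op_linear_r|exact: Fstate_linear].
Qed.

Lemma Fghost_linear (k : 'I_4) : linear (fun a : lightF => Fstate (ghost_part k a)).
Proof. by apply: lin_comp; [exact: Fstate_linear|exact: ghost_part_linear]. Qed.

Lemma n0_linear1 (b c : lightF) : linear (fun a => n0 a b c).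
Proof.
apply: lin_bigsum => k; apply: lin_bigsum => l.
apply: lin_comp; first exact: hcoef_linear.
apply: (lin_comp (g := fun x => n_op _ _ x _ _)); first exact: n_op_linear1.
exact: Fghost_linear.
Qed.

Lemma n0_linear2 (a c : lightF) : linear (fun b => n0 a b c).
Proof.
apply: lin_bigsum => k; apply: lin_bigsum => l.
apply: lin_comp; first exact: hcoef_linear.
apply: (lin_comp (g := fun x => n_op _ _ _ x _)); first exact: n_op_linear2.
exact: Fghost_linear.
Qed.

Lemma n0_linear3 (a b : lightF) : linear (n0 a b).
Proof.
apply: lin_bigsum => k; apply: lin_bigsum => l.
apply: lin_comp; first exact: hcoef_linear.
by apply: lin_comp; [exact: n_op_linear3|exact: Fstate_linear].
Qed.

Section Deformed.
Variable eta : 'M[K]_D.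

Lemma Qeta_linear : linear (Qeta eta).
Proof.
apply: lin_add; first exact: QF_linear.
apply: lin_bigsum => i; apply: lin_bigsum => j; apply: lin_scale.
by apply: lin_comp; [exact: mu0_linear_r|exact: br0_linear_r].
Qed.

Lemma nu0eta_linear_l (b : lightF) : linear (fun a : lightF => nu0eta eta a b).
Proof.
apply: lin_bigsum => i; apply: lin_bigsum => j; apply: lin_scale.
have h1 := lin_comp (n0_linear2 (fbg K i) b) (br0_linear_r (fbg K j)).
have h2 := lin_comp (mu0_linear_l (br0 (fbg K j) b)) (m0_linear_r (fbg K i)).
exact: lin_sub h1 h2.
Qed.

Lemma nu0eta_linear_r (a : lightF) : linear (fun b : lightF => nu0eta eta a b).
Proof.
apply: lin_bigsum => i; apply: lin_bigsum => j; apply: lin_scale.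
have h1 := n0_linear3 (fbg K i) (br0 (fbg K j) a).
have h2 := lin_comp (mu0_linear_r (m0 (fbg K i) a)) (br0_linear_r (fbg K j)).
exact: lin_sub h1 h2.
Qed.

Lemma mu0eta_bilin : bilin (mu0eta eta).
Proof.
split=> [b|a].
  exact: lin_add (mu0_linear_l b) (nu0eta_linear_l b).
exact: lin_add (mu0_linear_r a) (nu0eta_linear_r a).
Qed.

End Deformed.

End Multilinearity.

(** * Leading order in h *)

Section Monomials.
Context (K : fieldType) (D : nat).
Local Notation state := (state K D).
Local Notation pseries := (pseries K D).
Local Notation basis := (basis D).
Local Notation field := (field K D).
Local Notation mgen := (mgen D).
Local Notation mono := (@mono K D).
Implicit Types (x y : state) (u v : pseries) (r n : int) (m : seq mgen) (S : seq ggen).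

(** A form of equality of ghost sets that evaluates by computation on explicit lists, whatever the
    order in which the ghost modes were created. *)
Definition same_ghosts S S' := all (mem S') S && all (mem S) S'.

Lemma same_ghostsP S S' :
  ([fset e in S]%fset == [fset e in S']%fset) = same_ghosts S S'.
Proof.
apply/eqP/andP => [/fsetP e|[/allP s /allP s']].
  by split; apply/allP => f fS; have := e f; rewrite !inE /= fS => /esym.
by apply/fsetP => f; rewrite !inE /=; apply/idP/idP => [/s|/s'].
Qed.

Lemma mono_ghosts r m S S' u : same_ghosts S S' -> mono r m S u = mono r m S' u.
Proof. by rewrite -same_ghostsP !monoE => /eqP ->. Qed.

Lemma mono0 r m S : mono r m S 0 = 0.
Proof. exact: (lin0 (mono_linear _ _ _)). Qed.

Lemma hpow_mono s r m S u : hpow s (mono r m S u) = mono (r + s) m S u.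
Proof. by rewrite !monoE hpow_sng. Qed.

Lemma onps_mono f r m S u : linear f -> onps f (mono r m S u) = mono r m S (f u).
Proof. by move=> lf; rewrite !monoE onps_sng. Qed.

Lemma mcreate_mono g r m S u : mcreate g (mono r m S u) = mono r (g :: m) S u.
Proof. by rewrite !monoE mcreate_sng mset_cons. Qed.

Lemma mderiv_mono0 g r S u : mderiv g (mono r [::] S u) = 0.
Proof. by rewrite monoE mderiv_sng /= mset_seqE scale0r (lin0 (sng_linear _)). Qed.

Lemma mderiv_mono1 g f r S u :
  mderiv g (mono r [:: f] S u) = if g == f then mono r [::] S u else 0.
Proof.
rewrite monoE mderiv_sng /= mset_seqE /= addn0 eq_sym.
case: eqP => [->|_]; last by rewrite scale0r (lin0 (sng_linear _)).
by rewrite scale1r monoE mset_cons msetD1K.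
Qed.

Lemma fset_consE (e : ggen) S :
  [fset f in e :: S]%fset = (e |` [fset f in S])%fset :> {fset ggen}.
Proof. by apply/fsetP => f; rewrite !inE. Qed.

Lemma gsign_seq e S : uniq S ->
  gsign K e [fset f in S]%fset = (-1) ^+ count (fun f => gcode f < gcode e)%N S.
Proof.
move=> uS; rewrite /gsign; congr (_ ^+ _); apply/permP.
by apply: uniq_perm; rewrite ?fset_uniq // => f; rewrite inE.
Qed.

Lemma gcreate_mono e r m S u : uniq S -> gcreate e (mono r m S u) =
  if e \in S then 0
  else (-1) ^+ count (fun f => gcode f < gcode e)%N S *: mono r m (e :: S) u.
Proof.
move=> uS; rewrite !monoE gcreate_sng /= inE; case: (e \in S) => //=.
by rewrite gsign_seq // fset_consE (linZ (sng_linear _)).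
Qed.

Lemma gdelete_mono e r m S u : uniq S -> gdelete e (mono r m S u) =
  if e \in S then (-1) ^+ count (fun f => gcode f < gcode e)%N S *:
                  mono r m (rem e S) u
  else 0.
Proof.
move=> uS; rewrite !monoE gdelete_sng /= inE; case: (e \in S) => //=.
rewrite gsign_seq // (linZ (sng_linear _)); congr (_ *: sng (_, _) _).
by apply/fsetP => f; rewrite !inE /= mem_rem_uniq // inE.
Qed.

Lemma scoef_mono r m S r' m' S' u : scoef r m S (mono r' m' S' u) =
  if [&& r' == r, perm_eq m' m & same_ghosts S' S] then u else 0.
Proof.
have -> : scoef r m S (mono r' m' S' u) =
    coef (r, seq_mset m, [fset e in S]%fset) (mono r' m' S' u).
  by rewrite coef.unlock.
rewrite monoE coef_sng -same_ghostsP !xpair_eqE -andbA.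
by congr (if [&& _, _ & _] then _ else _); apply/eqP/idP => /eq_seq_msetP.
Qed.

(* Contractions only raise the power of h, so the corrections to a leading term
   need not be computed: it is enough that they lie in [hge r S] for a large r. *)
Definition hge r S x : Prop := supp_in (fun k : basis =>
  (r <= k.1.1) && (k.2 == [fset e in S]%fset)) x.

Lemma hgeS r r' S x : r <= r' -> hge r' S x -> hge r S x.
Proof.
by move=> rr; apply: sub_supp_in => k /andP[/(le_trans rr) -> ->].
Qed.

Lemma hge_mono r r' m S u : r <= r' -> hge r S (mono r' m S u).
Proof. by move=> rr; rewrite monoE; apply: supp_in_sng; rewrite /= rr eqxx. Qed.

Lemma hge_gcreate e r S x : hge r S x -> hge r (e :: S) (gcreate e x).
Proof.
move=> hx; apply: (supp_in_gcreate hx) => k /andP[kr /eqP kS] /=.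
by rewrite kr fset_consE kS eqxx.
Qed.

Lemma hge_hpow s r S x : hge r S x -> hge (r + s) S (hpow s x).
Proof. by move=> hx; apply: (supp_in_hpow hx) => k; rewrite /= lerD2r. Qed.

Lemma scoef_hge r m S r' S' x : hge r' S' x ->
  ~~ same_ghosts S' S || (r < r') -> scoef r m S x = 0.
Proof.
move=> hx; rewrite -same_ghostsP.
have -> : scoef r m S x = coef (r, seq_mset m, [fset e in S]%fset) x.
  by rewrite coef.unlock.
move=> h; apply/eqP; apply: contraT => /hx /= /andP[rr /eqP SS].
by move: h; rewrite -SS eqxx /= ltNge rr.
Qed.

(** The six pairs are the ghost sectors read by [hcoef], each with the shift of the power of h at
    which it is read. For explicit arguments the condition is decided by computation. *)
Definition killed s r S := all (fun p => ~~ same_ghosts S p.1 || (s + p.2 < r))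
  [:: ([::], 0); ([:: c_], 0); ([:: dc_], 1); ([:: c_; dc_], 1);
      ([:: c_; hd2c_], 1); ([:: c_; dc_; hd2c_], 2)].

Lemma hcoef_hge s r S x : hge r S x -> killed s r S -> hcoef s x = 0.
Proof.
move=> hx; rewrite /killed /= !addr0 => /and5P[k1 k2 k3 k4 /and3P[k5 k6 _]].
rewrite /hcoef !(scoef_hge _ hx) // !scaler0.
by congr (_, (_, _, _), (_, _, _), _); apply/funext => i; rewrite (scoef_hge _ hx).
Qed.

(** Fields built from p and X leave the ghosts alone and never lower the power of h, as each
    contraction contributes a factor h and creation operators contribute none. *)
Definition matter F := good F /\ forall n r S x, hge r S x -> hge r S (F n x).

Lemma hge0 r S : hge r S 0.
Proof. exact: supp_in0. Qed.

Lemma matter_Xfield i : matter (@Xfield K D i).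
Proof.
split=> [|n r S x hx]; first exact: good_Xfield.
rewrite /Xfield; case: (- n) => [[|l]|l] /=.
- exact: (supp_in_onps hx).
- apply: (@hgeS _ (r + 1)); first by lia.
  by apply: hge_hpow; apply: (supp_in_mderiv hx).
- exact: (supp_in_mcreate hx).
Qed.

Lemma matter_pfield i : matter (@pfield K D i).
Proof.
split=> [|n r S x hx]; first exact: good_pfield.
rewrite /pfield; case: (- n - 1) => [[|l]|l] /=; last exact: (supp_in_mcreate hx).
- apply: supp_inN; apply: (@hgeS _ (r + 1)); first by lia.
  by apply: hge_hpow; apply: (supp_in_onps hx).
- apply: supp_inN; apply: (@hgeS _ (r + 1)); first by lia.
  by apply: hge_hpow; apply: (supp_in_mderiv hx).
Qed.

Lemma matter_idfield : matter (@idfield K D).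
Proof.
split=> [|n r S x hx]; first exact: good_idfield.
by rewrite /idfield; case: eqP => _ //; exact: hge0.
Qed.

Lemma matter_Xosc i : matter (@Xosc K D i).
Proof.
split=> [|n r S x hx]; first exact: good_Xosc.
rewrite /Xosc; case: eqP => _; first exact: hge0.
exact: (matter_Xfield i).2.
Qed.

Lemma matter_fderiv F : matter F -> matter (fderiv F).
Proof.
move=> [gF hF]; split=> [|n r S x hx]; first exact: good_fderiv.
by apply: supp_inZ; exact: hF.
Qed.

Lemma matter_nprod o F G : matter F -> matter G -> matter (nprod o F G).
Proof.
move=> [gF hF] [gG hG]; split=> [|n r S x hx]; first exact: good_nprod.
apply: supp_inD; last apply: supp_inZ.
  by apply: supp_in_fsum => k; apply: hF; exact: hG.
by apply: supp_in_fsum => k; apply: hG; exact: hF.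
Qed.

Lemma matter_oscs a : matter (@oscs K D a).
Proof.
apply: (@oscs_ind K D (fun _ F => matter F)) => [|l i F mF]; first exact: matter_idfield.
by apply: matter_nprod => //; exact: matter_Xosc.
Qed.

Lemma matter_psfield u : matter (psfield u).
Proof.
split=> [|n r S x hx]; first exact: good_psfield.
rewrite psfieldE; apply: supp_in_fsum => a.
by apply: (supp_in_onps ((matter_oscs a).2 n r S x hx)).
Qed.

Lemma matter_sum I (s : seq I) (F : I -> field) : (forall i, matter (F i)) ->
  matter (fun n x => \sum_(i <- s) F i n x).
Proof.
move=> mF; split=> [|n r S x hx]; first by apply: good_sum => i; have [] := mF i.
by apply: supp_in_sum => i _; exact: (mF i).2.
Qed.

(* A product of more oscillators than powers of z contains an annihilator. *)
Lemma hge_oscs (a : mindex D) n r S x : hge r S x -> n < (\sum_i a i)%:Z ->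
  hge (r + 1) S (oscs a n x).
Proof.
suff [_] : (fun (l : int) F => matter F /\ forall n r S x, hge r S x -> n < l ->
    hge (r + 1) S (F n x)) (\sum_i a i)%:Z (oscs a) by apply.
elim/(@oscs_ind K D) : (oscs a) => [|l i F [mF IH]].
  split=> [|{}n {}r {}S {}x hx n0]; first exact: matter_idfield.
  by rewrite /idfield; case: eqP => [n00|_]; [lia|exact: hge0].
split=> [|{}n {}r {}S {}x hx nl]; first by apply: matter_nprod => //; exact: matter_Xosc.
apply: supp_inD; last apply: supp_inZ; apply: supp_in_fsum => k.
  case: k => [|k]; first by rewrite /Xosc; exact: hge0.
  by apply: (matter_Xosc i).2; apply: IH => //; lia.
apply: mF.2; rewrite /Xosc; case: eqP => [|_]; first by lia.
rewrite /Xfield (_ : - - k.+1%:Z = Posz k.+1); last by lia.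
by apply: hge_hpow; apply: (supp_in_mderiv hx).
Qed.

Lemma oscs0 : oscs (mzero D) = @idfield K D.
Proof. by rewrite /oscs; elim: (enum _) => [//|i s IH] /=; rewrite ffunE. Qed.

Lemma nprod_id o F : good F -> nprod o F (@idfield K D) =
  fun n x => if (o : bool) && (n < 0) then - F n x else F n x.
Proof.
move=> gF; apply/funext => n; apply/funext => x; have F0 l := lin0 (good_linear gF l).
case: n => l.
  rewrite (nprod_trunc _ (N1 := l.+1) (N2 := 0)) => [|k lk|k _].
  - rewrite big_ord0 scaler0 addr0 andbF big_ord_recr big1 /= => [|k _].
      by rewrite add0r subrr /idfield eqxx.
    by rewrite /idfield; case: eqP => // e; have := ltn_ord k; lia.
  - by rewrite /idfield; case: eqP => // e; lia.
  - by rewrite /idfield; case: eqP => // e; lia.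
rewrite (nprod_trunc _ (N1 := 0) (N2 := l.+1)) => [|k lk|k lk].
- rewrite big_ord0 add0r andbT big_ord_recr big1 /= => [|k _].
    have -> : Negz l = - l.+1%:Z by lia.
    rewrite add0r addNr /idfield eqxx.
    by case: o; rewrite ?expr1 ?scaleN1r ?expr0 ?scale1r.
  by rewrite /idfield; case: eqP => // e; have := ltn_ord k; lia.
- by rewrite /idfield; case: eqP => // e; lia.
- by rewrite /idfield; case: eqP => // e; lia.
Qed.

Lemma oscs1 l : oscs (munit l) = @Xosc K D l.
Proof.
rewrite /oscs foldr_munit nprod_id; last exact: good_Xosc.
by [].
Qed.

Lemma mindex_small (a : mindex D) : (\sum_i a i < 2)%N ->
  a = mzero D \/ exists l, a = munit l.
Proof.
move=> a2; case: (pickP (fun i => 0 < a i)%N) => [l al|a0]; last first.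
  by left; apply/ffunP => i; rewrite ffunE; apply/eqP; rewrite -leqn0 leqNgt a0.
right; exists l; move: a2; rewrite (bigD1 l) //= => a2; apply/ffunP => i.
rewrite ffunE; case: eqP => [->|/eqP il].
  by move: al a2; case: (a l) => [//|[//|q _]]; rewrite !addSn.
move: a2; rewrite (bigD1 i) //=; move: al; case: (a l) => [//|q _].
by case: (a i) => // t; rewrite addSn addnCA addSn.
Qed.

(** With fewer than two oscillators allowed, only the constant and linear Taylor terms survive. This
    range covers n <= 1 on states without p and n <= -1 on states with a single p_{j,-1}; the case n
    = 0 on a p is treated modulo h instead. *)
Lemma psfield_deg1 u n w x : pwt_le w x -> n + 2%:Z * w < 2 ->
  psfield u n x = onps (psmul u) (idfield n x) +
    \sum_l onps (psmul (pderiv l u)) (Xosc l n x).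
Proof.
move=> wx nw; rewrite psfieldE.
rewrite (fsum_seq (s := mzero D :: [seq munit l | l <- enum 'I_D])).
- rewrite big_cons.
  rewrite oscs0 taylor0.
  rewrite big_map.
  rewrite big_enum.
  apply: f_equal2; first by [].
  by apply: eq_bigr => l _; rewrite oscs1 taylor_munit.
- rewrite /= map_inj_uniq ?enum_uniq ?andbT => [|l l' /ffunP/(_ l)].
    apply/mapP => -[l _ /ffunP/(_ l)]; by rewrite !ffunE eqxx.
  by rewrite !ffunE eqxx; case: eqP.
move=> a ar; rewrite (@oscs_order K D a _ w) ?onps0 //.
apply: (lt_le_trans nw); rewrite leNgt; apply/negP => a2; case/negP: ar.
have [->|[l ->]] := mindex_small a2; first by rewrite inE eqxx.
by rewrite inE map_f ?orbT // mem_enum.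
Qed.

(** At the power z^0 every nonconstant Taylor term contains an annihilator of X, hence an additional
    factor h. *)
Lemma psfield_mod u r S x : hge r S x ->
  hge (r + 1) S (psfield u 0 x - onps (psmul u) x).
Proof.
move=> hx; have [w wx] := ex_pwt_le x; pose N := (w.*2).+1.
have nN : 0 + 2%:Z * w%:Z < N%:Z by rewrite /N; lia.
rewrite (psfield_box u wx nN).
have [z zE] : exists z : {ffun 'I_D -> 'I_N}, boxval z = mzero D.
  by apply: boxvalP => i; rewrite ffunE.
rewrite (bigD1 z) //= zE oscs0 taylor0 addrAC.
have -> : idfield 0 x = x by rewrite /idfield eqxx.
rewrite subrr add0r; apply: supp_in_sum => f fz.
apply: (supp_in_onps (P := fun k : basis =>
  (r + 1 <= k.1.1) && (k.2 == [fset e in S]%fset))) => //.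
apply: hge_oscs => //; rewrite ltz_nat lt0n; apply: contra fz.
rewrite sum_nat_eq0 => /forallP f0; apply/eqP/boxval_inj; rewrite zE.
by apply/ffunP => i; rewrite [RHS]ffunE; apply/eqP; exact: f0.
Qed.

End Monomials.

(** * Modes of the matter fields on light monomials *)

Section MatterModes.
Context (K : fieldType) (D : nat).
Local Notation state := (state K D).
Local Notation pseries := (pseries K D).
Local Notation field := (field K D).
Local Notation vect := (vect K D).
Local Notation mono := (@mono K D).
Local Notation pf := (@pfield K D).
Local Notation Xf := (@Xfield K D).
Implicit Types (x y : state) (u v : pseries) (r n : int) (i j l : 'I_D) (S : seq ggen).

Lemma sum_nat2 (V : zmodType) (F : nat -> V) : \sum_(0 <= k < 2) F k = F 0%N + F 1%N.
Proof. by rewrite big_nat_recr //= big_nat1. Qed.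

Lemma nprod_terms o (A B : field) n x N1 N2 :
  (forall k : nat, (N1 <= k)%N -> A k%:Z (B (n - k%:Z) x) = 0) ->
  (forall k : nat, (N2 <= k)%N -> B (n + k.+1%:Z) (A (- k.+1%:Z) x) = 0) ->
  nprod o A B n x = \sum_(0 <= k < N1) A k%:Z (B (n - k%:Z) x) +
    (-1) ^+ o *: \sum_(0 <= k < N2) B (n + k.+1%:Z) (A (- k.+1%:Z) x).
Proof. by move=> h1 h2; rewrite !big_mkord; exact: nprod_trunc. Qed.

(** The coefficient of z^n in p_i(z) is p_{i,-n-1}: it creates for n >= 0, is - h d_i for n = -1,
    and for n = -k-2 contracts with X^i_{-k-1}. *)
Lemma pf_pos i n (k : nat) r m S u : n = k%:Z ->
  pf i n (mono r m S u) = mono r (inl (i, k) :: m) S u.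
Proof.
move=> ->; rewrite /pfield (_ : - k%:Z - 1 = Negz k); last by lia.
exact: mcreate_mono.
Qed.

Lemma pf_zero i n r m S u : n = -1 ->
  pf i n (mono r m S u) = - mono (r + 1) m S (pderiv i u).
Proof.
move=> ->; rewrite /pfield (_ : - -1 - 1 = Posz 0) //.
rewrite [pmode _ _ _]/(- hpow 1 (onps (pderiv i) _)) onps_mono ?hpow_mono //.
exact: pderiv_linear.
Qed.

Lemma pf_neg i n x : n <= -2 ->
  exists k : nat, n = - k.+2%:Z /\ pf i n x = - hpow 1 (mderiv (inr (i, k)) x).
Proof.
case: n => [|[|k]] // _; exists k; split; first by lia.
by rewrite /pfield (_ : - Negz k.+1 - 1 = Posz k.+1) //; lia.
Qed.

Lemma hpow0 s : hpow s 0 = 0 :> state.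
Proof. exact: (lin0 (hpow_linear s)). Qed.

Lemma pf_neg_1 i n r S u : n <= -2 -> pf i n (mono r [::] S u) = 0.
Proof. by case/(@pf_neg i _ (mono r [::] S u)) => k [_ ->]; rewrite mderiv_mono0 hpow0 oppr0. Qed.

Lemma pf_neg_p i j n r S u : n <= -2 -> pf i n (mono r [:: pgen j] S u) = 0.
Proof.
case/(@pf_neg i _ (mono r [:: pgen j] S u)) => k [_ ->].
by rewrite mderiv_mono1 hpow0 oppr0.
Qed.

Lemma pf_neg_d i j n r S u : n = -2 -> pf i n (mono r [:: dXgen j] S u) =
  if i == j then - mono (r + 1) [::] S u else 0.
Proof.
move=> n2; have : n <= -2 by lia.
case/(@pf_neg i _ (mono r [:: dXgen j] S u)) => k [nk ->].
have -> : k = 0%N by lia.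
rewrite mderiv_mono1 (_ : (inr (i, 0%N) == dXgen j) = (i == j)).
  by case: eqP => _; rewrite ?hpow_mono // hpow0 oppr0.
by rewrite /eq_op /= xpair_eqE eqxx andbT.
Qed.

Lemma pf_neg2_d i j n r S u : n <= -3 -> pf i n (mono r [:: dXgen j] S u) = 0.
Proof.
move=> n3; have : n <= -2 by lia.
case/(@pf_neg i _ (mono r [:: dXgen j] S u)) => k [nk ->].
rewrite mderiv_mono1 (_ : (inr (i, k) == dXgen j) = false) ?hpow0 ?oppr0 //.
by rewrite /eq_op /= xpair_eqE; case: k nk => [|k]; [lia|rewrite andbF].
Qed.

Lemma Xf_pos i n (k : nat) r m S u : n = k.+1%:Z ->
  Xf i n (mono r m S u) = mono r (inr (i, k) :: m) S u.
Proof. by move=> ->; exact: mcreate_mono. Qed.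

Lemma Xf_neg i n x : n < 0 ->
  exists k : nat, n = - k.+1%:Z /\ Xf i n x = hpow 1 (mderiv (inl (i, k)) x).
Proof. by case: n => // k _; exists k; split. Qed.

Lemma Xf_neg_1 i n r S u : n < 0 -> Xf i n (mono r [::] S u) = 0.
Proof. by case/(@Xf_neg i _ (mono r [::] S u)) => k [_ ->]; rewrite mderiv_mono0 hpow0. Qed.

Lemma Xf_neg_d i j n r S u : n < 0 -> Xf i n (mono r [:: dXgen j] S u) = 0.
Proof.
case/(@Xf_neg i _ (mono r [:: dXgen j] S u)) => k [_ ->].
by rewrite mderiv_mono1 hpow0.
Qed.

Lemma Xf_neg_p i j n r S u : n = -1 -> Xf i n (mono r [:: pgen j] S u) =
  if i == j then mono (r + 1) [::] S u else 0.
Proof.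
move=> n1; have : n < 0 by lia.
case/(@Xf_neg i _ (mono r [:: pgen j] S u)) => k [nk ->].
have -> : k = 0%N by lia.
rewrite mderiv_mono1 (_ : (inl (i, 0%N) == pgen j) = (i == j)).
  by case: eqP => _; rewrite ?hpow_mono // hpow0.
by rewrite /eq_op /= xpair_eqE eqxx andbT.
Qed.

Lemma Xf_neg2_p i j n r S u : n <= -2 -> Xf i n (mono r [:: pgen j] S u) = 0.
Proof.
move=> n2; have : n < 0 by lia.
case/(@Xf_neg i _ (mono r [:: pgen j] S u)) => k [nk ->].
rewrite mderiv_mono1 (_ : (inl (i, k) == pgen j) = false) ?hpow0 //.
by rewrite /eq_op /= xpair_eqE; case: k nk => [|k]; [lia|rewrite andbF].
Qed.

Lemma pwt_mono r m S u : pwt_le (\sum_(g <- m) pweight g)%N%:Z (mono r m S u).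
Proof.
rewrite monoE; apply: supp_in_sng; rewrite /pwt /=.
by rewrite (perm_big _ (perm_eq_seq_mset m)).
Qed.

Lemma pwt_mono_1 r S u : pwt_le 0 (mono r [::] S u).
Proof. by have := @pwt_mono r [::] S u; rewrite big_nil. Qed.

Lemma pwt_mono_d r j S u : pwt_le 0 (mono r [:: dXgen j] S u).
Proof. by have := @pwt_mono r [:: dXgen j] S u; rewrite big_seq1. Qed.

Lemma pwt_mono_p r j S u : pwt_le 1 (mono r [:: pgen j] S u).
Proof. by have := @pwt_mono r [:: pgen j] S u; rewrite big_seq1. Qed.

Arguments pwt_mono_1 : clear implicits.
Arguments pwt_mono_d : clear implicits.
Arguments pwt_mono_p : clear implicits.

Lemma psfield_lt0 u n x : pwt_le 0 x -> n < 0 -> psfield u n x = 0.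
Proof.
move=> wx n0; rewrite psfieldE fsbig1 // => a _.
by rewrite (@oscs_order K D a _ 0) ?onps0 //; lia.
Qed.

Lemma psfield_0 u n x : pwt_le 0 x -> n = 0 -> psfield u n x = onps (psmul u) x.
Proof.
move=> wx n0; rewrite (psfield_deg1 u wx); last by lia.
rewrite big1 => [|l _]; first by rewrite addr0 /idfield n0 eqxx.
by rewrite /Xosc n0 eqxx onps0.
Qed.

Lemma psfield_01 v n r S u : n = 0 ->
  psfield v n (mono r [::] S u) = mono r [::] S (psmul v u).
Proof.
move=> n0; rewrite (psfield_0 _ (pwt_mono_1 _ _ _)) // onps_mono //.
exact: psmul_linear_r.
Qed.

Lemma psfield_0d v n r j S u : n = 0 ->
  psfield v n (mono r [:: dXgen j] S u) = mono r [:: dXgen j] S (psmul v u).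
Proof.
move=> n0; rewrite (psfield_0 _ (pwt_mono_d _ _ _ _)) // onps_mono //.
exact: psmul_linear_r.
Qed.

Lemma psfield_1 v n r S u : n = 1 -> psfield v n (mono r [::] S u) =
  \sum_l mono r [:: dXgen l] S (psmul (pderiv l v) u).
Proof.
move=> n1; rewrite (psfield_deg1 v (pwt_mono_1 r S u)); last by lia.
rewrite /idfield n1 onps0 add0r; apply: eq_bigr => l _.
rewrite /Xosc (_ : (1 == 0 :> int) = false) // (@Xf_pos _ _ 0) //.
by rewrite onps_mono //; exact: psmul_linear_r.
Qed.

Lemma psfield_p v j n r S u : n = -1 -> psfield v n (mono r [:: pgen j] S u) =
  mono (r + 1) [::] S (psmul (pderiv j v) u).
Proof.
move=> n1; rewrite (psfield_deg1 v (pwt_mono_p r j S u)); last by lia.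
rewrite /idfield n1 onps0 add0r (bigD1 j) //= big1 => [|l lj].
  rewrite addr0 /Xosc (_ : (-1 == 0 :> int) = false) // Xf_neg_p // eqxx.
  by rewrite onps_mono //; exact: psmul_linear_r.
by rewrite /Xosc (_ : (-1 == 0 :> int) = false) // Xf_neg_p // (negPf lj) onps0.
Qed.

Lemma psfield_p2 v j n r S u : n <= -2 -> psfield v n (mono r [:: pgen j] S u) = 0.
Proof.
move=> n2; rewrite (psfield_deg1 v (pwt_mono_p r j S u)); last by lia.
have n0 : (n == 0) = false by lia.
rewrite /idfield n0 onps0 add0r big1 // => l _.
by rewrite /Xosc n0 Xf_neg2_p // onps0.
Qed.

(** Congruence modulo order r in h. The ghost sector is recorded as well, because the power of h at
    which [hcoef] reads a term depends on it. *)
Definition cg r S x y : Prop := hge r S (x - y).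

Lemma cg_refl r S x : cg r S x x.
Proof. by rewrite /cg subrr; exact: hge0. Qed.

Lemma cg_eq r S x y : x = y -> cg r S x y.
Proof. by move=> ->; exact: cg_refl. Qed.

Lemma cg_add r S x y z t : cg r S x y -> cg r S z t -> cg r S (x + z) (y + t).
Proof. by move=> xy zt; rewrite /cg opprD addrACA; exact: supp_inD. Qed.

Lemma cg_opp r S x y : cg r S x y -> cg r S (- x) (- y).
Proof. by move=> xy; rewrite /cg -opprD; exact: supp_inN. Qed.

Lemma cg_sum r S I (s : seq I) (P : pred I) (F G : I -> state) :
  (forall t, P t -> cg r S (F t) (G t)) ->
  cg r S (\sum_(t <- s | P t) F t) (\sum_(t <- s | P t) G t).
Proof. by move=> FG; rewrite /cg -sumrB; exact: supp_in_sum. Qed.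

Lemma cg0 r S x : hge r S x -> cg r S x 0.
Proof. by rewrite /cg subr0. Qed.

Lemma psfield_mod0 v n r m S u : n = 0 ->
  cg (r + 1) S (psfield v n (mono r m S u)) (mono r m S (psmul v u)).
Proof.
move=> ->; have := @psfield_mod K D v r S _ (@hge_mono K D r r m S u (lexx r)).
by rewrite onps_mono //; exact: psmul_linear_r.
Qed.

Lemma pf_lin i n : linear (pf i n). Proof. exact: good_linear (good_pfield K i) n. Qed.
Lemma ps_lin u n : linear (psfield u n). Proof. exact: good_linear (good_psfield u) n. Qed.

Definition pAfield i (A : pseries) : field := nprod false (pf i) (psfield A).
Definition XBfield i (B : pseries) : field := nprod false (fderiv (Xf i)) (psfield B).

Lemma matter_pA i A : matter (pAfield i A).
Proof. by apply: matter_nprod; [exact: matter_pfield|exact: matter_psfield]. Qed.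

Lemma matter_XB i B : matter (XBfield i B).
Proof.
by apply: matter_nprod; [apply: matter_fderiv; exact: matter_Xfield|exact: matter_psfield].
Qed.

(** In this and the following evaluations N1 and N2 count the creation and annihilation modes of the
    left factor that may contribute at the given power of z; all other terms vanish by the bounds on
    single fields above. *)
Lemma pA_1_lt i A n r S u : n <= -2 -> pAfield i A n (mono r [::] S u) = 0.
Proof.
move=> n2; rewrite /pAfield (nprod_terms _ (N1 := 0) (N2 := 0)) => [|k _|[|k] _].
- by rewrite !big_geq // scaler0 addr0.
- by rewrite (psfield_lt0 _ (pwt_mono_1 _ _ _)) ?(lin0 (pf_lin _ _)) //; lia.
- rewrite pf_zero // (linN (ps_lin _ _)) (psfield_lt0 _ (pwt_mono_1 _ _ _)) ?oppr0 //; lia.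
- by rewrite pf_neg_1 ?(lin0 (ps_lin _ _)) //; lia.
Qed.

Lemma pA_1_m1 i A n r S u : n = -1 ->
  pAfield i A n (mono r [::] S u) = - mono (r + 1) [::] S (psmul A (pderiv i u)).
Proof.
move=> n1; rewrite /pAfield (nprod_terms _ (N1 := 0) (N2 := 1)) => [|k _|[|k] // _].
- rewrite big_geq // big_nat1 scale1r add0r pf_zero // (linN (ps_lin _ _)).
  by rewrite psfield_01 //; lia.
- by rewrite (psfield_lt0 _ (pwt_mono_1 _ _ _)) ?(lin0 (pf_lin _ _)) //; lia.
- by rewrite pf_neg_1 ?(lin0 (ps_lin _ _)) //; lia.
Qed.

Lemma pA_1_0 i A n r S u : n = 0 ->
  cg (r + 1) S (pAfield i A n (mono r [::] S u)) (mono r [:: pgen i] S (psmul A u)).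
Proof.
move=> n0; rewrite /pAfield (nprod_terms _ (N1 := 1) (N2 := 1)) => [|[|k] // _|[|k] // _].
- rewrite !big_nat1 scale1r -[X in cg _ _ _ X]addr0; apply: cg_add.
    rewrite psfield_01; last by lia.
    by rewrite (@pf_pos _ _ 0) //; exact: cg_refl.
  apply: cg0; apply: (matter_psfield A).2; rewrite pf_zero //.
  by apply: supp_inN; exact: hge_mono.
- by rewrite (psfield_lt0 _ (pwt_mono_1 _ _ _)) ?(lin0 (pf_lin _ _)) //; lia.
- by rewrite pf_neg_1 ?(lin0 (ps_lin _ _)) //; lia.
Qed.

Lemma pA_p_lt i j A n r S u : n <= -3 -> pAfield i A n (mono r [:: pgen j] S u) = 0.
Proof.
move=> n3; rewrite /pAfield (nprod_terms _ (N1 := 0) (N2 := 0)) => [|k _|[|k] _].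
- by rewrite !big_geq // scaler0 addr0.
- by rewrite psfield_p2 ?(lin0 (pf_lin _ _)) //; lia.
- by rewrite pf_zero // (linN (ps_lin _ _)) psfield_p2 ?oppr0 //; lia.
- by rewrite pf_neg_p ?(lin0 (ps_lin _ _)) //; lia.
Qed.

Lemma pA_p_m1 i j A n r S u : n = -1 ->
  cg (r + 2) S (pAfield i A n (mono r [:: pgen j] S u))
    (mono (r + 1) [:: pgen i] S (psmul (pderiv j A) u)
     - mono (r + 1) [:: pgen j] S (psmul A (pderiv i u))).
Proof.
move=> n1; rewrite /pAfield (nprod_terms _ (N1 := 1) (N2 := 1)) => [|[|k] // _|[|k] // _].
- rewrite !big_nat1 scale1r; apply: cg_add.
    rewrite psfield_p; last by lia.
    by rewrite (@pf_pos _ _ 0) //; exact: cg_refl.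
  rewrite pf_zero // (linN (ps_lin _ _)); apply: cg_opp.
  by rewrite (_ : r + 2 = r + 1 + 1); [apply: psfield_mod0; lia|lia].
- by rewrite psfield_p2 ?(lin0 (pf_lin _ _)) //; lia.
- by rewrite pf_neg_p ?(lin0 (ps_lin _ _)) //; lia.
Qed.

Lemma pA_d_lt i j A n r S u : n <= -3 -> pAfield i A n (mono r [:: dXgen j] S u) = 0.
Proof.
move=> n3; rewrite /pAfield (nprod_terms _ (N1 := 0) (N2 := 0)) => [|k _|[|[|k]] _].
- by rewrite !big_geq // scaler0 addr0.
- by rewrite (psfield_lt0 _ (pwt_mono_d _ _ _ _)) ?(lin0 (pf_lin _ _)) //; lia.
- rewrite pf_zero // (linN (ps_lin _ _)) (psfield_lt0 _ (pwt_mono_d _ _ _ _)) ?oppr0 //; lia.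
- rewrite pf_neg_d //; case: eqP => _; last exact: (lin0 (ps_lin _ _)).
  by rewrite (linN (ps_lin _ _)) (psfield_lt0 _ (pwt_mono_1 _ _ _)) ?oppr0 //; lia.
- by rewrite pf_neg2_d ?(lin0 (ps_lin _ _)) //; lia.
Qed.

Lemma pA_d_m2 i j A n r S u : n = -2 -> pAfield i A n (mono r [:: dXgen j] S u) =
  if i == j then - mono (r + 1) [::] S (psmul A u) else 0.
Proof.
move=> n2; rewrite /pAfield (nprod_terms _ (N1 := 0) (N2 := 2)) => [|k _|[|[|k]] // _].
- rewrite big_geq // sum_nat2 scale1r add0r pf_zero // (linN (ps_lin _ _)).
  rewrite (psfield_lt0 _ (pwt_mono_d _ _ _ _)); last by lia.
  rewrite oppr0 add0r pf_neg_d //; case: eqP => _; last exact: (lin0 (ps_lin _ _)).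
  rewrite (linN (ps_lin _ _)) psfield_01 //; lia.
- by rewrite (psfield_lt0 _ (pwt_mono_d _ _ _ _)) ?(lin0 (pf_lin _ _)) //; lia.
- by rewrite pf_neg2_d ?(lin0 (ps_lin _ _)) //; lia.
Qed.

Lemma pA_d_m1 i j A n r S u : n = -1 -> pAfield i A n (mono r [:: dXgen j] S u) =
  - mono (r + 1) [:: dXgen j] S (psmul A (pderiv i u))
  - if i == j then \sum_l mono (r + 1) [:: dXgen l] S (psmul (pderiv l A) u) else 0.
Proof.
move=> n1; rewrite /pAfield (nprod_terms _ (N1 := 0) (N2 := 2)) => [|k _|[|[|k]] // _].
- rewrite big_geq // sum_nat2 scale1r add0r pf_zero // (linN (ps_lin _ _)).
  rewrite psfield_0d; last by lia.
  apply: f_equal2 => //; rewrite pf_neg_d //; case: eqP => _; last first.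
    by rewrite oppr0; exact: (lin0 (ps_lin _ _)).
  by rewrite (linN (ps_lin _ _)) psfield_1 //; lia.
- by rewrite (psfield_lt0 _ (pwt_mono_d _ _ _ _)) ?(lin0 (pf_lin _ _)) //; lia.
- by rewrite pf_neg2_d ?(lin0 (ps_lin _ _)) //; lia.
Qed.

Lemma fderivE (F : field) n x : fderiv F n x = (n + 1)%:~R *: F (n + 1) x.
Proof. by []. Qed.

Lemma fderiv_m1 (F : field) n x : n = -1 -> fderiv F n x = 0.
Proof. by move=> ->; rewrite fderivE addNr scale0r. Qed.

Lemma dXf_lin i n : linear (fderiv (Xf i) n).
Proof. exact: good_linear (good_fderiv (good_Xfield K i)) n. Qed.

Lemma dXf_0 i n r m S u : n = 0 ->
  fderiv (Xf i) n (mono r m S u) = mono r (dXgen i :: m) S u.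
Proof. by move=> ->; rewrite fderivE (@Xf_pos _ _ 0) // add0r scale1r. Qed.

Lemma dXf_neg_1 i n r S u : n < 0 -> fderiv (Xf i) n (mono r [::] S u) = 0.
Proof.
move=> n0; have [n1|n1] := eqVneq n (-1); first exact: fderiv_m1.
by rewrite fderivE Xf_neg_1 ?scaler0 //; lia.
Qed.

Lemma dXf_neg_d i j n r S u : n < 0 -> fderiv (Xf i) n (mono r [:: dXgen j] S u) = 0.
Proof.
move=> n0; have [n1|n1] := eqVneq n (-1); first exact: fderiv_m1.
by rewrite fderivE Xf_neg_d ?scaler0 //; lia.
Qed.

Lemma dXf_neg_p i j n r S u : n = -2 -> fderiv (Xf i) n (mono r [:: pgen j] S u) =
  if i == j then - mono (r + 1) [::] S u else 0.
Proof.
move=> ->; rewrite fderivE Xf_neg_p // (_ : -2 + 1 = -1) // scaleN1r.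
by case: eqP => _ //; rewrite oppr0.
Qed.

Lemma dXf_neg2_p i j n r S u : n < 0 -> n != -2 ->
  fderiv (Xf i) n (mono r [:: pgen j] S u) = 0.
Proof.
move=> n0 n2; have [n1|n1] := eqVneq n (-1); first exact: fderiv_m1.
by rewrite fderivE Xf_neg2_p ?scaler0 //; lia.
Qed.

Lemma XB_1_lt i B n r S u : n < 0 -> XBfield i B n (mono r [::] S u) = 0.
Proof.
move=> n0; rewrite /XBfield (nprod_terms _ (N1 := 0) (N2 := 0)) => [|k _|k _].
- by rewrite !big_geq // scaler0 addr0.
- by rewrite (psfield_lt0 _ (pwt_mono_1 _ _ _)) ?(lin0 (dXf_lin _ _)) //; lia.
- by rewrite dXf_neg_1 ?(lin0 (ps_lin _ _)) //; lia.
Qed.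

Lemma XB_1_0 i B n r S u : n = 0 ->
  XBfield i B n (mono r [::] S u) = mono r [:: dXgen i] S (psmul B u).
Proof.
move=> n0; rewrite /XBfield (nprod_terms _ (N1 := 1) (N2 := 0)) => [|[|k] // _|k _].
- rewrite big_nat1 big_geq // scaler0 addr0 psfield_01; last by lia.
  by rewrite dXf_0.
- by rewrite (psfield_lt0 _ (pwt_mono_1 _ _ _)) ?(lin0 (dXf_lin _ _)) //; lia.
- by rewrite dXf_neg_1 ?(lin0 (ps_lin _ _)) //; lia.
Qed.

Lemma XB_d_lt i j B n r S u : n < 0 -> XBfield i B n (mono r [:: dXgen j] S u) = 0.
Proof.
move=> n0; rewrite /XBfield (nprod_terms _ (N1 := 0) (N2 := 0)) => [|k _|k _].
- by rewrite !big_geq // scaler0 addr0.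
- by rewrite (psfield_lt0 _ (pwt_mono_d _ _ _ _)) ?(lin0 (dXf_lin _ _)) //; lia.
- by rewrite dXf_neg_d ?(lin0 (ps_lin _ _)) //; lia.
Qed.

Lemma XB_p_lt i j B n r S u : n <= -3 -> XBfield i B n (mono r [:: pgen j] S u) = 0.
Proof.
move=> n3; rewrite /XBfield (nprod_terms _ (N1 := 0) (N2 := 0)) => [|k _|k _].
- by rewrite !big_geq // scaler0 addr0.
- by rewrite psfield_p2 ?(lin0 (dXf_lin _ _)) //; lia.
- have [k1|k1] := eqVneq k 1%N; last first.
    by rewrite dXf_neg2_p ?(lin0 (ps_lin _ _)) //; lia.
  rewrite dXf_neg_p ?k1 //; case: eqP => _; last exact: (lin0 (ps_lin _ _)).
  by rewrite (linN (ps_lin _ _)) (psfield_lt0 _ (pwt_mono_1 _ _ _)) ?oppr0 //; lia.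
Qed.

Lemma XB_p_m2 i j B n r S u : n = -2 -> XBfield i B n (mono r [:: pgen j] S u) =
  if i == j then - mono (r + 1) [::] S (psmul B u) else 0.
Proof.
move=> n2; rewrite /XBfield (nprod_terms _ (N1 := 0) (N2 := 2)) => [|k _|k k2].
- rewrite big_geq // sum_nat2 scale1r add0r.
  (* A derivative has no z^{-1} term, so the mode k = 0 drops out; k = 1 is the double pole of dX^i
     with p_j. *)
  rewrite fderiv_m1 // (lin0 (ps_lin _ _)) add0r.
  rewrite dXf_neg_p //; case: eqP => _; last exact: (lin0 (ps_lin _ _)).
  rewrite (linN (ps_lin _ _)) psfield_01 //; lia.
- by rewrite psfield_p2 ?(lin0 (dXf_lin _ _)) //; lia.
- by rewrite dXf_neg2_p ?(lin0 (ps_lin _ _)) //; lia.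
Qed.

Lemma XB_p_m1 i j B n r S u : n = -1 -> XBfield i B n (mono r [:: pgen j] S u) =
  mono (r + 1) [:: dXgen i] S (psmul (pderiv j B) u)
  - if i == j then \sum_l mono (r + 1) [:: dXgen l] S (psmul (pderiv l B) u) else 0.
Proof.
move=> n1; rewrite /XBfield (nprod_terms _ (N1 := 1) (N2 := 2)) => [|[|k] // _|k k2].
- rewrite big_nat1 sum_nat2 scale1r psfield_p; last by lia.
  rewrite dXf_0 // fderiv_m1 // (lin0 (ps_lin _ _)) add0r.
  apply: f_equal2 => //; rewrite dXf_neg_p //; case: eqP => _; last first.
    by rewrite oppr0; exact: (lin0 (ps_lin _ _)).
  by rewrite (linN (ps_lin _ _)) psfield_1 //; lia.
- by rewrite psfield_p2 ?(lin0 (dXf_lin _ _)) //; lia.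
- by rewrite dXf_neg2_p ?(lin0 (ps_lin _ _)) //; lia.
Qed.

End MatterModes.

(** * Fields of V^1 and the Courant structure; modes of L *)

Section VectorFields.
Context (K : fieldType) (D : nat).
Local Notation state := (state K D).
Local Notation pseries := (pseries K D).
Local Notation field := (field K D).
Local Notation vect := (vect K D).
Local Notation mono := (@mono K D).
Local Notation V1mono := (@V1mono K D).
Implicit Types (x y : state) (u v : pseries) (r n : int) (i j k l : 'I_D) (S : seq ggen).
Implicit Types (AB CE : vect * vect).

Local Opaque nprod psfield pfield Xfield hpow onps mcreate mderiv gcreate gdelete Defs.mono.

Definition Vf AB : field := fun n x =>
  \sum_i pAfield i (AB.1 i) n x + \sum_i XBfield i (AB.2 i) n x.

Lemma matter_add (F G : field) : matter F -> matter G ->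
  matter (fun n x => F n x + G n x).
Proof.
move=> [[lF tF] hF] [[lG tG] hG]; split=> [|n r S x hx]; last first.
  by apply: supp_inD; [exact: hF|exact: hG].
split=> [n|x]; first exact: lin_add.
have [N FN] := tF x; have [M GM] := tG x; exists (maxn N M) => n nN.
by rewrite FN ?GM ?addr0 //; lia.
Qed.

Lemma matter_Vf AB : matter (Vf AB).
Proof.
have h1 := matter_sum (index_enum 'I_D) (fun i => matter_pA i (AB.1 i)).
have h2 := matter_sum (index_enum 'I_D) (fun i => matter_XB i (AB.2 i)).
exact: matter_add h1 h2.
Qed.

Lemma Vf_lin AB n : linear (Vf AB n).
Proof. exact: good_linear (matter_Vf AB).1 n. Qed.

Definition pairing AB CE : pseries :=
  \sum_i (psmul (AB.1 i) (CE.2 i) + psmul (AB.2 i) (CE.1 i)).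

(** The Dorfman bracket of the standard Courant algebroid TM + T*M: the Lie bracket of vector fields
    together with L_A E - i_C dB. The double pole of two V^1 fields gives its symmetric pairing,
    [pairing]. *)
Definition dorfman AB CE : vect * vect :=
  ((fun k => \sum_i (psmul (AB.1 i) (pderiv i (CE.1 k))
                     - psmul (pderiv i (AB.1 k)) (CE.1 i))) : vect,
   (fun k => \sum_i (psmul (AB.1 i) (pderiv i (CE.2 k))
                     + psmul (pderiv k (AB.1 i)) (CE.2 i)
                     - psmul (pderiv i (AB.2 k)) (CE.1 i)
                     + psmul (pderiv k (AB.2 i)) (CE.1 i))) : vect).

Definition vscale (v : pseries) AB : vect * vect :=
  ((fun k => psmul v (AB.1 k)) : vect, (fun k => psmul v (AB.2 k)) : vect).

Definition along AB u : pseries := \sum_i psmul (AB.1 i) (pderiv i u).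

Lemma Vf_1_lt AB n r S u : n <= -2 -> Vf AB n (mono r [::] S u) = 0.
Proof.
move=> n2; rewrite /Vf [X in X + _]big1 => [|i _]; last exact: pA_1_lt.
by rewrite add0r; apply: big1 => i _; apply: XB_1_lt; lia.
Qed.

Lemma Vf_1_m1 AB n r S u : n = -1 ->
  Vf AB n (mono r [::] S u) = - mono (r + 1) [::] S (along AB u).
Proof.
move=> n1; rewrite /Vf [X in _ + X]big1 => [|i _]; last by apply: XB_1_lt; lia.
rewrite addr0 (lin_sum (mono_linear _ _ _)) -sumrN.
by apply: eq_bigr => i _; rewrite pA_1_m1.
Qed.

Lemma Vf_1_0 AB n r S u : n = 0 ->
  cg (r + 1) S (Vf AB n (mono r [::] S u)) (V1mono r S (vscale u AB)).
Proof.
move=> n0; apply: cg_add; apply: cg_sum => i _.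
  by rewrite -[(vscale u AB).1 i]/(psmul u (AB.1 i)) psmulC; exact: pA_1_0.
by rewrite XB_1_0 // -[(vscale u AB).2 i]/(psmul u (AB.2 i)) psmulC; exact: cg_refl.
Qed.

Lemma Vf_V1mono AB CE n r S : Vf AB n (V1mono r S CE) = \sum_i \sum_j
  ((pAfield i (AB.1 i) n (mono r [:: pgen j] S (CE.1 j)) +
    pAfield i (AB.1 i) n (mono r [:: dXgen j] S (CE.2 j))) +
   (XBfield i (AB.2 i) n (mono r [:: pgen j] S (CE.1 j)) +
    XBfield i (AB.2 i) n (mono r [:: dXgen j] S (CE.2 j)))).
Proof.
rewrite /Vf -big_split; apply: eq_bigr => i _.
have lp := good_linear (matter_pA i (AB.1 i)).1 n.
have lx := good_linear (matter_XB i (AB.2 i)).1 n.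
rewrite [RHS]big_split; apply: (f_equal2 +%R); rewrite [RHS]big_split /Defs.V1mono.
  by apply: (etrans (linD lp _ _)); apply: (f_equal2 +%R); exact: (lin_sum lp).
by apply: (etrans (linD lx _ _)); apply: (f_equal2 +%R); exact: (lin_sum lx).
Qed.

Lemma Vf_V_lt AB CE n r S : n <= -3 -> Vf AB n (V1mono r S CE) = 0.
Proof.
move=> n3; rewrite Vf_V1mono; apply: big1 => i _; apply: big1 => j _.
have add4 (V : zmodType) (a b c d : V) : a = 0 -> b = 0 -> c = 0 -> d = 0 ->
  a + b + (c + d) = 0 by move=> -> -> -> ->; rewrite !addr0.
by apply: add4; [exact: pA_p_lt|exact: pA_d_lt|exact: XB_p_lt|apply: XB_d_lt; lia].
Qed.

Lemma sum_diag (V : zmodType) i (F : 'I_D -> V) :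
  \sum_j (if i == j then F j else 0) = F i.
Proof. by rewrite -big_mkcond (big_pred1 i) // => j; rewrite eq_sym. Qed.

(** Both p's are contracted, each with the coefficient function of the other field. The term has one
    more power of h than the pairing; it is kept in exact formulas but reaches no leading
    coefficient. *)
Definition double_contraction AB CE : pseries :=
  \sum_i \sum_j psmul (pderiv j (AB.1 i)) (pderiv i (CE.1 j)).

Lemma pA_p_m2E i j A n r S u : n = -2 -> pAfield i A n (mono r [:: pgen j] S u) =
  - mono (r + 1 + 1) [::] S (psmul (pderiv j A) (pderiv i u)).
Proof.
move=> n2; rewrite /pAfield (nprod_terms _ (N1 := 0) (N2 := 1)) => [|q _|[|q] // _].
- rewrite big_geq // big_nat1 scale1r add0r pf_zero // (linN (ps_lin _ _)).
  by rewrite psfield_p //; lia.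
- by rewrite psfield_p2 ?(lin0 (pf_lin _ _)) //; lia.
- by rewrite pf_neg_p ?(lin0 (ps_lin _ _)) //; lia.
Qed.

Lemma sum_m2 (V : zmodType) (a b c : 'I_D -> 'I_D -> V) :
  \sum_i \sum_j ((- a i j + (if i == j then - b i j else 0)) +
                 ((if i == j then - c i j else 0) + 0)) =
  - (\sum_i (b i i + c i i) + \sum_i \sum_j a i j).
Proof.
rewrite -big_split -sumrN; apply: eq_bigr => i _ /=.
rewrite !big_split /= !sum_diag sumrN big1_eq addr0 !opprD.
by rewrite -addrA addrC.
Qed.

(** Pure reindexing: the contractions at mode -1 come sorted by pairs of summands of the two fields
    and are regrouped by the index k of the resulting component, in the shape of [dorfman]. *)
Lemma sum_m1 (V : zmodType) (p1 p2 x1 x2 : 'I_D -> 'I_D -> V)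
    (y z : 'I_D -> 'I_D -> 'I_D -> V) :
  \sum_i \sum_j (((p1 i j - p2 i j) +
      (- x1 i j - (if i == j then \sum_l y i j l else 0))) +
      (x2 i j - (if i == j then \sum_l z i j l else 0))) =
  - (\sum_k \sum_i (p2 i k - p1 k i) +
     \sum_k \sum_i (x1 i k + y i i k - x2 k i + z i i k)).
Proof.
have e1 : \sum_k \sum_i (p2 i k - p1 k i) =
    \sum_i \sum_j p2 i j - \sum_i \sum_j p1 i j.
  rewrite [X in _ = X - _]exchange_big -sumrB /=; apply: eq_bigr => k _.
  exact: sumrB.
have e2 : \sum_k \sum_i (x1 i k + y i i k - x2 k i + z i i k) =
    \sum_i \sum_j x1 i j + \sum_i \sum_l y i i l - \sum_i \sum_j x2 i j
    + \sum_i \sum_l z i i l.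
  rewrite [X in _ = X + _ - _ + _]exchange_big [X in _ = _ + X - _ + _]exchange_big.
  rewrite [X in _ = _ + X]exchange_big -big_split -sumrB -big_split /=.
  by apply: eq_bigr => k _; rewrite -big_split -sumrB -big_split.
rewrite e1 e2.
under eq_bigr => i _ do rewrite !big_split /= !sumrN !sum_diag.
rewrite !big_split /= !sumrN.
move: (\sum_i \sum_j p1 _ _) (\sum_i \sum_j p2 _ _) (\sum_i \sum_j x1 _ _)
  (\sum_i \sum_j x2 _ _) (\sum_i \sum_l y _ _ _) (\sum_i \sum_l z _ _ _) => a b c d e f.
rewrite !opprD !opprK -!addrA; rewrite addrCA; congr (_ + (_ + (_ + (_ + _)))).
Qed.

Lemma Vf_V_m2 AB CE n r S : n = -2 -> Vf AB n (V1mono r S CE) =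
  - (mono (r + 1) [::] S (pairing AB CE) + mono (r + 1 + 1) [::] S (double_contraction AB CE)).
Proof.
move=> n2; rewrite Vf_V1mono.
apply: etrans (etrans (sum_m2
  (fun i j => mono (r + 1 + 1) [::] S (psmul (pderiv j (AB.1 i)) (pderiv i (CE.1 j))))
  (fun i j => mono (r + 1) [::] S (psmul (AB.1 i) (CE.2 j)))
  (fun i j => mono (r + 1) [::] S (psmul (AB.2 i) (CE.1 j)))) _).
  apply: eq_bigr => i _; apply: eq_bigr => j _.
  apply: (f_equal2 +%R); apply: (f_equal2 +%R); [exact: pA_p_m2E|exact: pA_d_m2|exact: XB_p_m2|].
  by apply: XB_d_lt; lia.
apply: (f_equal (fun x => - x)); apply: (f_equal2 +%R); apply: esym.
  apply: (etrans (lin_sum (mono_linear _ _ _) _ _ _)); apply: eq_bigr => i _.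
  exact: (linD (mono_linear _ _ _)).
apply: (etrans (lin_sum (mono_linear _ _ _) _ _ _)); apply: eq_bigr => i _.
exact: (lin_sum (mono_linear _ _ _)).
Qed.

Lemma Vf_V_m1 AB CE n r S : n = -1 ->
  cg (r + 2) S (Vf AB n (V1mono r S CE)) (- V1mono (r + 1) S (dorfman AB CE)).
Proof.
move=> n1; rewrite Vf_V1mono; pose P k := mono (r + 1) [:: pgen k] S.
pose X k := mono (r + 1) [:: dXgen k] S.
have lP k : linear (P k) by exact: mono_linear.
have lX k : linear (X k) by exact: mono_linear.
have E := sum_m1 (fun i j => P i (psmul (pderiv j (AB.1 i)) (CE.1 j)))
  (fun i j => P j (psmul (AB.1 i) (pderiv i (CE.1 j))))
  (fun i j => X j (psmul (AB.1 i) (pderiv i (CE.2 j))))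
  (fun i j => X i (psmul (pderiv j (AB.2 i)) (CE.1 j)))
  (fun i j l => X l (psmul (pderiv l (AB.1 i)) (CE.2 j)))
  (fun i j l => X l (psmul (pderiv l (AB.2 i)) (CE.1 j))).
have F : V1mono (r + 1) S (dorfman AB CE) =
    \sum_k \sum_i (P k (psmul (AB.1 i) (pderiv i (CE.1 k)))
                   - P k (psmul (pderiv i (AB.1 k)) (CE.1 i))) +
    \sum_k \sum_i (X k (psmul (AB.1 i) (pderiv i (CE.2 k)))
                   + X k (psmul (pderiv k (AB.1 i)) (CE.2 i))
                   - X k (psmul (pderiv i (AB.2 k)) (CE.1 i))
                   + X k (psmul (pderiv k (AB.2 i)) (CE.1 i))).
  apply: (f_equal2 +%R); apply: eq_bigr => k _.
    apply: (etrans (lin_sum (lP k) _ _ _)); apply: eq_bigr => i _.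
    exact: (linB (lP k)).
  apply: (etrans (lin_sum (lX k) _ _ _)); apply: eq_bigr => i _.
  apply: (etrans (linD (lX k) _ _)); apply: (f_equal2 +%R); last by [].
  apply: (etrans (linB (lX k) _ _)); apply: (f_equal2 +%R); last by [].
  exact: (linD (lX k)).
rewrite F.
rewrite -E; apply: cg_sum => i _; apply: cg_sum => j _.
apply: cg_add; first by apply: cg_add; [exact: pA_p_m1|apply: cg_eq; exact: pA_d_m1].
rewrite -[X in cg _ _ _ X]addr0; apply: cg_add; first by apply: cg_eq; exact: XB_p_m1.
by apply: cg_eq; apply: XB_d_lt; lia.
Qed.

Lemma ps_V1mono v CE n r S : psfield v n (V1mono r S CE) =
  \sum_j psfield v n (mono r [:: pgen j] S (CE.1 j)) +
  \sum_j psfield v n (mono r [:: dXgen j] S (CE.2 j)).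
Proof.
by apply: (etrans (linD (ps_lin v n) _ _)); apply: (f_equal2 +%R); exact: (lin_sum (ps_lin v n)).
Qed.

Lemma ps_V_lt v CE n r S : n <= -2 -> psfield v n (V1mono r S CE) = 0.
Proof.
move=> n2; rewrite ps_V1mono.
rewrite [X in X + _]big1 => [|j _]; last exact: psfield_p2.
rewrite add0r; apply: big1 => j _; apply: psfield_lt0; last by lia.
exact: pwt_mono_d.
Qed.

Lemma ps_V_m1 v CE n r S : n = -1 -> psfield v n (V1mono r S CE) =
  mono (r + 1) [::] S (\sum_j psmul (pderiv j v) (CE.1 j)).
Proof.
move=> n1; rewrite ps_V1mono.
rewrite [X in _ + X]big1 => [|j _]; last first.
  by apply: psfield_lt0; [exact: pwt_mono_d|lia].
rewrite addr0 (lin_sum (mono_linear _ _ _)); apply: eq_bigr => j _.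
exact: psfield_p.
Qed.

Lemma ps_V_0 v CE n r S : n = 0 ->
  cg (r + 1) S (psfield v n (V1mono r S CE)) (V1mono r S (vscale v CE)).
Proof.
move=> n0; rewrite ps_V1mono.
by apply: cg_add; apply: cg_sum => j _; exact: psfield_mod0.
Qed.

Definition gradient u : vect * vect := ((0 : vect), (fun i => pderiv i u) : vect).
Definition divergence AB : pseries := \sum_i pderiv i (AB.1 i).

Definition Tfield i : field := nprod false (@pfield K D i) (fderiv (@Xfield K D i)).

Lemma LfieldE n x : Lfield n x = - hpow (-1) (\sum_i Tfield i n x).
Proof. by []. Qed.

Lemma matter_T i : matter (Tfield i).
Proof.
by apply: matter_nprod; [exact: matter_pfield|apply: matter_fderiv; exact: matter_Xfield].
Qed.

(** The prefactor 1/h costs one order, which would turn discarded corrections into leading terms.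
    Therefore the modes of L are evaluated exactly below, and this bound serves only to locate the
    ghost sector. *)
Lemma hge_Lfield n r S x : hge r S x -> hge (r - 1) S (Lfield n x).
Proof.
move=> hx; apply: supp_inN; apply: hge_hpow; apply: supp_in_sum => i _.
exact: (matter_T i).2.
Qed.

Lemma T_1_m1 i n r S u : n = -1 ->
  Tfield i n (mono r [::] S u) = - mono (r + 1) [:: dXgen i] S (pderiv i u).
Proof.
move=> n1; rewrite /Tfield (nprod_terms _ (N1 := 0) (N2 := 1)) => [|q _|[|q] // _].
- rewrite big_geq // big_nat1 scale1r add0r pf_zero // (linN (dXf_lin _ _)).
  by rewrite dXf_0 //; lia.
- by rewrite dXf_neg_1 ?(lin0 (pf_lin _ _)) //; lia.
- by rewrite pf_neg_1 ?(lin0 (dXf_lin _ _)) //; lia.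
Qed.

Lemma T_1_lt i n r S u : n <= -2 -> Tfield i n (mono r [::] S u) = 0.
Proof.
move=> n2; rewrite /Tfield (nprod_terms _ (N1 := 0) (N2 := 0)) => [|q _|[|q] _].
- by rewrite !big_geq // scaler0 addr0.
- by rewrite dXf_neg_1 ?(lin0 (pf_lin _ _)) //; lia.
- by rewrite pf_zero // (linN (dXf_lin _ _)) dXf_neg_1 ?oppr0 //; lia.
- by rewrite pf_neg_1 ?(lin0 (dXf_lin _ _)) //; lia.
Qed.

Lemma T_d_m2 i j n r S u : n = -2 -> Tfield i n (mono r [:: dXgen j] S u) =
  if i == j then - mono (r + 1) [:: dXgen j] S u else 0.
Proof.
move=> n2; rewrite /Tfield (nprod_terms _ (N1 := 0) (N2 := 2)) => [|q _|[|[|q]] // _].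
- rewrite big_geq // sum_nat2 scale1r add0r fderiv_m1; last by lia.
  rewrite add0r pf_neg_d //; case: eqP => [ij|_]; last exact: (lin0 (dXf_lin _ _)).
  by rewrite (linN (dXf_lin _ _)) dXf_0 ?ij //; lia.
- by rewrite dXf_neg_d ?(lin0 (pf_lin _ _)) //; lia.
- by rewrite pf_neg2_d ?(lin0 (dXf_lin _ _)) //; lia.
Qed.

Lemma T_d_lt i j n r S u : n <= -3 -> Tfield i n (mono r [:: dXgen j] S u) = 0.
Proof.
move=> n3; rewrite /Tfield (nprod_terms _ (N1 := 0) (N2 := 0)) => [|q _|[|[|q]] _].
- by rewrite !big_geq // scaler0 addr0.
- by rewrite dXf_neg_d ?(lin0 (pf_lin _ _)) //; lia.
- by rewrite pf_zero // (linN (dXf_lin _ _)) dXf_neg_d ?oppr0 //; lia.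
- rewrite pf_neg_d //; case: eqP => _; last exact: (lin0 (dXf_lin _ _)).
  by rewrite (linN (dXf_lin _ _)) dXf_neg_1 ?oppr0 //; lia.
- by rewrite pf_neg2_d ?(lin0 (dXf_lin _ _)) //; lia.
Qed.

Lemma T_p_m2 i j n r S u : n = -2 -> Tfield i n (mono r [:: pgen j] S u) =
  if i == j then - mono (r + 1) [:: pgen j] S u else 0.
Proof.
move=> n2; rewrite /Tfield (nprod_terms _ (N1 := 1) (N2 := 1)) => [|[|q] // _|[|q] // _].
- rewrite !big_nat1 scale1r (@fderiv_m1 K D _ (n + 1)); last by lia.
  rewrite addr0 dXf_neg_p; last by lia.
  case: eqP => [ij|_]; last exact: (lin0 (pf_lin _ _)).
  rewrite (linN (pf_lin _ _)) -ij; apply: (f_equal (fun x => - x)).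
  exact: (@pf_pos _ _ _ _ 0).
- by rewrite dXf_neg2_p ?(lin0 (pf_lin _ _)) //; lia.
- by rewrite pf_neg_p ?(lin0 (dXf_lin _ _)) //; lia.
Qed.

Lemma T_p_m3 i j n r S u : n = -3 -> Tfield i n (mono r [:: pgen j] S u) =
  if i == j then mono (r + 1 + 1) [::] S (pderiv j u) else 0.
Proof.
move=> n3; rewrite /Tfield (nprod_terms _ (N1 := 0) (N2 := 1)) => [|q _|[|q] // _].
- rewrite big_geq // big_nat1 scale1r add0r pf_zero // (linN (dXf_lin _ _)).
  rewrite dXf_neg_p; last by lia.
  by case: eqP => [->|_]; rewrite ?opprK ?oppr0.
- by rewrite dXf_neg2_p ?(lin0 (pf_lin _ _)) //; lia.
- by rewrite pf_neg_p ?(lin0 (dXf_lin _ _)) //; lia.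
Qed.

Lemma T_p_lt i j n r S u : n <= -4 -> Tfield i n (mono r [:: pgen j] S u) = 0.
Proof.
move=> n4; rewrite /Tfield (nprod_terms _ (N1 := 0) (N2 := 0)) => [|q _|[|q] _].
- by rewrite !big_geq // scaler0 addr0.
- by rewrite dXf_neg2_p ?(lin0 (pf_lin _ _)) //; lia.
- by rewrite pf_zero // (linN (dXf_lin _ _)) dXf_neg2_p ?oppr0 //; lia.
- by rewrite pf_neg_p ?(lin0 (dXf_lin _ _)) //; lia.
Qed.

(** The coefficient of z^n in L(z) is L_{-n-2}, so n = -1, -2, -3 are L_{-1}, L_0 and L_1: the
    translation u -> du, the conformal weight 1 on V^1, and minus h times the divergence. *)
Lemma L_1_m1 n r S u : n = -1 ->
  Lfield n (mono r [::] S u) = V1mono r S (gradient u).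
Proof.
move=> n1; rewrite LfieldE (lin_sum (hpow_linear _)) -sumrN /Defs.V1mono.
rewrite [X in _ = X + _]big1 => [|i _]; last exact: mono0.
rewrite add0r; apply: eq_bigr => i _.
by rewrite T_1_m1 // (linN (hpow_linear _)) hpow_mono opprK addrK.
Qed.

Lemma L_1_lt n r S u : n <= -2 -> Lfield n (mono r [::] S u) = 0.
Proof.
move=> n2; rewrite LfieldE [X in hpow _ X]big1 => [|i _]; last exact: T_1_lt.
by rewrite hpow0 oppr0.
Qed.

Lemma T_V n CE r S i : Tfield i n (V1mono r S CE) =
  \sum_j Tfield i n (mono r [:: pgen j] S (CE.1 j)) +
  \sum_j Tfield i n (mono r [:: dXgen j] S (CE.2 j)).
Proof.
have lT := good_linear (matter_T i).1 n.
by apply: (etrans (linD lT _ _)); apply: (f_equal2 +%R); exact: (lin_sum lT).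
Qed.

Lemma sumNB (V : zmodType) (a b : 'I_D -> V) :
  \sum_i (- a i - b i) = - (\sum_i a i + \sum_i b i).
Proof. by rewrite big_split /= !sumrN opprD. Qed.

Lemma L_V_m2 n r S CE : n = -2 -> Lfield n (V1mono r S CE) = V1mono r S CE.
Proof.
move=> n2; pose P i := mono (r + 1) [:: pgen i] S (CE.1 i).
pose X i := mono (r + 1) [:: dXgen i] S (CE.2 i).
have T i : Tfield i n (V1mono r S CE) = - P i - X i.
  rewrite T_V; apply: (f_equal2 +%R).
    apply: (etrans _ (sum_diag i (fun j => - P j))).
    by apply: eq_bigr => j _; exact: T_p_m2.
  apply: (etrans _ (sum_diag i (fun j => - X j))).
  by apply: eq_bigr => j _; exact: T_d_m2.
rewrite LfieldE (eq_bigr _ (fun i _ => T i)).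
have -> : \sum_i (- P i - X i) = - (\sum_i P i + \sum_i X i).
  exact: sumNB.
rewrite (linN (hpow_linear _)) opprK (linD (hpow_linear _)).
apply: (f_equal2 +%R); apply: (etrans (lin_sum (hpow_linear _) _ _ _)).
  by apply: eq_bigr => i _; rewrite hpow_mono addrK.
by apply: eq_bigr => i _; rewrite hpow_mono addrK.
Qed.

Lemma L_V_m3 n r S CE : n = -3 ->
  Lfield n (V1mono r S CE) = - mono (r + 1) [::] S (divergence CE).
Proof.
move=> n3; rewrite LfieldE; apply: (f_equal (fun x => - x)).
apply: (etrans (lin_sum (hpow_linear _) _ _ _)).
apply: (etrans _ (esym (lin_sum (mono_linear _ _ _) _ _ _))).
apply: eq_bigr => i _.
have T : Tfield i n (V1mono r S CE) = mono (r + 1 + 1) [::] S (pderiv i (CE.1 i)).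
  rewrite T_V -[RHS]addr0; apply: (f_equal2 +%R); last first.
    by apply: big1 => j _; apply: T_d_lt; lia.
  apply: (etrans _ (sum_diag i (fun j => mono (r + 1 + 1) [::] S (pderiv j (CE.1 j))))).
  by apply: eq_bigr => j _; exact: T_p_m3.
rewrite T hpow_mono (addrK 1 (r + 1)).
reflexivity.
Qed.

Lemma L_V_lt n r S CE : n <= -4 -> Lfield n (V1mono r S CE) = 0.
Proof.
move=> n4; rewrite LfieldE [X in hpow _ X]big1 => [|i _]; first by rewrite hpow0 oppr0.
rewrite T_V [X in X + _]big1 => [|j _]; last exact: T_p_lt.
by rewrite add0r; apply: big1 => j _; apply: T_d_lt; lia.
Qed.

End VectorFields.

(** * Ghosts and the operations on light modes *)

Section Ghosts.
Context (K : fieldType) (D : nat).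
Local Notation state := (state K D).
Local Notation pseries := (pseries K D).
Local Notation field := (field K D).
Local Notation vect := (vect K D).
Local Notation mono := (@mono K D).
Local Notation V1mono := (@V1mono K D).
Local Notation cf := (@cfield K D).
Local Notation bf := (@bfield K D).
Implicit Types (x y : state) (u v : pseries) (r n : int) (i j k l : 'I_D) (S : seq ggen).
Implicit Types (AB CE : vect * vect) (F M : field).

Lemma gcode_inj : injective gcode.
Proof.
by move=> [a|a] [b|b] /= e; (suff -> : a = b by []) || exfalso; lia.
Qed.

Lemma gsort_fset S : uniq S -> sorted (relpre gcode leq) S ->
  gsort [fset e in S]%fset = S.
Proof.
move=> uS sS; apply: (sorted_eq (leT := relpre gcode leq)) => //.
- by move=> b a c; exact: leq_trans.
- by move=> a b /anti_leq /gcode_inj.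
- by apply: sort_sorted => a b; exact: leq_total.
- by rewrite perm_sort; apply: uniq_perm; rewrite ?fset_uniq // => e; rewrite inE.
Qed.

Lemma enum_mset1 (g : mgen D) : enum_mset (seq_mset [:: g]) = [:: g].
Proof. by apply: perm_small_eq (perm_eq_seq_mset _). Qed.

Lemma enum_mset_nil : enum_mset (seq_mset [::] : {mset mgen D}%mset) = [::].
Proof. by apply: perm_small_eq (perm_eq_seq_mset _). Qed.

Lemma fdivd0 F : fdivd 0 F = F.
Proof.
by apply/funext => n; apply/funext => x; rewrite /fdivd invr1 scale1r.
Qed.

Lemma fdivd1 F : fdivd 1 F = fderiv F.
Proof.
by apply/funext => n; apply/funext => x; rewrite /fdivd invr1 scale1r.
Qed.

Lemma mnprod_p i F : mnprod [:: pgen i] F = nprod false (@pfield K D i) F.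
Proof. by rewrite -[LHS]/(nprod false (fdivd 0 (pfield i)) F) fdivd0. Qed.

Lemma mnprod_dX i F : mnprod [:: dXgen i] F = nprod false (fderiv (@Xfield K D i)) F.
Proof. by rewrite -[LHS]/(nprod false (fdivd 1 (Xfield i)) F) fdivd1. Qed.

Lemma gnprod_c F : gnprod [:: c_] F = nprod false cf F.
Proof. by rewrite -[LHS]/(nprod false (fdivd 0 cf) F) fdivd0. Qed.

Lemma gnprod_dc F : gnprod [:: dc_] F = nprod false (fderiv cf) F.
Proof. by rewrite -[LHS]/(nprod false (fdivd 1 cf) F) fdivd1. Qed.

Lemma gnprod_cdc F :
  gnprod [:: c_; dc_] F = nprod true cf (nprod false (fderiv cf) F).
Proof.
by rewrite -[LHS]/(nprod true (fdivd 0 cf) (nprod false (fdivd 1 cf) F)) fdivd0 fdivd1.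
Qed.

Lemma Y_mono r m S u n x : uniq S -> sorted (relpre gcode leq) S ->
  enum_mset (seq_mset m) = m ->
  Y (mono r m S u) n x = hpow r (gnprod S (mnprod m (psfield u)) n x).
Proof.
move=> uS sS em; rewrite YE monoE.
rewrite (msupp_sum_sng (G := fun p u => Ymono p u n x)); last first.
  by move=> p; exact: Ymono_linear.
rewrite /Ymono (gsort_fset uS sS) em; reflexivity.
Qed.

Lemma nprod_add o F M M' n x : good F -> good M -> good M' ->
  nprod o F (fun n x => M n x + M' n x) n x = nprod o F M n x + nprod o F M' n x.
Proof.
move=> gF gM gM'; have gA : good (fun n x => M n x + M' n x).
  split=> [p|y]; first by apply: lin_add; exact: good_linear.
  have [N1 h1] := good_trunc gM y; have [N2 h2] := good_trunc gM' y.
  by exists (maxn N1 N2) => p pN; rewrite h1 ?h2 ?addr0 //; lia.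
have [N1 [h1 h1']] := nprod_bound n x gF gM.
have [N2 [h2 h2']] := nprod_bound n x gF gM'.
have [N3 [h3 h3']] := nprod_bound n x gF gA.
pose N := maxn N1 (maxn N2 N3).
rewrite !(nprod_trunc _ (N1 := N) (N2 := N));
  try by move=> q Nq; first [apply: h1|apply: h1'|apply: h2|apply: h2'
                             |apply: h3|apply: h3']; lia.
rewrite addrACA -scalerDr -!big_split /=; apply: (f_equal2 +%R).
  by apply: eq_bigr => q _; exact: (linD (good_linear gF _)).
by [].
Qed.

Local Opaque nprod psfield pfield Xfield hpow onps mcreate mderiv gcreate gdelete
  Defs.mono Y Lfield.

Lemma gcreate0 e : gcreate e 0 = 0 :> state.
Proof. exact: (lin0 (gcreate_linear e)). Qed.

Lemma cf_pos n (q : nat) x : n = q%:Z -> cf n x = gcreate (inr q) x.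
Proof.
move=> ->; rewrite /cfield.
case: q => [|[|q]]; [by []|by []|].
by rewrite (_ : 1 - q.+2%:Z = Negz q) //; lia.
Qed.

Lemma cf_neg n (q : nat) x : n = - q.+1%:Z -> cf n x = gdelete (inl q) x.
Proof. by move=> ->; rewrite /cfield (_ : 1 - - q.+1%:Z = Posz q.+2) //; lia. Qed.

Lemma bf_neg n (q : nat) x : n = - q.+1%:Z -> bf n x = gdelete (inr q) x.
Proof.
move=> ->; rewrite /bfield; case: q => [|q].
  by rewrite (_ : - - 1%:Z - 2 = Negz 0) //; lia.
by rewrite (_ : - - q.+2%:Z - 2 = Posz q) //; lia.
Qed.

(* On such states the annihilation part of the field c vanishes. *)
Definition bfree x := forall q, gdelete (inl q) x = 0.

Lemma bfreeD x y : bfree x -> bfree y -> bfree (x + y).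
Proof. by move=> hx hy q; rewrite (linD (gdelete_linear _)) hx hy addr0. Qed.

Lemma gdelete_mono_out e r m S u : uniq S -> e \notin S -> gdelete e (mono r m S u) = 0.
Proof. by move=> uS /negPf eS; rewrite gdelete_mono // eS. Qed.

Lemma bfree_mono r m S u : uniq S -> all (fun e => if e is inl _ then false else true) S ->
  bfree (mono r m S u).
Proof.
move=> uS /allP aS q; apply: gdelete_mono_out => //.
by apply/negP => /aS.
Qed.

Lemma bfree_sum I (s : seq I) (F : I -> state) :
  (forall t, bfree (F t)) -> bfree (\sum_(t <- s) F t).
Proof.
move=> hF q; apply: (etrans (lin_sum (gdelete_linear _) _ _ _)).
by apply: big1 => t _; exact: hF.
Qed.

Lemma bfree_V1mono r S AB : uniq S ->
  all (fun e => if e is inl _ then false else true) S -> bfree (V1mono r S AB).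
Proof. by move=> uS aS; apply: bfreeD; apply: bfree_sum => i; exact: bfree_mono. Qed.

Lemma nprod_c o M n x N : bfree x -> (forall p, linear (M p)) ->
  (forall q : nat, (N <= q)%N -> M (n - q%:Z) x = 0) ->
  nprod o cf M n x = \sum_(0 <= q < N) gcreate (inr q) (M (n - q%:Z) x).
Proof.
move=> bx lM h; rewrite (nprod_terms _ (N1 := N) (N2 := 0)) => [|q Nq|q _].
- rewrite [X in _ + _ *: X]big_geq // scaler0 addr0.
  by apply: eq_bigr => q _; exact: cf_pos.
- by rewrite h // (lin0 (good_linear (good_cfield K D) _)).
- by rewrite (cf_neg _ erefl) bx (lin0 (lM _)).
Qed.

Lemma nprod_dc o M n x N : bfree x -> (forall p, linear (M p)) ->
  (forall q : nat, (N <= q)%N -> M (n - q%:Z) x = 0) ->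
  nprod o (fderiv cf) M n x =
    \sum_(0 <= q < N) q.+1%:R *: gcreate (inr q.+1) (M (n - q%:Z) x).
Proof.
move=> bx lM h; rewrite (nprod_terms _ (N1 := N) (N2 := 0)) => [|q Nq|q _].
- rewrite [X in _ + _ *: X]big_geq // scaler0 addr0.
  apply: eq_bigr => q _; rewrite fderivE (@cf_pos _ q.+1); last by lia.
  by rewrite (_ : (q%:Z + 1)%:~R = q.+1%:R :> K) // -PoszD addn1 -pmulrn.
- by rewrite h // (lin0 (good_linear (good_fderiv (good_cfield K D)) _)).
(* The derivative kills the mode -1; all lower modes are annihilators of the field c, which vanish
   on states free of b. *)
- case: q => [|q]; first by rewrite fderiv_m1 ?(lin0 (lM _)).
  by rewrite fderivE (@cf_neg _ q) ?bx ?scaler0 ?(lin0 (lM _)) //; lia.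
Qed.

(** Ghost modes square to zero. Since the ghost sector alone decides, products with a repeated c
    vanish without evaluating the matter factor. *)
Lemma hge_gcreate_in e r S y : hge r S y -> e \in S -> gcreate e y = 0.
Proof.
move=> hy eS; rewrite gcreateE big_seq; apply: big1 => p.
rewrite msupp_coef => /hy /andP[_ /eqP ->].
by rewrite inE eS.
Qed.

Lemma cg_gcreate e r S x y : cg r S x y -> cg r (e :: S) (gcreate e x) (gcreate e y).
Proof. by move=> xy; rewrite /cg -(linB (gcreate_linear e)); exact: hge_gcreate. Qed.

Lemma hge_V1mono r r' S AB : r <= r' -> hge r S (V1mono r' S AB).
Proof.
by move=> rr; apply: supp_inD; apply: supp_in_sum => i _; exact: hge_mono.
Qed.

Lemma gcreate_monoE e r m S u : uniq S -> e \notin S -> gcreate e (mono r m S u) =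
  (-1) ^+ count (fun f => gcode f < gcode e)%N S *: mono r m (e :: S) u.
Proof. by move=> uS /negPf eS; rewrite gcreate_mono // eS. Qed.

Lemma gcreate_V1mono e r S AB : uniq S -> e \notin S -> gcreate e (V1mono r S AB) =
  (-1) ^+ count (fun f => gcode f < gcode e)%N S *: V1mono r (e :: S) AB.
Proof.
move=> uS eS; apply: (etrans (linD (gcreate_linear e) _ _)).
apply: (etrans _ (esym (scalerDr _ _ _))); apply: (f_equal2 +%R).
  apply: (etrans (lin_sum (gcreate_linear e) _ _ _)).
  by rewrite scaler_sumr; apply: eq_bigr => i _; exact: gcreate_monoE.
apply: (etrans (lin_sum (gcreate_linear e) _ _ _)).
by rewrite scaler_sumr; apply: eq_bigr => i _; exact: gcreate_monoE.
Qed.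

Lemma V1mono_ghosts r S S' AB : same_ghosts S S' -> V1mono r S AB = V1mono r S' AB.
Proof.
move=> SS; apply: (f_equal2 +%R); apply: eq_bigr => i _; exact: mono_ghosts.
Qed.

Lemma gdelete_V1mono_hd e r S AB : uniq (e :: S) ->
  count (fun f => gcode f < gcode e)%N (e :: S) = 0%N ->
  gdelete e (V1mono r (e :: S) AB) = V1mono r S AB.
Proof.
move=> uS cS.
have E m u : gdelete e (mono r m (e :: S) u) = mono r m S u.
  rewrite gdelete_mono // mem_head cS expr0 scale1r.
  by have -> : rem e (e :: S) = S by rewrite /= eqxx.
apply: (etrans (linD (gdelete_linear e) _ _)).
by apply: (f_equal2 +%R); apply: (etrans (lin_sum (gdelete_linear e) _ _ _));
  apply: eq_bigr => i _; exact: E.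
Qed.

Lemma hpow_V1mono s r S AB : hpow s (V1mono r S AB) = V1mono (r + s) S AB.
Proof.
apply: (etrans (linD (hpow_linear s) _ _)).
by apply: (f_equal2 +%R); apply: (etrans (lin_sum (hpow_linear s) _ _ _));
  apply: eq_bigr => i _; exact: hpow_mono.
Qed.

Lemma cg_hpow s r S x y : cg r S x y -> cg (r + s) S (hpow s x) (hpow s y).
Proof. by move=> xy; rewrite /cg -(linB (hpow_linear s)); exact: hge_hpow. Qed.

Lemma hpow00 x : hpow 0 x = x.
Proof.
move: x; apply: state_ext => [||[[r m] S] u]; first exact: hpow_linear.
  exact: lin_id.
by rewrite hpow_sng addr0.
Qed.

Lemma Vf_good AB : good (Vf AB). Proof. exact: (matter_Vf AB).1. Qed.

Lemma gc : good cf. Proof. exact: good_cfield. Qed.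

Lemma nprod_sum o F I (s : seq I) (M : I -> field) n x : good F ->
  (forall t, good (M t)) ->
  nprod o F (fun n x => \sum_(t <- s) M t n x) n x = \sum_(t <- s) nprod o F (M t) n x.
Proof.
move=> gF gM; elim: s => [|t s IH].
  have -> : (fun n x => \sum_(t <- [::]) M t n x) = (fun _ _ => 0) :> field.
    by apply/funext => p; apply/funext => y; rewrite big_nil.
  rewrite big_nil (nprod_trunc _ (N1 := 0) (N2 := 0)) ?big_ord0 ?scaler0 ?addr0 // => q _.
  exact: (lin0 (good_linear gF _)).
rewrite big_cons -IH -nprod_add //; last exact: good_sum.
apply: (f_equal (fun G => nprod o F G n x)).
by apply/funext => p; apply/funext => y; rewrite big_cons.
Qed.

(** The monomials of a V^1 state share their ghost prefix, so the sum over them can be moved inside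
    the normal ordered product; the additivity hypotheses are what each concrete prefix has to
    supply. *)
Lemma Y_V1mono r S AB n x : uniq S -> sorted (relpre gcode leq) S ->
  (forall F G, good F -> good G ->
    gnprod S (fun n x => F n x + G n x) n x = gnprod S F n x + gnprod S G n x) ->
  (forall (F : 'I_D -> field), (forall i, good (F i)) ->
    gnprod S (fun n x => \sum_i F i n x) n x = \sum_i gnprod S (F i) n x) ->
  Y (V1mono r S AB) n x = hpow r (gnprod S (Vf AB) n x).
Proof.
move=> uS sS aS bS; have lY := Y_linear n x.
have gp i : good (pAfield i (AB.1 i)) by exact: (matter_pA _ _).1.
have gx i : good (XBfield i (AB.2 i)) by exact: (matter_XB _ _).1.
apply: (etrans (linD lY _ _)).
have -> : gnprod S (Vf AB) n x = \sum_i gnprod S (pAfield i (AB.1 i)) n x +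
    \sum_i gnprod S (XBfield i (AB.2 i)) n x.
  apply: (etrans (aS _ _ (good_sum (index_enum _) gp) (good_sum (index_enum _) gx))).
  exact: (f_equal2 +%R (bS _ gp) (bS _ gx)).
apply: (etrans _ (esym (linD (hpow_linear r) _ _))).
apply: (f_equal2 +%R); apply: (etrans (lin_sum lY _ _ _));
  apply: (etrans _ (esym (lin_sum (hpow_linear r) _ _ _))); apply: eq_bigr => i _.
  rewrite (@Y_mono _ _ _ _ _ _ uS sS (enum_mset1 _)).
  rewrite mnprod_p; reflexivity.
rewrite (@Y_mono _ _ _ _ _ _ uS sS (enum_mset1 _)).
rewrite mnprod_dX; reflexivity.
Qed.

Lemma Y_V r AB n x : Y (V1mono r [::] AB) n x = hpow r (Vf AB n x).
Proof. exact: Y_V1mono. Qed.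

Lemma Y_cV r AB n x : Y (V1mono r [:: c_] AB) n x = hpow r (nprod false cf (Vf AB) n x).
Proof.
have aS F G : good F -> good G -> gnprod [:: c_] (fun n x => F n x + G n x) n x =
    gnprod [:: c_] F n x + gnprod [:: c_] G n x.
  by move=> gF gG; rewrite !gnprod_c; exact: nprod_add gc gF gG.
have bS (F : 'I_D -> field) : (forall i, good (F i)) ->
    gnprod [:: c_] (fun n x => \sum_i F i n x) n x = \sum_i gnprod [:: c_] (F i) n x.
  move=> gF; rewrite gnprod_c; apply: (etrans (nprod_sum _ _ _ _ gc gF)).
  by apply: eq_bigr => i _; rewrite gnprod_c.
rewrite (@Y_V1mono r [:: c_] AB n x isT isT aS bS) gnprod_c; reflexivity.
Qed.

Lemma Y_u r u n x : Y (mono r [::] [::] u) n x = hpow r (psfield u n x).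
Proof. exact: (@Y_mono r [::] [::] u n x isT isT enum_mset_nil). Qed.

Lemma Y_cu r u n x : Y (mono r [::] [:: c_] u) n x =
  hpow r (nprod false cf (psfield u) n x).
Proof.
rewrite (@Y_mono r [::] [:: c_] u n x isT isT enum_mset_nil) gnprod_c; reflexivity.
Qed.

Lemma Y_dcu r u n x : Y (mono r [::] [:: dc_] u) n x =
  hpow r (nprod false (fderiv cf) (psfield u) n x).
Proof.
rewrite (@Y_mono r [::] [:: dc_] u n x isT isT enum_mset_nil) gnprod_dc; reflexivity.
Qed.

Lemma Y_cdcu r u n x : Y (mono r [::] [:: c_; dc_] u) n x =
  hpow r (nprod true cf (nprod false (fderiv cf) (psfield u)) n x).
Proof.
rewrite (@Y_mono r [::] [:: c_; dc_] u n x isT isT enum_mset_nil) gnprod_cdc; reflexivity.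
Qed.

End Ghosts.

(** * Component readout and ghost products *)

Section Operations.
Context (K : fieldType) (D : nat).
Local Notation state := (state K D).
Local Notation pseries := (pseries K D).
Local Notation field := (field K D).
Local Notation vect := (vect K D).
Local Notation lightF := (lightF K D).
Local Notation mono := (@mono K D).
Local Notation V1mono := (@V1mono K D).
Local Notation cf := (@cfield K D).
Local Notation bf := (@bfield K D).
Local Notation V1 := (vect * vect)%type.
Implicit Types (x y : state) (u v w : pseries) (r n : int) (i j k l : 'I_D) (S : seq ggen).
Implicit Types (AB CE GH : vect * vect).

Local Opaque nprod psfield pfield Xfield hpow onps mcreate mderiv gcreate gdelete
  Defs.mono Y Lfield.

Definition inc1 (V : V1 * pseries) : lightF := (0, V, 0, 0).
Definition inc2 (V : V1 * pseries) : lightF := (0, 0, V, 0).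

Lemma inc1D V W : inc1 (V + W) = inc1 V + inc1 W.
Proof. by rewrite /inc1 -[RHS]/(_, _, _, _) !addr0. Qed.

Lemma inc2D V W : inc2 (V + W) = inc2 V + inc2 W.
Proof. by rewrite /inc2 -[RHS]/(_, _, _, _) !addr0. Qed.

Lemma inc2N V : inc2 (- V) = - inc2 V.
Proof. by rewrite /inc2 -[RHS]/(_, _, _, _) !oppr0. Qed.

Lemma hcoefP r x u (A B : vect) v (A' B' : vect) w t :
  scoef r [::] [::] x = u ->
  (forall i, scoef r [:: pgen i] [:: c_] x = A i) ->
  (forall i, scoef r [:: dXgen i] [:: c_] x = B i) ->
  scoef (r + 1) [::] [:: dc_] x = v ->
  (forall i, scoef (r + 1) [:: pgen i] [:: c_; dc_] x = A' i) ->
  (forall i, scoef (r + 1) [:: dXgen i] [:: c_; dc_] x = B' i) ->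
  (2%:R^-1 : K) *: scoef (r + 1) [::] [:: c_; hd2c_] x = w ->
  (2%:R^-1 : K) *: scoef (r + 2) [::] [:: c_; dc_; hd2c_] x = t ->
  hcoef r x = (u, (A, B, v), (A', B', w), t).
Proof.
move=> hu hA hB hv hA' hB' hw ht; rewrite /hcoef hu hv hw ht.
have -> : (fun i => scoef r [:: pgen i] [:: c_] x) = A by exact/funext.
have -> : (fun i => scoef r [:: dXgen i] [:: c_] x) = B by exact/funext.
have -> : (fun i => scoef (r + 1) [:: pgen i] [:: c_; dc_] x) = A' by exact/funext.
have -> : (fun i => scoef (r + 1) [:: dXgen i] [:: c_; dc_] x) = B' by exact/funext.
reflexivity.
Qed.

Lemma perm_gens (g h : mgen D) : perm_eq [:: g] [:: h] = (g == h).
Proof.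
apply/idP/eqP => [/perm_mem/(_ g)|->]; last exact: perm_refl.
by rewrite !inE eqxx => /esym/eqP.
Qed.

Lemma perm_gen0 (g : mgen D) : perm_eq [:: g] [::] = false.
Proof. by apply/negP => /perm_size. Qed.

Lemma perm_0gen (g : mgen D) : perm_eq [::] [:: g] = false.
Proof. by apply/negP => /perm_size. Qed.

Lemma pgen_eq i j : (pgen i == pgen j) = (i == j).
Proof. by rewrite /eq_op /= xpair_eqE eqxx andbT. Qed.

Lemma dXgen_eq i j : (dXgen i == dXgen j) = (i == j).
Proof. by rewrite /eq_op /= xpair_eqE eqxx andbT. Qed.

Lemma scoef_V1 r' m S' r S AB : scoef r' m S' (V1mono r S AB) =
  \sum_i scoef r' m S' (mono r [:: pgen i] S (AB.1 i)) +
  \sum_i scoef r' m S' (mono r [:: dXgen i] S (AB.2 i)).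
Proof.
apply: (etrans (linD (scoef_linear r' m S') _ _)).
by apply: (f_equal2 +%R); exact: (lin_sum (scoef_linear _ _ _)).
Qed.

Lemma sum_pick (F : 'I_D -> pseries) (b : bool) j :
  \sum_i (if (i == j) && b then F i else 0) = if b then F j else 0.
Proof.
rewrite (bigD1 j) //= eqxx big1 ?addr0 // => i ij.
by rewrite (negPf ij).
Qed.

Lemma scoef_V1_0 r' S' r S AB : scoef r' [::] S' (V1mono r S AB) = 0.
Proof.
rewrite scoef_V1 -[RHS]addr0; apply: (f_equal2 +%R); apply: big1 => i _;
  by rewrite scoef_mono perm_gen0 andbF.
Qed.

Lemma scoef_V1_p r' j S' r S AB : scoef r' [:: pgen j] S' (V1mono r S AB) =
  if (r == r') && same_ghosts S S' then AB.1 j else 0.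
Proof.
rewrite scoef_V1 -[RHS]addr0 -(sum_pick (fun j => AB.1 j)); apply: (f_equal2 +%R).
  by apply: eq_bigr => i _; rewrite scoef_mono perm_gens pgen_eq andbCA.
by apply: big1 => i _; rewrite scoef_mono perm_gens andbF.
Qed.

Lemma scoef_V1_d r' j S' r S AB : scoef r' [:: dXgen j] S' (V1mono r S AB) =
  if (r == r') && same_ghosts S S' then AB.2 j else 0.
Proof.
rewrite scoef_V1 -[RHS]add0r -(sum_pick (fun j => AB.2 j)); apply: (f_equal2 +%R).
  by apply: big1 => i _; rewrite scoef_mono perm_gens andbF.
by apply: eq_bigr => i _; rewrite scoef_mono perm_gens dXgen_eq andbCA.
Qed.

Lemma hcoef_V1_1 r AB : hcoef r (V1mono r [:: c_] AB) = inc1 (AB, 0).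
Proof.
case: AB => A B; apply: hcoefP => [|i|i||i|i||];
  by rewrite ?scoef_V1_0 ?scoef_V1_p ?scoef_V1_d ?eqxx ?andbF ?scaler0.
Qed.

Lemma hcoef_V1_2 r S AB : same_ghosts S [:: c_; dc_] ->
  hcoef r (V1mono (r + 1) S AB) = inc2 (AB, 0).
Proof.
move=> hS; rewrite (V1mono_ghosts _ _ hS).
case: AB => A B; apply: hcoefP => [|i|i||i|i||];
  by rewrite ?scoef_V1_0 ?scoef_V1_p ?scoef_V1_d ?eqxx ?andbF ?scaler0.
Qed.

Lemma hcoef_mono_0 r u : hcoef r (mono r [::] [::] u) = inF0 u.
Proof.
by apply: hcoefP => [|i|i||i|i||];
  rewrite scoef_mono ?perm_0gen ?perm_refl ?eqxx ?andbF ?scaler0.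
Qed.

Lemma hcoef_mono_1 r v : hcoef r (mono (r + 1) [::] [:: dc_] v) = inc1 (0, v).
Proof.
by apply: hcoefP => [|i|i||i|i||];
  rewrite scoef_mono ?perm_0gen ?perm_refl ?eqxx ?andbF ?scaler0.
Qed.

Lemma hcoef_mono_2 r S w : same_ghosts S [:: c_; hd2c_] ->
  hcoef r (mono (r + 1) [::] S w) = inc2 (0, (2%:R^-1 : K) *: w).
Proof.
move=> hS; rewrite (mono_ghosts _ _ _ hS).
by apply: hcoefP => [|i|i||i|i||];
  rewrite scoef_mono ?perm_0gen ?perm_refl ?eqxx ?andbF ?scaler0.
Qed.

Lemma hcoef_cg s r S x y : cg r S x y -> killed s r S -> hcoef s x = hcoef s y.
Proof.
move=> xy /(hcoef_hge xy); rewrite (linB (hcoef_linear s)).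
by move/eqP; rewrite subr_eq0 => /eqP.
Qed.

Lemma hcoefD s x y : hcoef s (x + y) = hcoef s x + hcoef s y.
Proof. exact: (linD (hcoef_linear s)). Qed.

Lemma Fstate_inc1 AB v : Fstate (inc1 (AB, v)) = V1mono 0 [:: c_] AB + mono 1 [::] [:: dc_] v.
Proof.
rewrite /Fstate.
have -> : mono 0 [::] [::] (F0 (inc1 (AB, v))) = 0 by exact: mono0.
have -> : V1mono 1 [:: c_; dc_] (F2 (inc1 (AB, v))).1 = 0.
  exact: (lin0 (V1mono_linear _ _)).
have -> : mono 1 [::] [:: c_; hd2c_] (F2 (inc1 (AB, v))).2 = 0 by exact: mono0.
have -> : mono 2 [::] [:: c_; dc_; hd2c_] (F3 (inc1 (AB, v))) = 0 by exact: mono0.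
rewrite !scaler0 !addr0 add0r; reflexivity.
Qed.

Lemma Fstate_inF0 u : Fstate (inF0 u) = mono 0 [::] [::] u.
Proof.
rewrite /Fstate.
have -> : V1mono 0 [:: c_] (F1 (inF0 u)).1 = 0 by exact: (lin0 (V1mono_linear _ _)).
have -> : mono 1 [::] [:: dc_] (F1 (inF0 u)).2 = 0 by exact: mono0.
have -> : V1mono 1 [:: c_; dc_] (F2 (inF0 u)).1 = 0 by exact: (lin0 (V1mono_linear _ _)).
have -> : mono 1 [::] [:: c_; hd2c_] (F2 (inF0 u)).2 = 0 by exact: mono0.
have -> : mono 2 [::] [:: c_; dc_; hd2c_] (F3 (inF0 u)) = 0 by exact: mono0.
rewrite !scaler0 !addr0; reflexivity.
Qed.

Lemma sum_nat3 (V : zmodType) (F : nat -> V) :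
  \sum_(0 <= q < 3) F q = F 0%N + F 1%N + F 2%N.
Proof. by rewrite big_nat_recr //= sum_nat2. Qed.

Lemma hge_Vf AB n r S x : hge r S x -> hge r S (Vf AB n x).
Proof. exact: (matter_Vf AB).2. Qed.

Lemma hge_ps u n r S x : hge r S x -> hge r S (psfield u n x).
Proof. exact: (matter_psfield u).2. Qed.

(** In the expansion of c(z) the mode c_1 dies on a state already containing c, and modes beyond
    c_{-1} would need a pole of order at least 3 between two V^1 fields. Only c_0 and c_{-1}
    remain. *)
Lemma cV_V AB CE r n : n <= 0 -> nprod false cf (Vf AB) n (V1mono r [:: c_] CE) =
  gcreate dc_ (Vf AB (n - 1) (V1mono r [:: c_] CE)) +
  gcreate hd2c_ (Vf AB (n - 2) (V1mono r [:: c_] CE)).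
Proof.
move=> n0; apply: (etrans (nprod_c false (N := 3) _ (Vf_lin AB) _)).
- exact: bfree_V1mono.
- by move=> q q3; apply: Vf_V_lt; lia.
rewrite sum_nat3 -[RHS]add0r addrA; apply: (f_equal2 +%R); last by [].
apply: (f_equal2 +%R); last by [].
by apply: (@hge_gcreate_in K D _ r [:: c_]) => //; apply: hge_Vf; exact: hge_V1mono.
Qed.

Lemma cV_dc AB w r n : n <= 0 -> nprod false cf (Vf AB) n (mono r [::] [:: dc_] w) =
  gcreate c_ (Vf AB n (mono r [::] [:: dc_] w)).
Proof.
move=> n0; apply: (etrans (nprod_c false (N := 2) _ (Vf_lin AB) _)).
- exact: bfree_mono.
- by move=> q q3; apply: Vf_1_lt; lia.
rewrite sum_nat2 subr0 -[RHS]addr0; apply: (f_equal2 +%R); first by [].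
by apply: (@hge_gcreate_in K D _ r [:: dc_]) => //; apply: hge_Vf; exact: hge_mono.
Qed.

Lemma cV_1 AB u r n : n <= 0 -> nprod false cf (Vf AB) n (mono r [::] [::] u) =
  gcreate c_ (Vf AB n (mono r [::] [::] u)) + gcreate dc_ (Vf AB (n - 1) (mono r [::] [::] u)).
Proof.
move=> n0; apply: (etrans (nprod_c false (N := 2) _ (Vf_lin AB) _)).
- exact: bfree_mono.
- by move=> q q3; apply: Vf_1_lt; lia.
by rewrite sum_nat2 subr0.
Qed.

Lemma dcv_V v CE r n : n <= 0 ->
  nprod false (fderiv cf) (psfield v) n (V1mono r [:: c_] CE) =
  gcreate dc_ (psfield v n (V1mono r [:: c_] CE)) +
  2%:R *: gcreate hd2c_ (psfield v (n - 1) (V1mono r [:: c_] CE)).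
Proof.
move=> n0; apply: (etrans (nprod_dc false (N := 2) _ (ps_lin v) _)).
- exact: bfree_V1mono.
- by move=> q q3; apply: ps_V_lt; lia.
by rewrite sum_nat2 subr0 scale1r.
Qed.

Lemma ps_1_lt v n r S u : n < 0 -> psfield v n (mono r [::] S u) = 0.
Proof. by move=> n0; apply: psfield_lt0 => //; exact: pwt_mono_1. Qed.

Lemma dcv_dc v w r n : n <= 0 ->
  nprod false (fderiv cf) (psfield v) n (mono r [::] [:: dc_] w) = 0.
Proof.
move=> n0; apply: (etrans (nprod_dc false (N := 1) _ (ps_lin v) _)).
- exact: bfree_mono.
- by move=> q q3; apply: ps_1_lt; lia.
rewrite big_nat1 scale1r.
by apply: (@hge_gcreate_in K D _ r [:: dc_]) => //; apply: hge_ps; exact: hge_mono.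
Qed.

Lemma dcv_1 v u r n : n <= 0 ->
  nprod false (fderiv cf) (psfield v) n (mono r [::] [::] u) =
  gcreate dc_ (psfield v n (mono r [::] [::] u)).
Proof.
move=> n0; apply: (etrans (nprod_dc false (N := 1) _ (ps_lin v) _)).
- exact: bfree_mono.
- by move=> q q3; apply: ps_1_lt; lia.
by rewrite big_nat1 subr0 scale1r.
Qed.

Lemma gcreate_dc_V1 r AB : gcreate dc_ (V1mono r [:: c_] AB) = - V1mono r [:: dc_; c_] AB.
Proof. by apply: (etrans (gcreate_V1mono _ _ _ _)) => //; rewrite scaleN1r. Qed.

Lemma gcreate_dc_mono r u : gcreate dc_ (mono r [::] [:: c_] u) = - mono r [::] [:: dc_; c_] u.
Proof. by apply: (etrans (gcreate_monoE _ _ _ _ _)) => //; rewrite scaleN1r. Qed.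

Lemma gcreate_hd2c_mono r u :
  gcreate hd2c_ (mono r [::] [:: c_] u) = - mono r [::] [:: hd2c_; c_] u.
Proof. by apply: (etrans (gcreate_monoE _ _ _ _ _)) => //; rewrite scaleN1r. Qed.

Lemma gcreate_c_V1 r AB : gcreate c_ (V1mono r [:: dc_] AB) = V1mono r [:: c_; dc_] AB.
Proof. by apply: (etrans (gcreate_V1mono _ _ _ _)) => //; rewrite scale1r. Qed.

Lemma gcreate_c_mono r S u : S = [::] \/ S = [:: dc_] \/ S = [:: hd2c_] ->
  gcreate c_ (mono r [::] S u) = mono r [::] (c_ :: S) u.
Proof.
by case=> [->|[->|->]]; apply: (etrans (gcreate_monoE _ _ _ _ _)) => //; rewrite scale1r.
Qed.

Lemma gcreate_c_V1_0 r AB : gcreate c_ (V1mono r [::] AB) = V1mono r [:: c_] AB.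
Proof. by apply: (etrans (gcreate_V1mono _ _ _ _)) => //; rewrite scale1r. Qed.

Lemma gcreate_dc_mono_0 r u : gcreate dc_ (mono r [::] [::] u) = mono r [::] [:: dc_] u.
Proof. by apply: (etrans (gcreate_monoE _ _ _ _ _)) => //; rewrite scale1r. Qed.

Lemma gcreateN e x : gcreate e (- x) = - gcreate e x.
Proof. exact: (linN (gcreate_linear e)). Qed.

Lemma gcreateD e x y : gcreate e (x + y) = gcreate e x + gcreate e y.
Proof. exact: (linD (gcreate_linear e)). Qed.

Lemma oppr_add_opp (V : zmodType) (a b : V) : - (- a + - b) = a + b.
Proof. by rewrite opprD !opprK. Qed.

Lemma gcreate_hd2c_neg r s u v :
  gcreate hd2c_ (- (mono r [::] [:: c_] u + mono s [::] [:: c_] v)) =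
  mono r [::] [:: hd2c_; c_] u + mono s [::] [:: hd2c_; c_] v.
Proof.
apply: (etrans (gcreateN _ _)); apply: (etrans (f_equal -%R (gcreateD _ _ _))).
apply: (etrans (f_equal -%R (f_equal2 +%R (gcreate_hd2c_mono _ _) (gcreate_hd2c_mono _ _)))).
exact: oppr_add_opp.
Qed.

Lemma gcreate_dc_neg r s u v :
  gcreate dc_ (- (mono r [::] [:: c_] u + mono s [::] [:: c_] v)) =
  mono r [::] [:: dc_; c_] u + mono s [::] [:: dc_; c_] v.
Proof.
apply: (etrans (gcreateN _ _)); apply: (etrans (f_equal -%R (gcreateD _ _ _))).
apply: (etrans (f_equal -%R (f_equal2 +%R (gcreate_dc_mono _ _) (gcreate_dc_mono _ _)))).
exact: oppr_add_opp.
Qed.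

End Operations.

(** * Product, bracket and homotopies on F_0 and F_1 *)

Section LeadingOrder.
Context (K : fieldType) (D : nat).
Local Notation state := (state K D).
Local Notation pseries := (pseries K D).
Local Notation field := (field K D).
Local Notation vect := (vect K D).
Local Notation lightF := (lightF K D).
Local Notation mono := (@mono K D).
Local Notation V1mono := (@V1mono K D).
Local Notation cf := (@cfield K D).
Local Notation bf := (@bfield K D).
Implicit Types (x y : state) (u v w : pseries) (r n : int) (i j k l : 'I_D) (S : seq ggen).
Implicit Types (AB CE GH : vect * vect).

Local Opaque nprod psfield pfield Xfield hpow onps mcreate mderiv gcreate gdelete
  Defs.mono Y Lfield hcoef.

Lemma Y_F1 AB v n x : Y (Fstate (inc1 (AB, v))) n x =
  nprod false cf (Vf AB) n x + hpow 1 (nprod false (fderiv cf) (psfield v) n x).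
Proof.
rewrite Fstate_inc1; apply: (etrans (linD (Y_linear n x) _ _)).
by apply: (f_equal2 +%R); [rewrite Y_cV hpow00|exact: Y_dcu].
Qed.

Lemma cV_lin AB n : linear (nprod false cf (Vf AB) n).
Proof. exact: (good_linear (good_nprod false (gc K D) (Vf_good AB)) n). Qed.

Lemma dcv_lin v n : linear (nprod false (fderiv cf) (psfield v) n).
Proof.
exact: (good_linear (good_nprod false (good_fderiv (gc K D)) (good_psfield v)) n).
Qed.

Lemma Y_F1_F1 AB v CE w n : n <= 0 ->
  Y (Fstate (inc1 (AB, v))) n (Fstate (inc1 (CE, w))) =
  (gcreate dc_ (Vf AB (n - 1) (V1mono 0 [:: c_] CE)) +
   gcreate hd2c_ (Vf AB (n - 2) (V1mono 0 [:: c_] CE)) +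
   gcreate c_ (Vf AB n (mono 1 [::] [:: dc_] w))) +
  hpow 1 (gcreate dc_ (psfield v n (V1mono 0 [:: c_] CE)) +
   2%:R *: gcreate hd2c_ (psfield v (n - 1) (V1mono 0 [:: c_] CE))).
Proof.
move=> n0; rewrite Y_F1 Fstate_inc1; apply: (f_equal2 +%R).
  apply: (etrans (linD (cV_lin AB n) _ _)).
  by apply: (f_equal2 +%R); [exact: cV_V|exact: cV_dc].
apply: f_equal; apply: (etrans (linD (dcv_lin v n) _ _)).
by rewrite -[RHS]addr0; apply: (f_equal2 +%R); [exact: dcv_V|exact: dcv_dc].
Qed.

Lemma Y_F1_F0 AB v u n : n <= 0 ->
  Y (Fstate (inc1 (AB, v))) n (Fstate (inF0 u)) =
  gcreate c_ (Vf AB n (mono 0 [::] [::] u)) +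
  gcreate dc_ (Vf AB (n - 1) (mono 0 [::] [::] u)) +
  hpow 1 (gcreate dc_ (psfield v n (mono 0 [::] [::] u))).
Proof.
move=> n0; rewrite Y_F1 Fstate_inF0; apply: (f_equal2 +%R); first exact: cV_1.
by apply: f_equal; exact: dcv_1.
Qed.

Lemma Y_F0_F1 u CE w n : Y (Fstate (inF0 u)) n (Fstate (inc1 (CE, w))) =
  psfield u n (V1mono 0 [:: c_] CE) + psfield u n (mono 1 [::] [:: dc_] w).
Proof.
rewrite Fstate_inF0 Fstate_inc1 Y_u hpow00.
exact: (linD (ps_lin u n)).
Qed.

Lemma hcoef_sum5 s (a b c d e : state) A B C D' E :
  hcoef s a = A -> hcoef s b = B -> hcoef s c = C -> hcoef s (hpow 1 d) = D' ->
  hcoef s (hpow 1 e) = E ->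
  hcoef s (a + b + c + hpow 1 (d + e)) = A + B + C + (D' + E).
Proof.
by move=> <- <- <- <- <-; rewrite (linD (hpow_linear 1)) !hcoefD.
Qed.

Lemma hcoef_sum3 s (a b c : state) A B C :
  hcoef s a = A -> hcoef s b = B -> hcoef s c = C -> hcoef s (a + b + c) = A + B + C.
Proof. by move=> <- <- <-; rewrite !hcoefD. Qed.

(** The simple pole produces the bracket in the sector c dc, the double pole the pairing in c d^2c.
    The double contraction and the d^2c term of v are of order h^2, whereas c d^2c is read at order
    h. *)
Lemma mu0_F1_F1 AB v CE w : mu0 (inc1 (AB, v)) (inc1 (CE, w)) =
  inc2 (dorfman AB CE + vscale w AB - vscale v CE, (2%:R^-1 : K) *: pairing AB CE).
Proof.
apply: (etrans (f_equal (hcoef 0) (Y_F1_F1 AB v CE w (lexx 0)))).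
have h1 : hcoef 0 (gcreate dc_ (Vf AB (0 - 1) (V1mono 0 [:: c_] CE))) =
    inc2 (dorfman AB CE, 0).
  apply: (etrans (hcoef_cg (r := 2) (S := [:: dc_; c_])
    (y := gcreate dc_ (- V1mono 1 [:: c_] (dorfman AB CE))) _ _)); [|by []|].
    by apply: cg_gcreate; exact: Vf_V_m1.
  by rewrite gcreateN gcreate_dc_V1 opprK; exact: (@hcoef_V1_2 _ _ 0).
have h2 : hcoef 0 (gcreate hd2c_ (Vf AB (0 - 2) (V1mono 0 [:: c_] CE))) =
    inc2 (0, (2%:R^-1 : K) *: pairing AB CE).
  apply: (etrans (f_equal (fun x => hcoef 0 (gcreate hd2c_ x))
    (Vf_V_m2 AB CE 0 [:: c_] (erefl (0 - 2))))).
  apply: (etrans (f_equal (hcoef 0) (gcreate_hd2c_neg _ _ _ _))).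
  apply: (etrans (hcoefD _ _ _)); rewrite -[RHS]addr0; apply: (f_equal2 +%R).
    exact: hcoef_mono_2.
  by apply: (@hcoef_hge K D 0 2 [:: hd2c_; c_]) => //; exact: hge_mono.
have h3 : hcoef 0 (gcreate c_ (Vf AB 0 (mono 1 [::] [:: dc_] w))) =
    inc2 (vscale w AB, 0).
  apply: (etrans (hcoef_cg (r := 2) (S := [:: c_; dc_])
    (y := gcreate c_ (V1mono 1 [:: dc_] (vscale w AB))) _ _)); [|by []|].
    by apply: cg_gcreate; exact: Vf_1_0.
  by rewrite gcreate_c_V1; exact: (@hcoef_V1_2 _ _ 0).
have h4 : hcoef 0 (hpow 1 (gcreate dc_ (psfield v 0 (V1mono 0 [:: c_] CE)))) =
    - inc2 (vscale v CE, 0).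
  apply: (etrans (hcoef_cg (r := 1 + 1) (S := [:: dc_; c_])
    (y := hpow 1 (gcreate dc_ (V1mono 0 [:: c_] (vscale v CE)))) _ _)); [|by []|].
    by apply: cg_hpow; apply: cg_gcreate; exact: (@ps_V_0 _ _ _ _ _ 0).
  rewrite gcreate_dc_V1 (linN (hpow_linear 1)) hpow_V1mono (linN (hcoef_linear 0)).
  by apply: f_equal; exact: (@hcoef_V1_2 _ _ 0).
have h5 : hcoef 0
    (hpow 1 (2%:R *: gcreate hd2c_ (psfield v (0 - 1) (V1mono 0 [:: c_] CE)))) = 0.
  apply: (@hcoef_hge K D 0 2 [:: hd2c_; c_]) => //; apply: (@hge_hpow K D 1 1).
  apply: supp_inZ; rewrite (ps_V_m1 v CE 0 [:: c_] (erefl (0 - 1))).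
  by apply: hge_gcreate; exact: hge_mono.
apply: (etrans (hcoef_sum5 h1 h2 h3 h4 h5)).
rewrite addr0 -!inc2D.
rewrite -inc2N.
rewrite -!inc2D; apply: f_equal; apply: (f_equal2 pair).
  rewrite -[LHS]/(dorfman AB CE + 0 + vscale w AB - vscale v CE) addr0; reflexivity.
by rewrite -[LHS]/(0 + 2%:R^-1 *: pairing AB CE + 0 - 0) subr0 addr0 add0r.
Qed.

Lemma mu0_F1_F0 AB v u : mu0 (inc1 (AB, v)) (inF0 u) =
  inc1 (vscale u AB, psmul v u - along AB u).
Proof.
apply: (etrans (f_equal (hcoef 0) (Y_F1_F0 AB v u (lexx 0)))).
have h1 : hcoef 0 (gcreate c_ (Vf AB 0 (mono 0 [::] [::] u))) = inc1 (vscale u AB, 0).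
  apply: (etrans (hcoef_cg (r := 1) (S := [:: c_])
    (y := gcreate c_ (V1mono 0 [::] (vscale u AB))) _ _)); [|by []|].
    by apply: cg_gcreate; exact: (@Vf_1_0 _ _ _ _ 0).
  by rewrite gcreate_c_V1_0; exact: hcoef_V1_1.
have h2 : hcoef 0 (gcreate dc_ (Vf AB (0 - 1) (mono 0 [::] [::] u))) =
    inc1 (0, - along AB u).
  rewrite (Vf_1_m1 AB 0 [::] u (erefl (0 - 1))) gcreateN gcreate_dc_mono_0.
  by rewrite -(linN (mono_linear _ _ _)); exact: (@hcoef_mono_1 _ _ 0).
have h3 : hcoef 0 (hpow 1 (gcreate dc_ (psfield v 0 (mono 0 [::] [::] u)))) =
    inc1 (0, psmul v u).
  rewrite (psfield_01 v 0 [::] u (erefl 0)) gcreate_dc_mono_0 hpow_mono.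
  exact: (@hcoef_mono_1 _ _ 0).
apply: (etrans (hcoef_sum3 h1 h2 h3)).
rewrite -!inc1D; apply: f_equal; apply: (f_equal2 pair).
  by rewrite -[LHS]/(vscale u AB + 0 + 0) !addr0.
by rewrite -[LHS]/(0 + - along AB u + psmul v u) add0r addrC.
Qed.

Lemma mu0_F0_F1 u CE w : mu0 (inF0 u) (inc1 (CE, w)) = inc1 (vscale u CE, psmul u w).
Proof.
apply: (etrans (f_equal (hcoef 0) (Y_F0_F1 u CE w 0))).
apply: (etrans (hcoefD _ _ _)).
have h1 : hcoef 0 (psfield u 0 (V1mono 0 [:: c_] CE)) = inc1 (vscale u CE, 0).
  apply: (etrans (hcoef_cg (r := 1) (S := [:: c_])
    (y := V1mono 0 [:: c_] (vscale u CE)) _ _)); [|by []|exact: hcoef_V1_1].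
  exact: (@ps_V_0 _ _ _ _ _ 0).
have h2 : hcoef 0 (psfield u 0 (mono 1 [::] [:: dc_] w)) = inc1 (0, psmul u w).
  rewrite (psfield_01 u 1 [:: dc_] w (erefl 0)); exact: (@hcoef_mono_1 _ _ 0).
apply: (etrans (f_equal2 +%R h1 h2)).
rewrite -inc1D; apply: f_equal; apply: (f_equal2 pair).
  by rewrite -[LHS]/(vscale u CE + 0) addr0.
by rewrite -[LHS]/(0 + psmul u w) add0r.
Qed.

Definition ord4_1 : 'I_4 := @Ordinal 4 1 isT.
Definition ord4_0 : 'I_4 := @Ordinal 4 0 isT.

Lemma ghost_part_inc1 (k : 'I_4) V :
  ghost_part k (inc1 V) = if k == ord4_1 then inc1 V else 0 :> lightF.
Proof. by case: k => [[|[|[|[|//]]]] k4]. Qed.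

Lemma ghost_part_inF0 (k : 'I_4) u :
  ghost_part k (inF0 u) = if k == ord4_0 then inF0 u else 0 :> lightF.
Proof. by case: k => [[|[|[|[|//]]]] k4]. Qed.

Lemma sum_ghost_part (V : zmodType) (G : 'I_4 -> lightF -> V) (a : lightF) (k0 : 'I_4) :
  (forall q : 'I_4, G q 0 = 0) ->
  \sum_(q : 'I_4) G q (if q == k0 then a else 0) = G k0 a.
Proof.
move=> G0; rewrite (bigD1 k0) //= eqxx big1 ?addr0 // => q /negPf ->.
exact: G0.
Qed.

Lemma bmode_F1 AB v : bmode (-1) (Fstate (inc1 (AB, v))) = V1mono 0 [::] AB.
Proof.
rewrite Fstate_inc1; apply: (etrans (linD (bmode_linear (-1)) _ _)).
rewrite -[RHS]addr0; apply: (f_equal2 +%R); first exact: (@gdelete_V1mono_hd K D c_ 0 [::]).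
exact: (@gdelete_mono_out K D c_ 1).
Qed.

Lemma bmode_F0 u : bmode (-1) (Fstate (inF0 u)) = 0.
Proof. by rewrite Fstate_inF0; exact: (@gdelete_mono_out K D c_ 0). Qed.

Lemma Fstate0 : Fstate (0 : lightF) = 0.
Proof. exact: (lin0 (@Fstate_linear K D)). Qed.

Lemma hcoef0 s : hcoef s (0 : state) = 0.
Proof. exact: (lin0 (hcoef_linear s)). Qed.

(** Here b_{-1} strips the ghost c and kills h dc v, which contains no c; what is left is a pure
    matter field. The sign is that of ghost number 1. *)
Lemma br0_F1 AB v b :
  br0 (inc1 (AB, v)) b = - hcoef 1 (Vf AB (-1) (Fstate b)).
Proof.
pose G (q : 'I_4) a := hcoef 1 (br_op q (Fstate a) (Fstate b)).
rewrite /br0; apply: (etrans (y := \sum_q G q (if q == ord4_1 then inc1 (AB, v) else 0))).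
  by apply: eq_bigr => q _; rewrite ghost_part_inc1.
rewrite sum_ghost_part => [|q].
  rewrite /G /br_op bmode_F1 Y_V hpow00 (linZ (hcoef_linear 1)); exact: scaleN1r.
by rewrite /G Fstate0 /br_op (lin0 (bmode_linear _)) Y0l scaler0 hcoef0.
Qed.

Lemma br0_F1_F1 AB v CE w : br0 (inc1 (AB, v)) (inc1 (CE, w)) =
  inc1 (dorfman AB CE, along AB w).
Proof.
rewrite br0_F1 Fstate_inc1.
have h1 : hcoef 1 (Vf AB (-1) (V1mono 0 [:: c_] CE)) = - inc1 (dorfman AB CE, 0).
  apply: (etrans (hcoef_cg (r := 2) (S := [:: c_])
    (y := - V1mono 1 [:: c_] (dorfman AB CE)) _ _)); [exact: Vf_V_m1|by []|].
  apply: (etrans (linN (hcoef_linear 1) _)); apply: f_equal; exact: hcoef_V1_1.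
have h2 : hcoef 1 (Vf AB (-1) (mono 1 [::] [:: dc_] w)) = - inc1 (0, along AB w).
  apply: (etrans (f_equal (hcoef 1) (Vf_1_m1 AB 1 [:: dc_] w (erefl (-1))))).
  apply: (etrans (linN (hcoef_linear 1) _)); apply: f_equal; exact: hcoef_mono_1.
apply: (etrans (f_equal (fun x => - hcoef 1 x) (linD (Vf_lin AB (-1)) _ _))).
apply: (etrans (f_equal -%R (hcoefD _ _ _))).
apply: (etrans (f_equal -%R (f_equal2 +%R h1 h2))).
rewrite oppr_add_opp -inc1D; apply: f_equal; apply: (f_equal2 pair).
  by rewrite -[LHS]/(dorfman AB CE + 0) addr0.
by rewrite -[LHS]/(0 + along AB w) add0r.
Qed.

Lemma br0_F1_F0 AB v u : br0 (inc1 (AB, v)) (inF0 u) = inF0 (along AB u).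
Proof.
rewrite br0_F1 Fstate_inF0.
apply: (etrans (f_equal (fun x => - hcoef 1 x) (Vf_1_m1 AB 0 [::] u (erefl (-1))))).
apply: (etrans (f_equal -%R (linN (hcoef_linear 1) _))); rewrite opprK.
exact: (@hcoef_mono_0 _ _ 1).
Qed.

(** Two V^1 fields have poles of order at most 2, and the product of two ghosts c contributes a
    zero. With at most simple poles left, the series over i in [m_op] and [n_op] reduce to i = 0. *)
Lemma Y_F1_F1_lt AB v CE w n : n <= -2 ->
  Y (Fstate (inc1 (AB, v))) n (Fstate (inc1 (CE, w))) = 0.
Proof.
move=> n2; rewrite Y_F1_F1; last by lia.
rewrite !(Vf_V_lt AB CE 0 [:: c_]); [|lia|lia].
rewrite (Vf_1_lt AB 1 [:: dc_] w n2) !(ps_V_lt v CE 0 [:: c_]); [|lia|lia].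
by rewrite !gcreate0 scaler0 !addr0 hpow0 addr0.
Qed.

(** The h^2 part of the residue, collected so that the residue can be stated exactly; it lies beyond
    the order at which the sector is read. *)
Definition rest AB v CE w : pseries :=
  double_contraction AB CE - along AB w - \sum_j psmul (pderiv j v) (CE.1 j).

Lemma Y_F1_F1_m1 AB v CE w :
  Y (Fstate (inc1 (AB, v))) (-1) (Fstate (inc1 (CE, w))) =
  mono 1 [::] [:: c_; dc_] (pairing AB CE) +
  mono 2 [::] [:: c_; dc_] (rest AB v CE w).
Proof.
have gE u : mono 2 [::] [:: dc_; c_] u = mono 2 [::] [:: c_; dc_] u by exact: mono_ghosts.
have h1 : gcreate dc_ (Vf AB (-1 - 1) (V1mono 0 [:: c_] CE)) =
    mono 1 [::] [:: c_; dc_] (pairing AB CE) +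
    mono 2 [::] [:: c_; dc_] (double_contraction AB CE).
  apply: (etrans (f_equal (gcreate dc_) (Vf_V_m2 AB CE 0 [:: c_] (erefl (-1 - 1))))).
  apply: (etrans (gcreate_dc_neg _ _ _ _)).
  by apply: (f_equal2 +%R); exact: mono_ghosts.
have h2 : gcreate hd2c_ (Vf AB (-1 - 2) (V1mono 0 [:: c_] CE)) = 0.
  by apply: (etrans (f_equal (gcreate hd2c_) (Vf_V_lt AB CE 0 [:: c_] (n := -1 - 2) isT)));
    exact: gcreate0.
have h3 : gcreate c_ (Vf AB (-1) (mono 1 [::] [:: dc_] w)) =
    - mono 2 [::] [:: c_; dc_] (along AB w).
  apply: (etrans (f_equal (gcreate c_) (Vf_1_m1 AB 1 [:: dc_] w (erefl (-1))))).
  apply: (etrans (gcreateN _ _)); apply: f_equal; apply: gcreate_c_mono; right; left.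
  reflexivity.
pose q := \sum_j psmul (pderiv j v) (CE.1 j).
have h4 : hpow 1 (gcreate dc_ (psfield v (-1) (V1mono 0 [:: c_] CE)) +
    2%:R *: gcreate hd2c_ (psfield v (-1 - 1) (V1mono 0 [:: c_] CE))) =
    - mono 2 [::] [:: c_; dc_] q.
  rewrite (ps_V_lt v CE 0 [:: c_] (n := -1 - 1) isT) gcreate0 scaler0 addr0.
  rewrite (ps_V_m1 v CE 0 [:: c_] (erefl (-1))) gcreate_dc_mono (linN (hpow_linear 1)).
  by apply: f_equal; rewrite hpow_mono; exact: gE.
apply: (etrans (Y_F1_F1 AB v CE w (n := -1) isT)).
apply: (etrans (f_equal2 +%R (f_equal2 +%R (f_equal2 +%R h1 h2) h3) h4)).
have lm := @mono_linear K D 2 [::] [:: c_; dc_].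
have -> : mono 2 [::] [:: c_; dc_] (rest AB v CE w) =
    mono 2 [::] [:: c_; dc_] (double_contraction AB CE) -
    mono 2 [::] [:: c_; dc_] (along AB w) - mono 2 [::] [:: c_; dc_] q.
  rewrite /rest -/q; apply: (etrans (linB lm _ _)); apply: (f_equal2 +%R); [exact: (linB lm)|reflexivity].
rewrite addr0 !addrA; reflexivity.
Qed.

Lemma Y_F1_F0_lt AB v u n : n <= -2 -> Y (Fstate (inc1 (AB, v))) n (Fstate (inF0 u)) = 0.
Proof.
move=> n2; rewrite Y_F1_F0; last by lia.
rewrite !(Vf_1_lt AB 0 [::] u); [|lia|lia]; rewrite ps_1_lt; last by lia.
by rewrite !gcreate0 hpow0 !addr0.
Qed.

Lemma Y_F1_F0_m1 AB v u : Y (Fstate (inc1 (AB, v))) (-1) (Fstate (inF0 u)) =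
  mono 1 [::] [:: c_] (- along AB u).
Proof.
rewrite (Y_F1_F0 AB v u (n := -1) isT) (Vf_1_lt AB 0 [::] u (n := -1 - 1) isT).
rewrite (ps_1_lt v 0 [::] u (n := -1) isT).
rewrite !gcreate0 hpow0 !addr0 (Vf_1_m1 AB 0 [::] u (erefl (-1))) gcreateN.
rewrite gcreate_c_mono; last by left.
rewrite (linN (mono_linear _ _ _)); reflexivity.
Qed.

Lemma Y_F0_F1_lt u CE w n : n <= -2 -> Y (Fstate (inF0 u)) n (Fstate (inc1 (CE, w))) = 0.
Proof.
move=> n2; rewrite Y_F0_F1 (ps_V_lt u CE 0 [:: c_] n2) ps_1_lt ?addr0 //; lia.
Qed.

Lemma Y_F0_F1_m1 u CE w : Y (Fstate (inF0 u)) (-1) (Fstate (inc1 (CE, w))) =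
  mono 1 [::] [:: c_] (\sum_j psmul (pderiv j u) (CE.1 j)).
Proof.
rewrite Y_F0_F1 (ps_V_m1 u CE 0 [:: c_] (erefl (-1))) (ps_1_lt u 1 [:: dc_] w (n := -1) isT).
by rewrite addr0.
Qed.

Lemma Y_vac_cdc r u : Y (mono r [::] [:: c_; dc_] u) 0 (vac K D) =
  mono r [::] [:: c_; dc_] u.
Proof.
rewrite Y_cdcu /vac; pose M := nprod false (fderiv cf) (psfield u).
have lM p : linear (M p) by exact: dcv_lin.
have M0 p : p <= 0 -> M p (mono 0 [::] [::] (@psone K D)) =
    gcreate dc_ (psfield u p (mono 0 [::] [::] (@psone K D))) by exact: dcv_1.
rewrite -/M (nprod_c true (N := 1) _ lM) => [||q q1].
- rewrite big_nat1 M0 // psfield_01 // psmul1 gcreate_dc_mono_0 gcreate_c_mono; last first.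
    by right; left.
  rewrite hpow_mono add0r; reflexivity.
- exact: bfree_mono.
- by rewrite M0 ?ps_1_lt ?gcreate0 //; lia.
Qed.

Lemma Y_vac_c r u : Y (mono r [::] [:: c_] u) 0 (vac K D) = mono r [::] [:: c_] u.
Proof.
rewrite Y_cu /vac (nprod_c false (N := 1) _ (ps_lin u)) => [||q q1].
- rewrite big_nat1 psfield_01 // psmul1 gcreate_c_mono; last by left.
  rewrite hpow_mono add0r; reflexivity.
- exact: bfree_mono.
- by apply: ps_1_lt; lia.
Qed.

(** Once i = 0 is the only term, the outer residue is the value at z = 0 on the vacuum. The creation
    property then returns the state itself, so m is b_{-1} applied to the residue of the product. *)
Lemma m_op_trunc (a b : state) : (forall n, n <= -2 -> Y a n b = 0) ->
  m_op a b = bmode (-1) (Y (Y a (-1) b) 0 (vac K D)).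
Proof.
move=> h; rewrite /m_op (fsum_nat_trunc (N := 1)) => [|q q1].
  by rewrite big_ord1 expr0 invr1 mulr1 scale1r.
by rewrite h ?Y0l ?(lin0 (bmode_linear _)) ?scaler0 //; lia.
Qed.

Lemma m0_F1_F1 AB v CE w : m0 (inc1 (AB, v)) (inc1 (CE, w)) = inc1 (0, pairing AB CE).
Proof.
rewrite /m0 m_op_trunc => [|n]; last exact: Y_F1_F1_lt.
have E r u : bmode (-1) (mono r [::] [:: c_; dc_] u) = mono r [::] [:: dc_] u.
  apply: (etrans (gdelete_mono _ _ _ _ _)) => //.
  by rewrite mem_head expr0 scale1r.
rewrite Y_F1_F1_m1.
apply: (etrans (f_equal (fun x => hcoef 0 (bmode (-1) x)) (linD (Y_linear 0 (vac K D)) _ _))).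
apply: (etrans (f_equal (hcoef 0) (linD (bmode_linear (-1)) _ _))).
apply: (etrans (hcoefD _ _ _)); rewrite -[RHS]addr0; apply: (f_equal2 +%R).
  by rewrite Y_vac_cdc E; exact: (@hcoef_mono_1 _ _ 0).
rewrite Y_vac_cdc E; apply: (@hcoef_hge K D 0 2 [:: dc_]); last by [].
exact: hge_mono.
Qed.

Lemma m0_F1_F0 AB v u : m0 (inc1 (AB, v)) (inF0 u) = 0.
Proof.
rewrite /m0 m_op_trunc => [|n]; last exact: Y_F1_F0_lt.
rewrite Y_F1_F0_m1 Y_vac_c; apply: (@hcoef_hge K D 0 1 [::]) => //.
have -> : bmode (-1) (mono 1 [::] [:: c_] (- along AB u)) =
    mono 1 [::] [::] (- along AB u).
  apply: (etrans (gdelete_mono _ _ _ _ _)) => //.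
  by rewrite mem_head expr0 scale1r.
exact: hge_mono.
Qed.

Lemma nsum_trunc (z : nat -> int -> state) : (forall q n, n <= -2 -> z q n = 0) ->
  (\sum_(q \in [set: nat]) (q.+1%:R^-1 : K) *: z q (- q.+1%:Z)) = z 0%N (-1).
Proof.
move=> h; rewrite (fsum_nat_trunc (N := 1)) => [|q q1].
  by rewrite big_ord1 invr1 scale1r.
by rewrite h ?scaler0 //; lia.
Qed.

Lemma n_op_trunc (k l : nat) (a b c : state) :
  (forall n, n <= -2 -> Y b n c = 0) -> (forall n, n <= -2 -> Y a n c = 0) ->
  n_op k l a b c = Y (bmode (-1) a) 0 (Y b (-1) c) +
                   (-1) ^+ (k * l) *: Y (bmode (-1) b) 0 (Y a (-1) c).
Proof.
move=> hb ha; apply: (f_equal2 +%R).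
  by apply: (nsum_trunc (z := fun q n => Y (bmode (-1) a) q%:Z (Y b n c))) => q n n2;
    rewrite hb // Y0r.
apply: f_equal.
by apply: (nsum_trunc (z := fun q n => Y (bmode (-1) b) q%:Z (Y a n c))) => q n n2;
  rewrite ha // Y0r.
Qed.

Lemma n0_F1 V (b c : lightF) (l0 : 'I_4) :
  (forall q : 'I_4, ghost_part q b = if q == l0 then b else 0) ->
  n0 (inc1 V) b c = hcoef 0 (n_op 1 l0 (Fstate (inc1 V)) (Fstate b) (Fstate c)).
Proof.
move=> hb; pose G (p q : 'I_4) (a b : lightF) :=
  hcoef 0 (n_op p q (Fstate a) (Fstate b) (Fstate c)).
rewrite /n0; apply: (etrans (y := \sum_p G p l0 (if p == ord4_1 then inc1 V else 0) b)).
  apply: eq_bigr => p _; rewrite -(ghost_part_inc1 p V).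
  apply: (etrans (y := \sum_q G p q (ghost_part p (inc1 V)) (if q == l0 then b else 0))).
    by apply: eq_bigr => q _; rewrite -hb.
  apply: (sum_ghost_part (G := fun q => G p q (ghost_part p (inc1 V)))) => q.
  by rewrite /G Fstate0 (lin0 (n_op_linear2 _ _ _ _)) hcoef0.
apply: (sum_ghost_part (G := fun p a => G p l0 a b)) => q.
by rewrite /G Fstate0 (lin0 (n_op_linear1 _ _ _ _)) hcoef0.
Qed.

Lemma hcoef_Vf_cdc AB u v :
  hcoef 0 (Vf AB 0 (mono 1 [::] [:: c_; dc_] u + mono 2 [::] [:: c_; dc_] v)) =
  inc2 (vscale u AB, 0).
Proof.
have h1 : hcoef 0 (Vf AB 0 (mono 1 [::] [:: c_; dc_] u)) = inc2 (vscale u AB, 0).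
  apply: (etrans (hcoef_cg (r := 2) (S := [:: c_; dc_])
    (y := V1mono 1 [:: c_; dc_] (vscale u AB)) _ _)); [exact: Vf_1_0|by []|].
  exact: (@hcoef_V1_2 _ _ 0).
have h2 : hcoef 0 (Vf AB 0 (mono 2 [::] [:: c_; dc_] v)) = 0.
  by apply: (@hcoef_hge K D 0 2 [:: c_; dc_]) => //; apply: hge_Vf; exact: hge_mono.
apply: (etrans (f_equal (hcoef 0) (linD (Vf_lin AB 0) _ _))).
apply: (etrans (hcoefD _ _ _)); apply: (etrans (f_equal2 +%R h1 h2)); exact: addr0.
Qed.

Lemma hcoef_Y_bmode AB v x :
  hcoef 0 (Y (bmode (-1) (Fstate (inc1 (AB, v)))) 0 x) = hcoef 0 (Vf AB 0 x).
Proof. by rewrite bmode_F1 Y_V hpow00. Qed.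

Lemma hcoef_n_op (k l : nat) (a b c : state) A B :
  (forall n, n <= -2 -> Y b n c = 0) -> (forall n, n <= -2 -> Y a n c = 0) ->
  hcoef 0 (Y (bmode (-1) a) 0 (Y b (-1) c)) = A ->
  hcoef 0 (Y (bmode (-1) b) 0 (Y a (-1) c)) = B ->
  hcoef 0 (n_op k l a b c) = A + (-1) ^+ (k * l) *: B.
Proof.
move=> hb ha <- <-; rewrite (n_op_trunc k l hb ha); apply: (etrans (hcoefD _ _ _)).
by apply: (f_equal2 +%R); last exact: (linZ (hcoef_linear 0)).
Qed.

Lemma n0_F1_F1_F1 AB v CE w GH t : n0 (inc1 (AB, v)) (inc1 (CE, w)) (inc1 (GH, t)) =
  inc2 (vscale (pairing CE GH) AB - vscale (pairing AB GH) CE, 0).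
Proof.
apply: (etrans (n0_F1 _ _ (fun q => ghost_part_inc1 q (CE, w)))).
have hb n : n <= -2 -> Y (Fstate (inc1 (CE, w))) n (Fstate (inc1 (GH, t))) = 0.
  exact: Y_F1_F1_lt.
have ha n : n <= -2 -> Y (Fstate (inc1 (AB, v))) n (Fstate (inc1 (GH, t))) = 0.
  exact: Y_F1_F1_lt.
have hA : hcoef 0 (Y (bmode (-1) (Fstate (inc1 (AB, v)))) 0
    (Y (Fstate (inc1 (CE, w))) (-1) (Fstate (inc1 (GH, t))))) =
    inc2 (vscale (pairing CE GH) AB, 0).
  by rewrite hcoef_Y_bmode Y_F1_F1_m1; exact: hcoef_Vf_cdc.
have hB : hcoef 0 (Y (bmode (-1) (Fstate (inc1 (CE, w)))) 0
    (Y (Fstate (inc1 (AB, v))) (-1) (Fstate (inc1 (GH, t))))) =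
    inc2 (vscale (pairing AB GH) CE, 0).
  by rewrite hcoef_Y_bmode Y_F1_F1_m1; exact: hcoef_Vf_cdc.
apply: (etrans (hcoef_n_op 1 ord4_1 hb ha hA hB)).
rewrite -[(1 * ord4_1)%N]/1%N expr1 scaleN1r -inc2N -inc2D; apply: f_equal; apply: (f_equal2 pair).
  reflexivity.
by rewrite -[LHS]/(0 - 0) subr0.
Qed.

(** A residue between F_1 and F_0 already carries one power of h, while c V^1 is read at h^0. This
    disposes of the terms of n_0 having one argument in F_0. *)
Lemma hcoef_Vf_c AB u : hcoef 0 (Vf AB 0 (mono 1 [::] [:: c_] u)) = 0.
Proof.
by apply: (@hcoef_hge K D 0 1 [:: c_]) => //; apply: hge_Vf; exact: hge_mono.
Qed.

Lemma n0_F1_F1_F0 AB v CE w u : n0 (inc1 (AB, v)) (inc1 (CE, w)) (inF0 u) = 0.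
Proof.
apply: (etrans (n0_F1 _ _ (fun q => ghost_part_inc1 q (CE, w)))).
have hb n : n <= -2 -> Y (Fstate (inc1 (CE, w))) n (Fstate (inF0 u)) = 0.
  exact: Y_F1_F0_lt.
have ha n : n <= -2 -> Y (Fstate (inc1 (AB, v))) n (Fstate (inF0 u)) = 0.
  exact: Y_F1_F0_lt.
have hA : hcoef 0 (Y (bmode (-1) (Fstate (inc1 (AB, v)))) 0
    (Y (Fstate (inc1 (CE, w))) (-1) (Fstate (inF0 u)))) = 0.
  by rewrite hcoef_Y_bmode Y_F1_F0_m1; exact: hcoef_Vf_c.
have hB : hcoef 0 (Y (bmode (-1) (Fstate (inc1 (CE, w)))) 0
    (Y (Fstate (inc1 (AB, v))) (-1) (Fstate (inF0 u)))) = 0.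
  by rewrite hcoef_Y_bmode Y_F1_F0_m1; exact: hcoef_Vf_c.
apply: (etrans (hcoef_n_op 1 ord4_1 hb ha hA hB)).
by rewrite scaler0 addr0.
Qed.

Lemma n0_F1_F0_F1 AB v u CE w : n0 (inc1 (AB, v)) (inF0 u) (inc1 (CE, w)) = 0.
Proof.
apply: (etrans (n0_F1 _ _ (fun q => ghost_part_inF0 q u))).
have hb n : n <= -2 -> Y (Fstate (inF0 u)) n (Fstate (inc1 (CE, w))) = 0.
  exact: Y_F0_F1_lt.
have ha n : n <= -2 -> Y (Fstate (inc1 (AB, v))) n (Fstate (inc1 (CE, w))) = 0.
  exact: Y_F1_F1_lt.
have hA : hcoef 0 (Y (bmode (-1) (Fstate (inc1 (AB, v)))) 0
    (Y (Fstate (inF0 u)) (-1) (Fstate (inc1 (CE, w))))) = 0.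
  by rewrite hcoef_Y_bmode Y_F0_F1_m1; exact: hcoef_Vf_c.
have hB : hcoef 0 (Y (bmode (-1) (Fstate (inF0 u))) 0
    (Y (Fstate (inc1 (AB, v))) (-1) (Fstate (inc1 (CE, w))))) = 0.
  by rewrite bmode_F0 Y0l hcoef0.
apply: (etrans (hcoef_n_op 1 ord4_0 hb ha hA hB)).
by rewrite scaler0 addr0.
Qed.

Lemma L_lin n : linear (@Lfield K D n).
Proof. exact: good_linear (good_Lfield K D) n. Qed.

Lemma bf_lin n : linear (bf n).
Proof. exact: good_linear (good_bfield K D) n. Qed.

Definition Gfield : field := nprod true (fderiv cf) bf.

Lemma good_G : good Gfield.
Proof. by apply: good_nprod; [apply: good_fderiv; exact: gc|exact: good_bfield]. Qed.

Lemma G_lin n : linear (Gfield n).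
Proof. exact: good_linear good_G n. Qed.

(** The term in d^2 c is a total derivative and has no residue. *)
Lemma brstE x : brst x = nprod false cf (@Lfield K D) (-1) x + nprod false cf Gfield (-1) x.
Proof.
rewrite /brst (@fderiv_m1 K D _ (-1)) // scaler0 addr0; reflexivity.
Qed.

Lemma bf_out n (q : nat) r m S u : n = - q.+1%:Z -> uniq S -> inr q \notin S ->
  bf n (mono r m S u) = 0.
Proof. by move=> nq uS qS; rewrite (bf_neg _ nq); exact: gdelete_mono_out. Qed.

End LeadingOrder.

(** * The BRST operator on F_0 and F_1 *)

Section BRST.
Context (K : fieldType) (D : nat).
Local Notation state := (state K D).
Local Notation pseries := (pseries K D).
Local Notation field := (field K D).
Local Notation vect := (vect K D).
Local Notation lightF := (lightF K D).
Local Notation mono := (@mono K D).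
Local Notation V1mono := (@V1mono K D).
Local Notation cf := (@cfield K D).
Local Notation bf := (@bfield K D).
Local Notation Lf := (@Lfield K D).
Local Notation Gf := (@Gfield K D).
Implicit Types (x y : state) (u v w : pseries) (r n : int) (i j : 'I_D) (S : seq ggen).
Implicit Types (AB CE GH : vect * vect).

Local Opaque nprod psfield pfield Xfield hpow onps mcreate mderiv gcreate gdelete
  Defs.mono Y Lfield hcoef Gfield.

Lemma bf_negnat n : n <= -1 -> exists q : nat, n = - q.+1%:Z.
Proof. by move=> n1; exists (absz (n + 1)); lia. Qed.

Lemma G_bound n N x : bfree x ->
  (forall q : nat, (N <= q)%N -> bf (n - q%:Z) x = 0) ->
  Gf n x = \sum_(0 <= q < N) q.+1%:R *: gcreate (inr q.+1) (bf (n - q%:Z) x).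
Proof. move=> bx h; exact: nprod_dc bx (@bf_lin K D) h. Qed.

Lemma G_1 n r u : n <= -1 -> Gf n (mono r [::] [::] u) = 0.
Proof.
move=> n1; rewrite (@G_bound n 0) ?big_geq // => [|q _]; first exact: bfree_mono.
have [p pE] : exists p : nat, n - q%:Z = - p.+1%:Z by apply: bf_negnat; lia.
by rewrite (bf_out _ _ _ pE).
Qed.

Lemma cG_1 r u : nprod false cf Gf (-1) (mono r [::] [::] u) = 0.
Proof.
rewrite (@nprod_c _ _ false Gf (-1) _ 0) ?big_geq // => [||q _].
- exact: bfree_mono.
- exact: G_lin.
- by apply: G_1; lia.
Qed.

Lemma cL_1 r u : nprod false cf Lf (-1) (mono r [::] [::] u) = V1mono r [:: c_] (gradient u).
Proof.
rewrite (@nprod_c _ _ false Lf (-1) _ 1) => [||| q q1].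
- rewrite big_nat1; apply: (etrans (f_equal (gcreate _) (@L_1_m1 K D (-1 - 0%:Z) _ _ _ erefl))); exact: gcreate_c_V1_0.
- exact: bfree_mono.
- exact: L_lin.
- by apply: L_1_lt; lia.
Qed.

Lemma QF_F0 u : QF (inF0 u) = inc1 (gradient u, 0).
Proof.
rewrite /QF Fstate_inF0 brstE cL_1 cG_1 addr0; exact: hcoef_V1_1.
Qed.

(* The V^1 component of F_2 is h c dc V^1, so c dc V^1 is invisible to [hcoef 0];
   in Q these terms cancel between the matter and the ghost part anyway. *)
Lemma hcoef_V1_low S CE : same_ghosts S [:: c_; dc_] -> hcoef 0 (V1mono 0 S CE) = 0.
Proof.
move=> hS; rewrite (V1mono_ghosts _ _ hS).
apply: (@hcoefP K D 0 _ 0 0 0 0 0 0 0 0) => [|i|i||i|i||];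
  by rewrite ?scoef_V1_0 ?scoef_V1_p ?scoef_V1_d ?andbF ?scaler0.
Qed.

Lemma cL_cV CE : hcoef 0 (nprod false cf Lf (-1) (V1mono 0 [:: c_] CE)) =
  inc2 (0, (2%:R^-1 : K) *: divergence CE).
Proof.
rewrite (@nprod_c _ _ false Lf (-1) _ 3) => [||| q q1].
(* The three terms pair c_1, c_0, c_{-1} with L_{-1}, L_0, L_1. The first dies because c is already
   present, the second lands in c dc V^1 without the factor h, and the third gives the
   divergence. *)
- rewrite sum_nat3 (L_V_m2 _ _ _ (erefl (-1 - 1%:Z))) (L_V_m3 _ _ _ (erefl (-1 - 2%:Z))).
  rewrite (@hge_gcreate_in K D (inr 0%N) (0 - 1) [:: c_]) => [||//]; last first.
    by apply: hge_Lfield; exact: hge_V1mono.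
  rewrite add0r; apply: (etrans (hcoefD _ _ _)); rewrite -[RHS]add0r; apply: (f_equal2 +%R).
    apply: (etrans (f_equal (hcoef 0) (gcreate_dc_V1 _ _))).
    apply: (etrans (linN (hcoef_linear 0) _)); rewrite hcoef_V1_low //; exact: oppr0.
  rewrite gcreateN (gcreate_hd2c_mono) opprK; exact: (@hcoef_mono_2 _ _ 0).
- exact: bfree_V1mono.
- exact: L_lin.
- by apply: L_V_lt; lia.
Qed.

Lemma cL_dc v : nprod false cf Lf (-1) (mono 1 [::] [:: dc_] v) =
  V1mono 1 [:: c_; dc_] (gradient v).
Proof.
rewrite (@nprod_c _ _ false Lf (-1) _ 1) => [||| q q1].
- rewrite big_nat1; apply: (etrans (f_equal (gcreate _) (@L_1_m1 K D (-1 - 0%:Z) _ _ _ erefl))); exact: gcreate_c_V1.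
- exact: bfree_mono.
- exact: L_lin.
- by apply: L_1_lt; lia.
Qed.

Lemma bf_V1_out n r AB : n <= -2 -> bf n (V1mono r [:: c_] AB) = 0.
Proof.
move=> n2; have n1 : n <= -1 by lia.
have [[|p] pE] := bf_negnat n1; first by lia.
by apply: (etrans (linD (@bf_lin K D n) _ _)); rewrite -[RHS]addr0;
  apply: (f_equal2 +%R); apply: (etrans (lin_sum (@bf_lin K D n) _ _ _));
  apply: big1 => i _; apply: (bf_out _ _ _ pE).
Qed.

Lemma cG_cV r CE : nprod false cf Gf (-1) (V1mono r [:: c_] CE) = V1mono r [:: c_; dc_] CE.
Proof.
have Glt n : n <= -2 -> Gf n (V1mono r [:: c_] CE) = 0.
  move=> n2; rewrite (@G_bound n 0) ?big_geq // => [|q _]; first exact: bfree_V1mono.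
  by apply: bf_V1_out; lia.
have G1 : Gf (-1) (V1mono r [:: c_] CE) = V1mono r [:: dc_] CE.
  rewrite (@G_bound _ 1) => [||q q1].
  - rewrite big_nat1 scale1r (bf_neg _ (q := 0)) //.
    rewrite (gdelete_V1mono_hd (e := c_)) //.
    by apply: (etrans (gcreate_V1mono _ _ _ _)) => //; rewrite scale1r.
  - exact: bfree_V1mono.
  - by apply: bf_V1_out; lia.
rewrite (@nprod_c _ _ false Gf (-1) _ 1) => [||| q q1].
- rewrite big_nat1 subr0 G1; exact: gcreate_c_V1.
- exact: bfree_V1mono.
- exact: G_lin.
- by apply: Glt; lia.
Qed.

Lemma gcreate_hd2c_mono_0 r u : gcreate hd2c_ (mono r [::] [::] u) = mono r [::] [:: hd2c_] u.
Proof.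
rewrite gcreate_monoE; [|by []|by []]; exact: scale1r.
Qed.

Lemma cG_dc r v : nprod false cf Gf (-1) (mono r [::] [:: dc_] v) =
  2%:R *: mono r [::] [:: c_; hd2c_] v.
Proof.
pose x := mono r [::] [:: dc_] v.
have bx : bfree x by exact: bfree_mono.
have b1 : bf (-1) x = 0 by apply: (bf_out (q := 0)).
have b2 : bf (-2) x = mono r [::] [::] v.
  rewrite (bf_neg _ (q := 1)) //; apply: (etrans (gdelete_mono _ _ _ _ _)) => //.
  by rewrite mem_head expr0 scale1r.
have b3 n : n <= -3 -> bf n x = 0.
  move=> n3; have n1 : n <= -1 by lia.
  have [[|[|p]] pE] := bf_negnat n1; [lia|lia|].
  exact: (bf_out _ _ _ pE).
(* The mode b_0 removes c_0, and the derivative of c puts back its z-coefficient 2 c_{-1}, which is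
   the state of d^2 c. *)
have G1 : Gf (-1) x = 2%:R *: mono r [::] [:: hd2c_] v.
  rewrite (@G_bound (-1) 2 x bx) => [|q q1]; last by apply: b3; lia.
  rewrite sum_nat2 subr0 b1 gcreate0 scaler0 add0r (_ : -1 - 1%:Z = -2); last by [].
  rewrite b2.
  apply: (f_equal (fun z : state => 2%:R *: z)).
  exact: gcreate_hd2c_mono_0.
have G2 : Gf (-2) x = mono r [::] [:: dc_] v.
  rewrite (@G_bound (-2) 1 x bx) => [|q q1]; last by apply: b3; lia.
  rewrite big_nat1 subr0 scale1r b2; exact: gcreate_dc_mono_0.
have G3 n : n <= -3 -> Gf n x = 0.
  move=> n3; rewrite (@G_bound n 0 x bx) => [|q _]; first by rewrite big_geq.
  by apply: b3; lia.
rewrite -/x (@nprod_c _ _ false Gf (-1) x 2 bx) => [|| q q1].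
- rewrite sum_nat2 subr0 G1 (_ : -1 - 1%:Z = -2); last by [].
  rewrite G2.
  rewrite [X in _ + X](@hge_gcreate_in K D _ r [:: dc_]) => [||//]; last exact: hge_mono.
  rewrite addr0 (linZ (gcreate_linear _)); apply: (f_equal (fun z : state => 2%:R *: z)).
  by apply: gcreate_c_mono; right; right.
- exact: G_lin.
- by apply: G3; lia.
Qed.

Lemma QF_F1 AB v : (2%:R : K) != 0 -> QF (inc1 (AB, v)) =
  inc2 (gradient v, (2%:R^-1 : K) *: divergence AB + v).
Proof.
move=> K2; rewrite /QF Fstate_inc1.
have c1 : hcoef 0 (brst (V1mono 0 [:: c_] AB)) =
    inc2 (0, (2%:R^-1 : K) *: divergence AB).
  rewrite brstE; apply: (etrans (hcoefD _ _ _)); rewrite cL_cV cG_cV.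
  rewrite hcoef_V1_low //; exact: addr0.
have c2 : hcoef 0 (brst (mono 1 [::] [:: dc_] v)) = inc2 (gradient v, v).
  rewrite brstE; apply: (etrans (hcoefD _ _ _)); rewrite cL_dc cG_dc.
  have h1 : hcoef 0 (V1mono 1 [:: c_; dc_] (gradient v)) = inc2 (gradient v, 0).
    exact: (@hcoef_V1_2 _ _ 0).
  have h2 : hcoef 0 (2%:R *: mono 1 [::] [:: c_; hd2c_] v) = inc2 (0, v).
    have lm := @mono_linear K D 1 [::] [:: c_; hd2c_].
    have e : hcoef 0 (mono 1 [::] [:: c_; hd2c_] (2%:R *: v)) =
        inc2 (0, (2%:R^-1 : K) *: (2%:R *: v)) by exact: (@hcoef_mono_2 _ _ 0 [:: c_; hd2c_]).
    rewrite -(linZ lm) e scalerA mulVf; [rewrite scale1r; reflexivity|exact: K2].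
  apply: (etrans (f_equal2 +%R h1 h2)); rewrite -inc2D.
  apply: f_equal; apply: (f_equal2 pair); first exact: addr0.
  exact: add0r.
apply: (etrans (f_equal (hcoef 0) (linD (@brst_linear K D) _ _))).
apply: (etrans (hcoefD _ _ _)); apply: (etrans (f_equal2 +%R c1 c2)).
rewrite -inc2D; apply: f_equal; apply: (f_equal2 pair); last reflexivity.
exact: add0r.
Qed.

End BRST.

(** * Flat background deformation *)

Section Background.
Context (K : fieldType) (D : nat) (eta : 'M[K]_D).
Local Notation pseries := (pseries K D).
Local Notation vect := (vect K D).
Local Notation lightF := (lightF K D).
Implicit Types (u v w : pseries) (i j k l : 'I_D) (AB CE GH : vect * vect).

Local Opaque mu0 br0 m0 n0 QF psmul pderiv.

Definition dV i AB : vect * vect :=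
  ((fun k => pderiv i (AB.1 k)) : vect, (fun k => pderiv i (AB.2 k)) : vect).

Definition frame i : vect * vect := (single i (@psone K D), 0).

Lemma fbgE i : fbg K i = inc1 (frame i, 0).
Proof. reflexivity. Qed.

Lemma pderiv_psone i : pderiv i (@psone K D) = 0.
Proof.
Local Transparent pderiv.
apply: pseriesP => a; rewrite /pderiv /psone.
case: eqP => [/ffunP/(_ i)|_]; last by rewrite mulr0.
by rewrite !ffunE eqxx addn1.
Qed.
Local Opaque pderiv.

Lemma psmul0l u : psmul 0 u = 0. Proof. exact: lin0 (psmul_linear_l u). Qed.
Lemma psmul0r u : psmul u 0 = 0. Proof. exact: lin0 (psmul_linear_r u). Qed.
Lemma pderiv0 i : pderiv i (0 : pseries) = 0. Proof. exact: lin0 (pderiv_linear i). Qed.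

Lemma frame_sum i (F : 'I_D -> pseries) : \sum_j psmul ((frame i).1 j) (F j) = F i.
Proof.
rewrite (bigD1 i) //= /single eqxx ps1mul big1 ?addr0 // => j /negPf ->.
exact: psmul0l.
Qed.

Lemma pderiv_frame i j k : pderiv j ((frame i).1 k) = 0.
Proof. by rewrite /= /single; case: eqP => _; [exact: pderiv_psone|exact: pderiv0]. Qed.

Lemma pairing_frame i CE : pairing (frame i) CE = CE.2 i.
Proof.
rewrite /pairing big_split /= frame_sum big1 ?addr0 // => j _; exact: psmul0l.
Qed.

Lemma along_frame i u : along (frame i) u = pderiv i u.
Proof. exact: frame_sum. Qed.

(** The frame is a constant vector field, so all terms differentiating it drop out and the bracket
    with f_i becomes a coordinate derivative. This is where flatness of the background enters. *)
Lemma dorfman_frame i CE : dorfman (frame i) CE = dV i CE.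
Proof.
apply: (f_equal2 pair); apply/funext => k.
  under eq_bigr => j _ do rewrite pderiv_frame psmul0l subr0.
  exact: (frame_sum i (fun j => pderiv j (CE.1 k))).
under eq_bigr => j _.
  rewrite pderiv_frame -[(frame i).2 k]/(0 : pseries) -[(frame i).2 j]/(0 : pseries).
  rewrite !pderiv0 !psmul0l subr0 !addr0; over.
exact: (frame_sum i (fun j => pderiv j (CE.2 k))).
Qed.

Lemma br0_fbg_F1 j AB v : br0 (fbg K j) (inc1 (AB, v)) = inc1 (dV j AB, pderiv j v).
Proof. by rewrite fbgE br0_F1_F1 dorfman_frame along_frame. Qed.

Lemma br0_fbg_F0 j u : br0 (fbg K j) (inF0 u) = inF0 (pderiv j u).
Proof. by rewrite fbgE br0_F1_F0 along_frame. Qed.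

Lemma vscale0 AB : vscale 0 AB = 0.
Proof. by apply: (f_equal2 pair); apply/funext => k; exact: psmul0l. Qed.

Lemma R0_F1_term i j AB v : mu0 (fbg K i) (br0 (fbg K j) (inc1 (AB, v))) =
  inc2 (dV i (dV j AB) + vscale (pderiv j v) (frame i),
        (2%:R^-1 : K) *: pderiv j (AB.2 i)).
Proof.
rewrite br0_fbg_F1 fbgE mu0_F1_F1 dorfman_frame vscale0 subr0 pairing_frame.
reflexivity.
Qed.

Lemma R0_F0_term i j u : mu0 (fbg K i) (br0 (fbg K j) (inF0 u)) =
  inc1 (vscale (pderiv j u) (frame i), - pderiv i (pderiv j u)).
Proof.
by rewrite br0_fbg_F0 fbgE mu0_F1_F0 along_frame psmul0l sub0r.
Qed.

Lemma dorfman0 CE : dorfman 0 CE = 0.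
Proof.
apply: (f_equal2 pair); apply/funext => k; apply: big1 => j _.
  rewrite -[LHS]/(psmul (0 : pseries) _ - psmul (pderiv j (0 : pseries)) _).
  by rewrite pderiv0 !psmul0l subr0.
rewrite -[LHS]/(psmul (0 : pseries) _ + psmul (pderiv k (0 : pseries)) _
  - psmul (pderiv j (0 : pseries)) _ + psmul (pderiv k (0 : pseries)) _).
by rewrite !pderiv0 !psmul0l subr0 !addr0.
Qed.

Lemma pairing0 CE : pairing 0 CE = 0.
Proof. apply: big1 => j _; rewrite -[LHS]/(psmul (0 : pseries) _ + psmul (0 : pseries) _).
by rewrite !psmul0l addr0. Qed.

Lemma along0 u : along 0 u = 0.
Proof. by apply: big1 => j _; exact: psmul0l. Qed.

Lemma vscale_0 v : vscale v (0 : vect * vect) = 0.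
Proof. by apply: (f_equal2 pair); apply/funext => k; exact: psmul0r. Qed.

Lemma nu0_F1_F1_term i j AB v CE w :
  n0 (fbg K i) (br0 (fbg K j) (inc1 (AB, v))) (inc1 (CE, w))
  - mu0 (m0 (fbg K i) (inc1 (AB, v))) (br0 (fbg K j) (inc1 (CE, w))) =
  inc2 (vscale (pairing (dV j AB) CE) (frame i) - vscale (CE.2 i) (dV j AB)
        + vscale (AB.2 i) (dV j CE), 0).
Proof.
rewrite !br0_fbg_F1 fbgE n0_F1_F1_F1 m0_F1_F1 mu0_F1_F1 !pairing_frame.
rewrite dorfman0 vscale_0 pairing0 scaler0 addr0 sub0r -inc2N -inc2D.
apply: f_equal; apply: (f_equal2 pair); first exact: (f_equal (+%R _) (opprK _)).
by rewrite -[LHS]/(0 - 0 : pseries) subr0.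
Qed.

Lemma nu0_F1_F0_term i j AB v u :
  n0 (fbg K i) (br0 (fbg K j) (inc1 (AB, v))) (inF0 u)
  - mu0 (m0 (fbg K i) (inc1 (AB, v))) (br0 (fbg K j) (inF0 u)) =
  inc1 (0, - psmul (AB.2 i) (pderiv j u)).
Proof.
rewrite br0_fbg_F1 br0_fbg_F0 fbgE n0_F1_F1_F0 m0_F1_F1 mu0_F1_F0 pairing_frame.
rewrite vscale_0 along0 subr0 sub0r.
rewrite -[LHS]/(- 0, (- 0, - psmul (AB.2 i) (pderiv j u)), - 0, - 0).
by rewrite !oppr0.
Qed.

Lemma nu0_F0_F1_term i j u CE w :
  n0 (fbg K i) (br0 (fbg K j) (inF0 u)) (inc1 (CE, w))
  - mu0 (m0 (fbg K i) (inF0 u)) (br0 (fbg K j) (inc1 (CE, w))) = 0.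
Proof.
rewrite br0_fbg_F1 br0_fbg_F0 fbgE n0_F1_F0_F1 m0_F1_F0.
by rewrite (lin0 (mu0_linear_l _)) subr0.
Qed.

End Background.

(** * Deformed operations in components *)

Section DeformedOperations.
Context (K : fieldType) (D : nat) (eta : 'M[K]_D).
Local Notation pseries := (pseries K D).
Local Notation vect := (vect K D).
Local Notation lightF := (lightF K D).
Local Notation V1s := (vect * vect * pseries)%type.
Implicit Types (u v w : pseries) (i j k l : 'I_D) (AB CE GH : vect * vect).
Implicit Types (V W Z : V1s).

Local Opaque mu0 br0 m0 n0 QF psmul pderiv.

Definition cA k V : pseries := V.1.1 k.
Definition cB k V : pseries := V.1.2 k.
Definition cv V : pseries := V.2.

Lemma cA_linear k : linear (cA k). Proof. by []. Qed.
Lemma cB_linear k : linear (cB k). Proof. by []. Qed.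
Lemma cv_linear : linear cv. Proof. by []. Qed.
Lemma inc1_linear : linear (@inc1 K D).
Proof.
apply: lin_pair; last exact: lin_const0.
apply: lin_pair; last exact: lin_const0.
by apply: lin_pair; [exact: lin_const0|exact: lin_id].
Qed.

Lemma inc2_linear : linear (@inc2 K D).
Proof.
apply: lin_pair; last exact: lin_const0.
apply: lin_pair; last exact: lin_id.
by apply: lin_pair; exact: lin_const0.
Qed.

Lemma V1s_ext V W : (forall k, cA k V = cA k W) -> (forall k, cB k V = cB k W) ->
  cv V = cv W -> V = W.
Proof.
case: V W => [[A B] v] [[A' B'] v'] hA hB hv.
rewrite (_ : A = A'); last by apply/funext.
by rewrite (_ : B = B'); [apply: (f_equal (pair _))|apply/funext].
Qed.

Lemma eta_sum_linear (M N : lmodType K) (f : M -> N) (x : 'I_D -> 'I_D -> M) :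
  linear f -> f (\sum_i \sum_j eta i j *: x i j) = \sum_i \sum_j eta i j *: f (x i j).
Proof.
move=> lf; rewrite (lin_sum lf); apply: eq_bigr => i _; rewrite (lin_sum lf).
by apply: eq_bigr => j _; rewrite (linZ lf).
Qed.

Definition cX j V : pseries := cA j V + \sum_i eta i j *: cB i V.

Lemma eta_frame k (F : 'I_D -> pseries) :
  \sum_i \sum_j eta i j *: psmul (F j) ((frame K i).1 k) = \sum_j eta k j *: F j.
Proof.
rewrite (bigD1 k) //= [X in _ + X]big1 ?addr0 => [|i ik].
  by apply: eq_bigr => j _; rewrite /single eqxx psmul1.
by apply: big1 => j _; rewrite /single eq_sym (negPf ik) psmul0r scaler0.
Qed.

(** Derivatives along A come from the undeformed product and derivatives along eta B from the
    deformation; only their sum X appears in the deformed operations. *)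
Lemma psmul_etaX V (F : 'I_D -> pseries) :
  \sum_j psmul (F j) (cA j V) + \sum_i \sum_j eta i j *: psmul (F j) (cB i V) =
  \sum_j psmul (F j) (cX j V).
Proof.
rewrite exchange_big -big_split; apply: eq_bigr => j _.
rewrite (linD (psmul_linear_r _)); apply: f_equal; rewrite (lin_sum (psmul_linear_r _)).
by apply: eq_bigr => i _; rewrite (linZ (psmul_linear_r _)).
Qed.

Definition box u : pseries := \sum_i \sum_j eta i j *: pderiv i (pderiv j u).

Lemma Qeta_F1 V : (2%:R : K) != 0 -> Qeta eta (inc1 V) = inc2 (
  ((fun k => box (cA k V) + \sum_j eta k j *: pderiv j (cv V)) : vect,
   (fun k => pderiv k (cv V) + box (cB k V)) : vect,
   cv V + (2%:R^-1 : K) *: \sum_j pderiv j (cX j V))).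
Proof.
move=> K2; case: V => AB v; rewrite /Qeta QF_F1 // /R0eta.
under eq_bigr => i _ do under eq_bigr => j _ do rewrite R0_F1_term.
rewrite -(eta_sum_linear _ inc2_linear) -inc2D; apply: f_equal; apply: V1s_ext => [k|k|].
- rewrite (linD (cA_linear k)) (eta_sum_linear _ (cA_linear k)) add0r.
  under eq_bigr => i _ do under eq_bigr => j _ 
    do rewrite -[cA k _]/(pderiv i (pderiv j (AB.1 k)) +
      psmul (pderiv j v) ((frame K i).1 k)) scalerDr.
  under eq_bigr => i _ do rewrite big_split.
  rewrite big_split; apply: (f_equal2 +%R); first reflexivity.
  exact: (eta_frame k (fun j => pderiv j v)).
- rewrite (linD (cB_linear k)) (eta_sum_linear _ (cB_linear k)).
  apply: (f_equal2 +%R); first reflexivity.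
  apply: eq_bigr => i _; apply: eq_bigr => j _; apply: (f_equal ( *:%R _)).
  rewrite -[LHS]/(pderiv i (pderiv j (AB.2 k)) + psmul (pderiv j v) 0) psmul0r; exact: addr0.
rewrite (linD cv_linear) (eta_sum_linear _ cv_linear).
rewrite -[cv (gradient v, _)]/((2%:R^-1 : K) *: divergence AB + v).
rewrite [_ + v]addrC -addrA; apply: (f_equal (+%R v)).
under eq_bigr => i _ do under eq_bigr => j _ do rewrite -[cv _]/((2%:R^-1 : K) *: pderiv j (AB.2 i)) scalerA mulrC -scalerA.
under eq_bigr => i _ do rewrite -scaler_sumr.
rewrite -scaler_sumr -scalerDr; apply: (f_equal ( *:%R _)).
rewrite exchange_big -big_split; apply: eq_bigr => j _.
rewrite (linD (pderiv_linear j)); apply: (f_equal (+%R _)).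
by rewrite (lin_sum (pderiv_linear j)); apply: eq_bigr => i _; rewrite (linZ (pderiv_linear j)).
Qed.

Lemma Qeta_F0 u : Qeta eta (inF0 u) = inc1 (
  ((fun k => \sum_j eta k j *: pderiv j u) : vect, (fun k => pderiv k u) : vect,
   - box u)).
Proof.
rewrite /Qeta QF_F0 /R0eta.
under eq_bigr => i _ do under eq_bigr => j _ do rewrite R0_F0_term.
rewrite -(eta_sum_linear _ inc1_linear) -inc1D; apply: f_equal; apply: V1s_ext => [k|k|].
- rewrite (linD (cA_linear k)) (eta_sum_linear _ (cA_linear k)) add0r.
  exact: (eta_frame k (fun j => pderiv j u)).
- rewrite (linD (cB_linear k)) (eta_sum_linear _ (cB_linear k)).
  rewrite [X in _ + X]big1 ?addr0 // => i _; apply: big1 => j _.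
  by rewrite -[cB k _]/(psmul _ 0) psmul0r scaler0.
rewrite (linD cv_linear) (eta_sum_linear _ cv_linear) add0r -sumrN.
by apply: eq_bigr => i _; rewrite -sumrN; apply: eq_bigr => j _; exact: scalerN.
Qed.

(** Here, in [conv2] and in [cubic2] the factors stand in the order of the arguments although series
    commute: after tensoring with U the coefficients multiply in this order. *)
Definition curr2 k V W : pseries :=
  \sum_l (psmul (pderiv k (cA l V)) (cB l W) + psmul (pderiv k (cB l V)) (cA l W)).

(** Written for an arbitrary component c because the A- and B-components obey the same formula. They
    differ only in the current, which enters B directly and A with its index raised by eta. *)
Definition conv2 (c : V1s -> pseries) V W : pseries :=
  \sum_j (psmul (cX j V) (pderiv j (c W)) - psmul (pderiv j (c V)) (cX j W))
  + (psmul (c V) (cv W) - psmul (cv V) (c W)).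

Lemma sum_curr2 k V W :
  \sum_i \sum_j eta i j *: psmul (pairing (dV j V.1) W.1) ((frame K i).1 k) =
  \sum_j eta k j *: curr2 j V W.
Proof. exact: (eta_frame k (fun j => curr2 j V W)). Qed.

Lemma conv2E (c : V1s -> pseries) V W :
  \sum_j (psmul (cA j V) (pderiv j (c W)) - psmul (pderiv j (c V)) (cA j W))
    + (psmul (cv W) (c V) - psmul (cv V) (c W))
    + \sum_i \sum_j eta i j *:
        (psmul (cB i V) (pderiv j (c W)) - psmul (cB i W) (pderiv j (c V))) =
  conv2 c V W.
Proof.
rewrite /conv2 [psmul (cv W) _]psmulC addrAC; apply: (f_equal2 +%R); last by [].
have -> : \sum_i \sum_j eta i j *:
      (psmul (cB i V) (pderiv j (c W)) - psmul (cB i W) (pderiv j (c V))) =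
    \sum_i \sum_j eta i j *: psmul (pderiv j (c W)) (cB i V)
    - \sum_i \sum_j eta i j *: psmul (pderiv j (c V)) (cB i W).
  rewrite -sumrB; apply: eq_bigr => i _; rewrite -sumrB.
  apply: eq_bigr => j _; rewrite scalerBr [psmul (cB i W) _]psmulC.
  by rewrite [psmul (cB i V) _]psmulC.
rewrite !sumrB -(psmul_etaX W (fun j => pderiv j (c V))).
under [X in X - _ + _ = _]eq_bigr => j _ do rewrite psmulC.
under [X in _ = X - _]eq_bigr => j _ do rewrite psmulC.
rewrite -(psmul_etaX V (fun j => pderiv j (c W))) opprD !addrA.
by apply: (f_equal (fun x => x - _)); rewrite addrAC.
Qed.

Lemma mu0eta_F1_F1 V W : mu0eta eta (inc1 V) (inc1 W) = inc2 (
  ((fun k => conv2 (cA k) V W + \sum_j eta k j *: curr2 j V W) : vect,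
   (fun k => conv2 (cB k) V W + curr2 k V W) : vect,
   (2%:R^-1 : K) *: \sum_l (psmul (cA l V) (cB l W) + psmul (cB l V) (cA l W)))).
Proof.
case: V W => [AB v] [CE w]; rewrite /mu0eta /nu0eta mu0_F1_F1.
under eq_bigr => i _ do under eq_bigr => j _ do rewrite nu0_F1_F1_term.
rewrite -(eta_sum_linear _ inc2_linear) -inc2D; apply: f_equal.
pose V : V1s := (AB, v); pose W : V1s := (CE, w).
apply: V1s_ext => [k|k|].
- rewrite (linD (cA_linear k)) (eta_sum_linear _ (cA_linear k)).
  rewrite -[RHS]/(conv2 (cA k) V W + \sum_j eta k j *: curr2 j V W).
  rewrite -sum_curr2 -conv2E -[RHS]addrA; apply: (f_equal2 +%R).
    rewrite [RHS]addrA; reflexivity.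
  rewrite -big_split; apply: eq_bigr => i _; rewrite -big_split.
  apply: eq_bigr => j _; rewrite -[RHS]/(_ *: _ + _ *: _) -scalerDr; apply: (f_equal ( *:%R _)).
  rewrite [RHS]addrC [RHS]addrA [RHS]addrAC; reflexivity.
- rewrite (linD (cB_linear k)) (eta_sum_linear _ (cB_linear k)).
  rewrite -[RHS]/(conv2 (cB k) V W + curr2 k V W) -conv2E.
  rewrite [RHS]addrAC; apply: (f_equal2 +%R); last first.
    apply: eq_bigr => i _; apply: eq_bigr => j _; apply: (f_equal ( *:%R _)).
    rewrite -[LHS]/(psmul (pairing (dV j AB) CE) 0 - psmul (CE.2 i) (pderiv j (AB.2 k)) +
      psmul (AB.2 i) (pderiv j (CE.2 k))) psmul0r sub0r addrC; reflexivity.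
  rewrite [RHS]addrAC -big_split -[LHS]addrA; apply: (f_equal2 +%R); last reflexivity.
  apply: eq_bigr => i _.
  rewrite -[RHS]/((_ - _) + (_ + _)) [RHS]addrA [_ - _ + _ in RHS]addrAC; reflexivity.
rewrite (linD cv_linear) (eta_sum_linear _ cv_linear).
rewrite [X in _ + X]big1 ?addr0 // => i _; apply: big1 => j _; exact: scaler0.
Qed.

Lemma mu0eta_F1_F0 V u : mu0eta eta (inc1 V) (inF0 u) = inc1 (
  ((fun k => psmul (cA k V) u) : vect, (fun k => psmul (cB k V) u) : vect,
   psmul (cv V) u - \sum_j psmul (cX j V) (pderiv j u))).
Proof.
case: V => AB v; rewrite /mu0eta /nu0eta mu0_F1_F0.
under eq_bigr => i _ do under eq_bigr => j _ do rewrite nu0_F1_F0_term.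
rewrite -(eta_sum_linear _ inc1_linear) -inc1D; apply: f_equal.
apply: V1s_ext => [k|k|].
- rewrite (linD (cA_linear k)) (eta_sum_linear _ (cA_linear k)).
  rewrite [X in _ + X]big1 ?addr0 => [|i _]; last by apply: big1 => j _; exact: scaler0.
  exact: psmulC.
- rewrite (linD (cB_linear k)) (eta_sum_linear _ (cB_linear k)).
  rewrite [X in _ + X]big1 ?addr0 => [|i _]; last by apply: big1 => j _; exact: scaler0.
  exact: psmulC.
rewrite (linD cv_linear) (eta_sum_linear _ cv_linear).
rewrite -[LHS]/(psmul v u - along AB u +
  \sum_i \sum_j eta i j *: - psmul (AB.2 i) (pderiv j u)) -addrA.
apply: (f_equal (+%R (psmul v u))).
under [X in _ = - X]eq_bigr => j _ do rewrite psmulC.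
rewrite -(psmul_etaX (AB, v) (fun j => pderiv j u)) opprD; apply: (f_equal2 +%R).
  apply: f_equal; apply: eq_bigr => j _; exact: psmulC.
rewrite -sumrN; apply: eq_bigr => i _; rewrite -sumrN; apply: eq_bigr => j _.
by rewrite scalerN psmulC.
Qed.

Lemma mu0eta_F0_F1 u W : mu0eta eta (inF0 u) (inc1 W) = inc1 (
  ((fun k => psmul u (cA k W)) : vect, (fun k => psmul u (cB k W)) : vect,
   psmul u (cv W))).
Proof.
case: W => CE w; rewrite /mu0eta /nu0eta mu0_F0_F1.
under eq_bigr => i _ do under eq_bigr => j _ do rewrite nu0_F0_F1_term.
rewrite [X in _ + X]big1 ?addr0 // => i _; apply: big1 => j _; exact: scaler0.
Qed.

Definition cubic2 (c : V1s -> pseries) V W Z : pseries :=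
  \sum_l (psmul (c V) (psmul (cA l W) (cB l Z)) + psmul (c V) (psmul (cB l W) (cA l Z))
   - (psmul (cA l V) (psmul (c W) (cB l Z)) + psmul (cB l V) (psmul (c W) (cA l Z)))).

Lemma psmulCA u v w : psmul u (psmul v w) = psmul v (psmul u w).
Proof. by rewrite !psmulA [psmul u v]psmulC. Qed.

Lemma n0eta_F1 V W Z : n0eta (inc1 V) (inc1 W) (inc1 Z) = inc2 (
  ((fun k => cubic2 (cA k) V W Z) : vect, (fun k => cubic2 (cB k) V W Z) : vect, 0)).
Proof.
have h (c : V1s -> pseries) AB CE GH v w z : psmul (pairing CE GH) (c (AB, v)) -
  psmul (pairing AB GH) (c (CE, w)) = cubic2 c (AB, v) (CE, w) (GH, z).
  rewrite psmulC [X in _ - X]psmulC /pairing !(lin_sum (psmul_linear_r _)) -sumrB.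
  apply: eq_bigr => l _; rewrite !(linD (psmul_linear_r _)).
  rewrite [psmul (c (CE, w)) (psmul (AB.1 l) _)]psmulCA.
  rewrite [psmul (c (CE, w)) (psmul (AB.2 l) _)]psmulCA; reflexivity.
case: V W Z => [AB v] [CE w] [GH z]; rewrite /n0eta n0_F1_F1_F1; apply: f_equal.
by apply: V1s_ext => [k|k|]; [exact: (h (cA k) _ _ _ v w z)|exact: (h (cB k) _ _ _ v w z)|].
Qed.

End DeformedOperations.

(** * Tensor products *)

Section TensorMaps.
Context (K : fieldType).
Implicit Types (M N W : lmodType K).

Lemma tlift_linear M N W (f : M -> N -> W) : bilin f -> linear (tlift f).
Proof.
move=> bf c s t; apply: (etrans (tliftD _ _ bf)).
by apply: (f_equal2 +%R); first exact: tliftZ.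
Qed.

Lemma tensor_eq M N (s t : tensor M N) :
  (forall (W : lmodType K) (f : M -> N -> W), bilin f -> tlift f s = tlift f t) -> s = t.
Proof. by move=> h; apply/tensorP. Qed.

Lemma tens_bilin M N : bilin (@tens K M N).
Proof.
split=> [x|a] c b d; apply: tensor_eq => W f bf.
  by rewrite (tlift_linear bf) !tlift_tens // bf.1.
by rewrite (tlift_linear bf) !tlift_tens // bf.2.
Qed.

Lemma tens_sum M N (t : tensor M N) : t = \sum_(p <- repr t) tens p.1 p.2.
Proof.
apply: tensor_eq => W f bf; rewrite (lin_sum (tlift_linear bf)) /tlift.
by apply: eq_bigr => p _; rewrite [RHS](tlift_tens _ _ bf).
Qed.

Lemma tensor_ind M N (P : tensor M N -> Prop) :
  P 0 -> (forall s t, P s -> P t -> P (s + t)) -> (forall a x, P (tens a x)) ->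
  forall t, P t.
Proof.
by move=> P0 PD Pt t; rewrite [t]tens_sum; apply: big_ind => // p _.
Qed.

Lemma tensor_lin_ext M N W (f h : tensor M N -> W) : linear f -> linear h ->
  (forall a x, f (tens a x) = h (tens a x)) -> f =1 h.
Proof.
move=> lf lh fh; apply: tensor_ind => [|s t fs ft|//]; first by rewrite !lin0.
by rewrite (linD lf) (linD lh) fs ft.
Qed.

Lemma bilin_comp M N M' N' W (op : M' -> N' -> W) (f : M -> M') (g : N -> N') :
  bilin op -> linear f -> linear g -> bilin (fun a x => op (f a) (g x)).
Proof.
move=> [ol orr] lf lg; split=> [x|a]; first exact: (lin_comp (ol _) lf).
exact: (lin_comp (orr _) lg).
Qed.

Lemma bilin_post M N W W' (op : M -> N -> W) (h : W -> W') :
  bilin op -> linear h -> bilin (fun a x => h (op a x)).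
Proof. by move=> [ol orr] lh; split=> [x|a]; exact: lin_comp. Qed.

Lemma tmap_bilin M N M' N' (f : M -> M') (g : N -> N') :
  linear f -> linear g -> bilin (fun a x => tens (f a) (g x)).
Proof. by move=> lf lg; apply: bilin_comp => //; exact: tens_bilin. Qed.

Lemma tmap_linear M N M' N' (f : M -> M') (g : N -> N') :
  linear f -> linear g -> linear (tmap f g).
Proof. by move=> lf lg; apply: tlift_linear; exact: tmap_bilin. Qed.

Lemma tmap_tens M N M' N' (f : M -> M') (g : N -> N') a x :
  linear f -> linear g -> tmap f g (tens a x) = tens (f a) (g x).
Proof. by move=> lf lg; apply: tlift_tens; exact: tmap_bilin. Qed.

Lemma tmap_comp M N M' N' M'' N'' (f : M -> M') (g : N -> N') (f' : M' -> M'')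
    (g' : N' -> N'') t : linear f -> linear g -> linear f' -> linear g' ->
  tmap f' g' (tmap f g t) = tmap (fun a => f' (f a)) (fun x => g' (g x)) t.
Proof.
move=> lf lg lf' lg'; have l1 := lin_comp lf' lf; have l2 := lin_comp lg' lg.
move: t; apply: tensor_lin_ext => [||a x]; last by rewrite !tmap_tens.
  by apply: lin_comp; exact: tmap_linear.
exact: tmap_linear.
Qed.

Lemma tmap_id M N (t : tensor M N) : tmap id id t = t.
Proof.
move: t; apply: tensor_lin_ext => [||a x]; last by rewrite tmap_tens.
  exact: tmap_linear.
exact: lin_id.
Qed.

Lemma tmap_left_linear M N M' N' (f : M' -> M -> N') (W : lmodType K) (g : N -> W) t :
  (forall a, linear (f a)) -> (forall x, linear (fun a => f a x)) -> linear g ->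
  linear (fun a => tmap (f a) g t).
Proof.
move=> lf lf' lg c a b; move: t; apply: tensor_lin_ext => [||x y].
- exact: tmap_linear.
- by apply: lin_add; [apply: lin_scale|]; exact: tmap_linear.
by rewrite !tmap_tens // lf' (tens_bilin _ _).1.
Qed.

Lemma tmap_right_linear M N M' N' (f : M -> N') (W : lmodType K) (g : M' -> N -> W) t :
  (forall a, linear (g a)) -> (forall x, linear (fun a => g a x)) -> linear f ->
  linear (fun a => tmap f (g a) t).
Proof.
move=> lf lf' lg c a b; move: t; apply: tensor_lin_ext => [||x y].
- exact: tmap_linear.
- by apply: lin_add; [apply: lin_scale|]; exact: tmap_linear.
by rewrite !tmap_tens // lf' (tens_bilin _ _).2.
Qed.

Section Bilinear.
Context (M1 M2 M3 N1 N2 N3 : lmodType K).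
Context (op : M1 -> M2 -> M3) (m : N1 -> N2 -> N3) (bo : bilin op) (bm : bilin m).

Lemma tmap2_bilin_aux t : bilin (fun a x => tmap (op a) (m x) t).
Proof.
split=> [x|a].
  by apply: tmap_left_linear; [exact: bo.2|exact: bo.1|exact: bm.2].
by apply: tmap_right_linear; [exact: bm.2|exact: bm.1|exact: bo.2].
Qed.

Lemma tmap2_linear_l t : linear (fun s => tmap2 op m s t).
Proof. by apply: tlift_linear; exact: tmap2_bilin_aux. Qed.

Lemma tmap2_tens_l a x t : tmap2 op m (tens a x) t = tmap (op a) (m x) t.
Proof. by apply: tlift_tens; exact: tmap2_bilin_aux. Qed.

Lemma tmap2_tens a x b y : tmap2 op m (tens a x) (tens b y) = tens (op a b) (m x y).
Proof.
rewrite tmap2_tens_l tmap_tens //; [exact: bo.2|exact: bm.2].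
Qed.

Lemma tmap2_linear_r s : linear (tmap2 op m s).
Proof.
move=> c t t'; move: s; apply: tensor_lin_ext => [||a x].
- exact: tmap2_linear_l.
- by apply: lin_add; [apply: lin_scale|]; exact: tmap2_linear_l.
by rewrite !tmap2_tens_l tmap_linear //; [exact: bo.2|exact: bm.2].
Qed.

Lemma tmap2_bilin : bilin (tmap2 op m).
Proof. by split; [exact: tmap2_linear_l|exact: tmap2_linear_r]. Qed.

End Bilinear.

Lemma bilin_tensor_ext (M1 M2 N1 N2 W : lmodType K)
    (f h : tensor M1 N1 -> tensor M2 N2 -> W) : bilin f -> bilin h ->
  (forall a x b y, f (tens a x) (tens b y) = h (tens a x) (tens b y)) ->
  forall s t, f s t = h s t.
Proof.
move=> bf bh fh s t; move: s; apply: tensor_lin_ext => [||a x]; [exact: bf.1|exact: bh.1|].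
by move: t; apply: tensor_lin_ext => [||b y] //; [exact: bf.2|exact: bh.2].
Qed.

Definition trilin (M1 M2 M3 W : lmodType K) (f : M1 -> M2 -> M3 -> W) : Prop :=
  [/\ forall b c, linear (fun a => f a b c), forall a c, linear (fun b => f a b c)
    & forall a b, linear (f a b)].

Section Trilinear.
Context (M1 M2 M3 M4 N1 N2 N3 N4 : lmodType K).
Context (op : M1 -> M2 -> M3 -> M4) (m : N1 -> N2 -> N3 -> N4).
Context (bo : trilin op) (bm : trilin m).

Let op2 a : bilin (op a).
Proof. by case: bo => _ h2 h3; split=> [c|b]; [exact: h2|exact: h3]. Qed.
Let m2 a : bilin (m a).
Proof. by case: bm => _ h2 h3; split=> [c|b]; [exact: h2|exact: h3]. Qed.

Lemma tmap3_bilin_aux t r : bilin (fun a x => tmap2 (op a) (m x) t r).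
Proof.
case: (bo) (bm) => o1 _ _ [m1 _ _].
split=> [x|a] c b d.
  move: t r; apply: bilin_tensor_ext => [||y z y' z']; first exact: tmap2_bilin.
    split=> q; apply: lin_add; try apply: lin_scale;
      by [exact: tmap2_linear_l|exact: tmap2_linear_r].
  by rewrite !tmap2_tens // o1 (tens_bilin _ _).1.
move: t r; apply: bilin_tensor_ext => [||y z y' z']; first exact: tmap2_bilin.
  split=> q; apply: lin_add; try apply: lin_scale;
    by [exact: tmap2_linear_l|exact: tmap2_linear_r].
by rewrite !tmap2_tens // m1 (tens_bilin _ _).2.
Qed.

Lemma tmap3_tens_l a x t r : tmap3 op m (tens a x) t r = tmap2 (op a) (m x) t r.
Proof. by apply: tlift_tens; exact: tmap3_bilin_aux. Qed.

Lemma tmap3_linear1 t r : linear (fun s => tmap3 op m s t r).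
Proof. by apply: tlift_linear; exact: tmap3_bilin_aux. Qed.

Lemma tmap3_trilin : trilin (tmap3 op m).
Proof.
split=> [t r|s r|s t]; first exact: tmap3_linear1.
  move=> c t t'; move: s; apply: tensor_lin_ext => [||a x].
  - exact: tmap3_linear1.
  - by apply: lin_add; [apply: lin_scale|]; exact: tmap3_linear1.
  by rewrite !tmap3_tens_l tmap2_linear_l.
move=> c r r'; move: s; apply: tensor_lin_ext => [||a x].
- exact: tmap3_linear1.
- by apply: lin_add; [apply: lin_scale|]; exact: tmap3_linear1.
by rewrite !tmap3_tens_l tmap2_linear_r.
Qed.

Lemma tmap3_tens a x b y c z :
  tmap3 op m (tens a x) (tens b y) (tens c z) = tens (op a b c) (m x y z).
Proof. by rewrite tmap3_tens_l tmap2_tens. Qed.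

End Trilinear.

Lemma trilin_tensor_ext (M1 M2 M3 N1 N2 N3 W : lmodType K)
    (f h : tensor M1 N1 -> tensor M2 N2 -> tensor M3 N3 -> W) :
  trilin f -> trilin h ->
  (forall a x b y c z, f (tens a x) (tens b y) (tens c z) =
                       h (tens a x) (tens b y) (tens c z)) ->
  forall s t r, f s t r = h s t r.
Proof.
move=> [f1 f2 f3] [h1 h2 h3] fh s t r; move: s.
apply: tensor_lin_ext => [||a x]; [exact: f1|exact: h1|].
move: t r; apply: bilin_tensor_ext => // [||b y c z] //; by split.
Qed.

End TensorMaps.

(** * The differential algebra of U-valued power series *)

Section FieldAlgebra.
Context (K : fieldType) (D : nat) (U : algType K).
Local Notation pseries := (pseries K D).
Local Notation T := (tensor pseries U).
Local Notation psone := (@psone K D).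
Implicit Types (s t r : T) (i j : 'I_D).

Local Opaque psmul pderiv Defs.psone.

Lemma psmul_bilin : bilin (@psmul K D).
Proof. by split; [exact: psmul_linear_l|exact: psmul_linear_r]. Qed.

Lemma mul_bilin : bilin ( *%R : U -> U -> U).
Proof. 
split=> [y|x] a b c; first by rewrite mulrDl scalerAl.
by rewrite mulrDr scalerAr. Qed.

Lemma opmul_bilin : bilin (@opmul K D U).
Proof. exact: tmap2_bilin psmul_bilin mul_bilin. Qed.

Lemma opmul_tens u x v y : opmul (tens u x) (tens v y) = tens (psmul u v) (x * y) :> T.
Proof. exact: tmap2_tens psmul_bilin mul_bilin _ _ _ _. Qed.

Lemma opmulA : associative (@opmul K D U).
Proof.
have [ol orr] := opmul_bilin.
move=> s t r; pose f s t r := opmul s (opmul t r).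
rewrite -[LHS]/(f s t r); pose h s t r := opmul (opmul s t) r.
rewrite -[RHS]/(h s t r); move: s t r; apply: trilin_tensor_ext.
- split=> [b c|a c|a b]; [exact: ol| |].
    exact: (lin_comp (orr a) (ol c)).
  exact: (lin_comp (orr a) (orr b)).
- split=> [b c|a c|a b]; last exact: orr.
    exact: (lin_comp (ol c) (ol b)).
  exact: (lin_comp (ol c) (orr a)).
by move=> u x v y w z; rewrite /f /h !opmul_tens psmulA mulrA.
Qed.

Lemma op1mul : left_id (tens psone 1) (@opmul K D U).
Proof.
apply: tensor_lin_ext => [||u x]; [exact: opmul_bilin.2|exact: lin_id|].
by rewrite opmul_tens ps1mul mul1r.
Qed.

Lemma opmul1 : right_id (tens psone 1) (@opmul K D U).
Proof.
apply: tensor_lin_ext => [||u x]; [exact: opmul_bilin.1|exact: lin_id|].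
by rewrite opmul_tens psmul1 mulr1.
Qed.

Lemma opmulDl : left_distributive (@opmul K D U) +%R.
Proof. by move=> s t r; exact: (linD (opmul_bilin.1 r)). Qed.

Lemma opmulDr : right_distributive (@opmul K D U) +%R.
Proof. by move=> s t r; exact: (linD (opmul_bilin.2 s)). Qed.

(* The constant coefficient map to U separates 1 from 0. *)
Lemma tens1_neq0 : tens psone 1 != 0 :> T.
Proof.
pose f (u : pseries) (x : U) : U := u [ffun=> 0%N] *: x.
have bf : bilin f.
  split=> [x|u] a b c; rewrite /f ?scalerDr; last by rewrite !scalerA mulrC.
  by rewrite psD psZ scalerDl scalerA.
apply/eqP => /(f_equal (tlift f)); rewrite tlift_tens // (lin0 (tlift_linear bf)).
Local Transparent Defs.psone.
by rewrite /f /Defs.psone eqxx scale1r; move/eqP; rewrite oner_eq0.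
Qed.

(** A named copy of this one tensor product, to which the ring and algebra structures are attached;
    its module structure is the one of [tensor]. *)
Definition psalg : Type := T.
HB.instance Definition _ := GRing.Lmodule.on psalg.
HB.instance Definition _ :=
  GRing.Zmodule_isNzRing.Build psalg opmulA op1mul opmul1 opmulDl opmulDr tens1_neq0.

Lemma opscalerAl (a : K) (s t : psalg) : a *: (s * t) = (a *: s) * t.
Proof. by rewrite -[RHS]/(opmul (a *: s) t) (linZ (opmul_bilin.1 t)). Qed.
HB.instance Definition _ := GRing.Lmodule_isLalgebra.Build K psalg opscalerAl.

Lemma opscalerAr (a : K) (s t : psalg) : a *: (s * t) = s * (a *: t).
Proof. by rewrite -[RHS]/(opmul s (a *: t)) (linZ (opmul_bilin.2 s)). Qed.
HB.instance Definition _ := GRing.Lalgebra_isAlgebra.Build K psalg opscalerAr.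

Definition dalg i : psalg -> psalg := dtens i.

Lemma dtens_linear (N : lmodType K) i : linear (@dtens K D N i).
Proof. exact: (tmap_linear (pderiv_linear i) (lin_id (V := N))). Qed.

Lemma dtens_tens (N : lmodType K) i u (x : N) :
  dtens i (tens u x) = tens (pderiv i u) x.
Proof. exact: (tmap_tens _ _ (pderiv_linear i) (lin_id (V := N))). Qed.

Lemma dtensC (N : lmodType K) i j (s : tensor pseries N) :
  dtens i (dtens j s) = dtens j (dtens i s).
Proof.
move: s; apply: tensor_lin_ext => [||u x]; last by rewrite !dtens_tens pderivC.
  exact: lin_comp (dtens_linear i) (dtens_linear j).
exact: lin_comp (dtens_linear j) (dtens_linear i).
Qed.

Lemma dtensM i s t : dtens i (opmul s t) = opmul (dtens i s) t + opmul s (dtens i t).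
Proof.
have [ol orr] := opmul_bilin; have ld := @dtens_linear U i.
pose h s t := opmul (dtens i s) t + opmul s (dtens i t).
rewrite -[RHS]/(h s t); move: s t; apply: bilin_tensor_ext.
- exact: bilin_post opmul_bilin ld.
- split=> [t|s]; apply: lin_add.
  + exact: (lin_comp (ol t) ld).
  + exact: ol.
  + exact: orr.
  + exact: (lin_comp (orr s) ld).
move=> u x v y; rewrite /h !dtens_tens !opmul_tens dtens_tens pderivM.
exact: (linD ((tens_bilin _ _).1 (x * y))).
Qed.

End FieldAlgebra.

(** * Yang-Mills equations in a differential algebra *)

Section NoncommutativeRing.
Variable T : nzRingType.

(** Presents a ring, with Leibniz equality, to the decision procedure for identities in
    noncommutative rings. *)
#[export] Instance nc_ring_ops :
  @Ncring.Ring_ops T 0 1 +%R *%R (fun x y => x - y) -%R eq := {}.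

#[export] Instance nc_ring : Ncring.Ring (Ro := nc_ring_ops).
Proof.
split.
- exact: RelationClasses.eq_equivalence.
- by move=> x y -> z t ->.
- by move=> x y -> z t ->.
- by move=> x y -> z t ->.
- by move=> x y ->.
- exact: add0r.
- exact: addrC.
- exact: addrA.
- exact: mul1r.
- exact: mulr1.
- exact: mulrA.
- exact: mulrDl.
- by move=> x y z; exact: mulrDr.
- by [].
- exact: addrN.
Qed.

End NoncommutativeRing.

(** * From the component equations to the Yang-Mills form *)

Section YangMillsAlgebra.
Context (K : fieldType) (D : nat) (eta : 'M[K]_D) (T : algType K).
Context (K2 : (2%:R : K) != 0) (eta_sym : eta^T = eta).
Context (d : 'I_D -> T -> T) (d_linear : forall i, linear (d i)).
Context (dM : forall i x y, d i (x * y) = d i x * y + x * d i y).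
Context (dC : forall i j x, d i (d j x) = d j (d i x)).
Implicit Types (x y C : T) (i j k l m : 'I_D).

Local Ltac nc_ring_tac :=
  match goal with |- @eq _ ?x ?y => change (@eq (GRing.NzRing.sort T) x y) end;
  Ncring_tac.non_commutative_ring.

Definition ctr (F : 'I_D -> 'I_D -> T) : T := \sum_i \sum_j eta i j *: F i j.

Lemma eq_ctr F G : (forall i j, F i j = G i j) -> ctr F = ctr G.
Proof. by move=> FG; apply: eq_bigr => i _; apply: eq_bigr => j _; rewrite FG. Qed.

Lemma ctr_lin (f : T -> T) F : linear f -> f (ctr F) = ctr (fun i j => f (F i j)).
Proof. exact: eta_sum_linear. Qed.

Lemma ctrD F G : ctr F + ctr G = ctr (fun i j => F i j + G i j).
Proof.
rewrite /ctr -big_split; apply: eq_bigr => i _; rewrite -big_split.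
by apply: eq_bigr => j _; rewrite scalerDr.
Qed.

Lemma ctrN F : - ctr F = ctr (fun i j => - F i j).
Proof. by apply: ctr_lin; apply: lin_opp; exact: lin_id. Qed.

Lemma ctrT F : ctr F = ctr (fun i j => F j i).
Proof.
rewrite /ctr exchange_big; apply: eq_bigr => i _; apply: eq_bigr => j _.
by rewrite -{1}eta_sym mxE.
Qed.

Lemma mul2_inj x y : x + x = y + y -> x = y.
Proof.
move/(f_equal ( *:%R (2%:R^-1 : K))).
by rewrite -!mulr2n -!scaler_nat !scalerA mulVf // !scale1r.
Qed.

(** The workhorse of the algebraic part: the identities below fail term by term and hold only for
    the sum of the (i, j) and (j, i) terms. A symmetric eta sees nothing else, once 2 is invertible,
    and what remains is a free identity in a noncommutative ring. *)
Lemma ctr_sym_eq F G : (forall i j, F i j + F j i = G i j + G j i) -> ctr F = ctr G.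
Proof.
move=> FG; apply: mul2_inj; rewrite [X in _ + X]ctrT [X in _ = _ + X]ctrT !ctrD.
exact: eq_ctr.
Qed.

Lemma mull_linear y : linear (fun x => x * y).
Proof. by move=> a x z; rewrite mulrDl scalerAl. Qed.

Lemma mulr_linear y : linear (fun x => y * x).
Proof. by move=> a x z; rewrite mulrDr scalerAr. Qed.

Context (c Ph : 'I_D -> T).

Local Notation a l := (c l - Ph l).
Local Notation b l := (c l + Ph l).

(* With c = calA and Ph = Phi the fields are A = eta (c - Ph) and B = c + Ph, and
   [bX] is the coefficient A + eta B of the first order part of the equations. *)
Definition up k : T := \sum_l eta k l *: a l.
Definition bX j : T := up j + \sum_i eta i j *: b i.

Lemma sum_up (f : 'I_D -> T -> T) : (forall l, linear (f l)) ->
  \sum_l f l (up l) = ctr (fun l m => f l (a m)).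
Proof.
move=> lf; apply: eq_bigr => l _; rewrite (lin_sum (lf l)).
by apply: eq_bigr => m _; rewrite (linZ (lf l)).
Qed.

(** Since eta is symmetric, the contributions of [Ph] to A and eta B cancel, and X = 2 eta c. Hence
    first order terms involve the connection only. *)
Lemma bXE j : bX j = \sum_i eta i j *: (c i + c i).
Proof.
rewrite /bX /up -big_split; apply: eq_bigr => i _.
rewrite -{1}eta_sym mxE -[LHS]scalerDr; apply: f_equal; nc_ring_tac.
Qed.

Lemma sum_bX (f : 'I_D -> T -> T) : (forall l, linear (f l)) ->
  \sum_j f j (bX j) = ctr (fun i j => f j (c i + c i)).
Proof.
move=> lf; rewrite /ctr exchange_big; apply: eq_bigr => j _; rewrite bXE (lin_sum (lf j)).
by apply: eq_bigr => i _; rewrite (linZ (lf j)).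
Qed.

Definition comm x y : T := x * y - y * x.
Definition nab i x : T := d i x + comm (c i) x.
Definition curvature j k : T := d j (c k) - d k (c j) + comm (c j) (c k).

(* The c d^2c component of the equation is v = vsol. *)
Definition vsol : T := - ctr (fun i j => d i (c j) + c i * c j - Ph i * Ph j).

(** The mixed products of c and [Ph] are antisymmetric in the two indices and disappear under
    contraction with eta, leaving the c c and Phi Phi terms. *)
Lemma w_component v :
  v + (2%:R^-1 : K) *: (\sum_j d j (bX j)) +
    (2%:R^-1 : K) *: (\sum_l (up l * b l + b l * up l)) = v - vsol.
Proof.
rewrite -addrA -scalerDr; apply: f_equal; rewrite /vsol opprK.
rewrite sum_bX // (sum_up (f := fun l x => x * b l + b l * x)); last first.
  by move=> l; apply: lin_add; [exact: mull_linear|exact: mulr_linear].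
set w := ctr (fun i j => _ - _); have -> : w = (2%:R^-1 : K) *: (w + w).
  by rewrite -mulr2n -scaler_nat scalerA mulVf // scale1r.
apply: f_equal; rewrite !ctrD; apply: ctr_sym_eq => i j.
rewrite !(linD (d_linear _)); nc_ring_tac.
Qed.

Definition box_alg x : T := \sum_i \sum_j eta i j *: d i (d j x).
Definition conv_alg v x : T :=
  \sum_j (bX j * d j x - d j x * bX j) + (x * v - v * x).
Definition cubic_alg x : T :=
  \sum_l (x * (up l * b l) + x * (b l * up l) - (up l * (x * b l) + b l * (x * up l))).
Definition curr_alg k : T := \sum_l (d k (up l) * b l + d k (b l) * up l).
Definition wave v x : T := box_alg x + conv_alg v x + cubic_alg x.

Lemma wave_linear v : linear (wave v).
Proof.
apply: lin_add; first apply: lin_add.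
- apply: lin_bigsum => i; apply: lin_bigsum => j; apply: lin_scale.
  exact: lin_comp (d_linear i) (d_linear j).
- apply: lin_add; last first.
    by apply: lin_sub; [exact: mull_linear|exact: mulr_linear].
  apply: lin_bigsum => j; apply: lin_sub.
    exact: lin_comp (mulr_linear (bX j)) (d_linear j).
  exact: lin_comp (mull_linear (bX j)) (d_linear j).
apply: lin_bigsum => l; apply: lin_sub; apply: lin_add; try exact: mull_linear.
  exact: lin_comp (mulr_linear (up l)) (mull_linear (b l)).
exact: lin_comp (mulr_linear (b l)) (mull_linear (up l)).
Qed.

(** The cubic terms alone, 2 x (c c - Phi Phi) - 2 (c x c - Phi x Phi) after contraction, are not
    commutators. The commutator of x with the quadratic part of [vsol] turns them into double
    commutators, and the derivative part of [vsol] supplies [d_i c_j, x]. *)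
Lemma waveE x : wave vsol x =
  ctr (fun i j => nab i (nab j x) - comm (Ph i) (comm (Ph j) x)).
Proof.
rewrite /wave /conv_alg /cubic_alg -[box_alg x]/(ctr (fun i j => d i (d j x))).
rewrite (sum_bX (f := fun j y => y * d j x - d j x * y)); last first.
  by move=> j; apply: lin_sub; [exact: mull_linear|exact: mulr_linear].
rewrite (sum_up (f := fun l y => x * (y * b l) + x * (b l * y) - (y * (x * b l) + b l * (x * y))));
  last first.
  move=> l; apply: lin_sub; apply: lin_add; try exact: mull_linear.
  - exact: lin_comp (mulr_linear x) (mull_linear (b l)).
  - exact: lin_comp (mulr_linear x) (mulr_linear (b l)).
  - exact: lin_comp (mulr_linear (b l)) (mulr_linear x).
rewrite /vsol mulrN mulNr opprK (ctr_lin _ (mulr_linear x)) (ctr_lin _ (mull_linear x)).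
rewrite ctrN !ctrD; apply: ctr_sym_eq => i j.
rewrite /nab /comm !(linD (d_linear _)) !(linN (d_linear _)) !dM (dC j i).
nc_ring_tac.
Qed.

Lemma currE k : d k vsol + curr_alg k =
  ctr (fun i j => - d k (d i (c j)) + comm (d k (c i)) (c j) - comm (d k (Ph i)) (Ph j)).
Proof.
rewrite /curr_alg (sum_up (f := fun l y => d k y * b l + d k (b l) * y)); last first.
  move=> l; apply: lin_add; last exact: mulr_linear.
  exact: lin_comp (mull_linear (b l)) (d_linear k).
rewrite /vsol (linN (d_linear k)) (ctr_lin _ (d_linear k)) ctrN !ctrD.
apply: ctr_sym_eq => i j; rewrite /comm !(linD (d_linear _)) !(linN (d_linear _)) !dM.
nc_ring_tac.
Qed.

(** Treating c_k as a matter field misses covariance: [nab] applied to c_k lacks - d_k c_j to be the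
    curvature, and [c_k, Phi_i] lacks d_k Phi_i to be [nabla_k, Phi_i]. The gradient of v together
    with the current supplies exactly these terms. *)
Lemma connectionE k : d k vsol + curr_alg k + wave vsol (c k) =
  ctr (fun i j => nab i (curvature j k)) - ctr (fun i j => comm (nab k (Ph i)) (Ph j)).
Proof.
rewrite currE waveE ctrN !ctrD; apply: ctr_sym_eq => i j.
rewrite /curvature /nab /comm !(linD (d_linear _)) !(linN (d_linear _)) !dM.
rewrite !(dC _ k) (dC j i).
nc_ring_tac.
Qed.

Lemma scalarE k : wave vsol (Ph k) =
  ctr (fun i j => nab i (nab j (Ph k))) - ctr (fun i j => comm (Ph i) (comm (Ph j) (Ph k))).
Proof. by rewrite waveE ctrN ctrD. Qed.

Context (eta_inv : eta \in unitmx).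

Lemma eta_inj (x : 'I_D -> T) :
  (forall k, \sum_j eta k j *: x j = 0) -> forall l, x l = 0.
Proof.
move=> h l; have : \sum_k invmx eta l k *: \sum_j eta k j *: x j = 0.
  by apply: big1 => k _; rewrite h scaler0.
have -> : \sum_k invmx eta l k *: \sum_j eta k j *: x j =
    \sum_j (invmx eta *m eta) l j *: x j.
  under eq_bigr => k _ do rewrite scaler_sumr.
  rewrite exchange_big; apply: eq_bigr => j _; rewrite mxE scaler_suml.
  by apply: eq_bigr => k _; rewrite scalerA.
rewrite mulVmx // (bigD1 l) //= mxE eqxx scale1r big1 ?addr0 // => j /negPf jl.
by rewrite mxE eq_sym jl scale0r.
Qed.

(* The A- and B-components differ only by [wave] being applied to c - Ph or c + Ph,
   so that their half-sum and half-difference separate the two fields. *)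
Lemma wave_equations v :
  (forall k,
    box_alg (up k) + \sum_j eta k j *: d j v
      + (conv_alg v (up k) + \sum_j eta k j *: curr_alg j) + cubic_alg (up k) = 0 /\
    d k v + box_alg (b k) + (conv_alg v (b k) + curr_alg k) + cubic_alg (b k) = 0) <->
  (forall k, d k v + curr_alg k + wave v (c k) = 0 /\ wave v (Ph k) = 0).
Proof.
have lw := wave_linear v.
have hA k : box_alg (up k) + \sum_j eta k j *: d j v
      + (conv_alg v (up k) + \sum_j eta k j *: curr_alg j) + cubic_alg (up k) =
    \sum_j eta k j *: (d j v + curr_alg j + wave v (a j)).
  under [RHS]eq_bigr => j _ do rewrite scalerDr -(linZ lw).
  rewrite big_split -(lin_sum lw); under eq_bigr => j _ do rewrite scalerDr.
  rewrite big_split /wave -/(up k).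
  set s1 := \sum_j _; set s2 := \sum_j _; rewrite -[RHS]/(s1 + s2 + _).
  nc_ring_tac.
have hB k : d k v + box_alg (b k) + (conv_alg v (b k) + curr_alg k) + cubic_alg (b k) =
    d k v + curr_alg k + wave v (c k) + wave v (Ph k).
  rewrite -[RHS]addrA -(linD lw) /wave; nc_ring_tac.
have hC k : d k v + curr_alg k + wave v (a k) =
    d k v + curr_alg k + wave v (c k) - wave v (Ph k).
  by rewrite -[RHS]addrA -(linB lw).
split=> h k.
  (* The A-equations are combinations of these expressions with coefficients eta; invertibility of
     eta recovers each of them. *)
  have hk : d k v + curr_alg k + wave v (a k) = 0.
    by apply: (eta_inj (x := fun k => d k v + curr_alg k + wave v (a k))) => j;
      rewrite -hA; case: (h j).
  have [_] := h k; rewrite hB; rewrite hC in hk.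
  (* With x the connection part and y the scalar part, the two equations read x - y = 0 and x + y =
     0; hence y + y = 0, and 2 is invertible. *)
  move: hk; move: (d k v + _ + _) (wave v (Ph k)) => x y /eqP.
  rewrite subr_eq0 => /eqP -> yy; have y0 : y = 0.
    by apply: mul2_inj; rewrite yy addr0.
  by rewrite y0.
split.
  rewrite hA big1 // => j _; have [h1 h2] := h j.
  by rewrite hC h1 h2 subr0 scaler0.
by have [h1 h2] := h k; rewrite hB h1 h2 addr0.
Qed.

Definition nabla_op i (s : T) : T := d i s + c i * s.
Definition phi_op i (s : T) : T := Ph i * s.

Lemma opcomm_nabla_mul i x : opcomm (nabla_op i) (fun s => x * s) = (fun s => nab i x * s).
Proof.
apply/funext => s; rewrite /opcomm /nabla_op /nab /comm dM; nc_ring_tac.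
Qed.

(** Second derivatives of the argument cancel because the derivations commute, and first derivatives
    by the Leibniz rule. Every further commutator is therefore again a multiplication operator. *)
Lemma opcomm_nabla j k : opcomm (nabla_op j) (nabla_op k) = (fun s => curvature j k * s).
Proof.
apply/funext => s; rewrite /opcomm /nabla_op /curvature /comm.
rewrite !(linD (d_linear _)) !dM (dC j k); nc_ring_tac.
Qed.

Lemma opcomm_mul x y : opcomm (fun s => x * s) (fun s => y * s) = (fun s => comm x y * s).
Proof. apply/funext => s; rewrite /opcomm /comm; nc_ring_tac. Qed.

Lemma faithful x y : (forall s, x * s = y * s) <-> x = y.
Proof. by split=> [h|->//]; rewrite -[x]mulr1 h mulr1. Qed.

Lemma ctr_mull F s : \sum_i \sum_j eta i j *: (F i j * s) = ctr F * s.
Proof. by rewrite (ctr_lin _ (mull_linear s)). Qed.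

Lemma operator_equations : (forall k, d k vsol + curr_alg k + wave vsol (c k) = 0 /\
    wave vsol (Ph k) = 0) <->
  (forall k,
    (forall s, \sum_i \sum_j eta i j *:
        opcomm (nabla_op i) (opcomm (nabla_op j) (nabla_op k)) s =
      \sum_i \sum_j eta i j *: opcomm (opcomm (nabla_op k) (phi_op i)) (phi_op j) s) /\
    (forall s, \sum_i \sum_j eta i j *:
        opcomm (nabla_op i) (opcomm (nabla_op j) (phi_op k)) s =
      \sum_i \sum_j eta i j *: opcomm (phi_op i) (opcomm (phi_op j) (phi_op k)) s)).
Proof.
have e1 k s : \sum_i \sum_j eta i j *:
      opcomm (nabla_op i) (opcomm (nabla_op j) (nabla_op k)) s =
    ctr (fun i j => nab i (curvature j k)) * s.
  rewrite -ctr_mull; apply: eq_ctr => i j; by rewrite opcomm_nabla opcomm_nabla_mul.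
have e2 k s : \sum_i \sum_j eta i j *:
      opcomm (opcomm (nabla_op k) (phi_op i)) (phi_op j) s =
    ctr (fun i j => comm (nab k (Ph i)) (Ph j)) * s.
  rewrite -ctr_mull; apply: eq_ctr => i j; by rewrite opcomm_nabla_mul opcomm_mul.
have e3 k s : \sum_i \sum_j eta i j *:
      opcomm (nabla_op i) (opcomm (nabla_op j) (phi_op k)) s =
    ctr (fun i j => nab i (nab j (Ph k))) * s.
  rewrite -ctr_mull; apply: eq_ctr => i j; by rewrite !opcomm_nabla_mul.
have e4 k s : \sum_i \sum_j eta i j *:
      opcomm (phi_op i) (opcomm (phi_op j) (phi_op k)) s =
    ctr (fun i j => comm (Ph i) (comm (Ph j) (Ph k))) * s.
  rewrite -ctr_mull; apply: eq_ctr => i j; by rewrite !opcomm_mul.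
split=> h k; have [h1 h2] := h k.
  move: h1 h2; rewrite connectionE scalarE => /eqP; rewrite subr_eq0 => /eqP h1.
  move=> /eqP; rewrite subr_eq0 => /eqP h2.
  by split=> s; rewrite ?(e1, e3) ?(e2, e4) ?h1 ?h2.
rewrite connectionE scalarE; split.
  suff -> : ctr (fun i j => nab i (curvature j k)) =
      ctr (fun i j => comm (nab k (Ph i)) (Ph j)) by rewrite subrr.
  by apply/faithful => s; rewrite -e1 h1 e2.
suff -> : ctr (fun i j => nab i (nab j (Ph k))) =
    ctr (fun i j => comm (Ph i) (comm (Ph j) (Ph k))) by rewrite subrr.
by apply/faithful => s; rewrite -e3 h2 e4.
Qed.

End YangMillsAlgebra.

(** * Components of the tensor equations *)

Section Multilinear.
Context (K : fieldType).
Implicit Types (M N P W : lmodType K).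

Lemma bilin_add M N W (f h : M -> N -> W) :
  bilin f -> bilin h -> bilin (fun s t => f s t + h s t).
Proof. by move=> [f1 f2] [h1 h2]; split=> t; exact: lin_add. Qed.

Lemma bilin_sub M N W (f h : M -> N -> W) :
  bilin f -> bilin h -> bilin (fun s t => f s t - h s t).
Proof. by move=> [f1 f2] [h1 h2]; split=> t; exact: lin_sub. Qed.

Lemma bilin_scale M N W (c : K) (f : M -> N -> W) :
  bilin f -> bilin (fun s t => c *: f s t).
Proof. by move=> [f1 f2]; split=> t; exact: lin_scale. Qed.

Lemma bilin_sum M N W I (r : seq I) (f : I -> M -> N -> W) :
  (forall i, bilin (f i)) -> bilin (fun s t => \sum_(i <- r) f i s t).
Proof. by move=> bf; split=> t; apply: lin_bigsum => i; [exact: (bf i).1|exact: (bf i).2]. Qed.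

Lemma trilin_add M N P W (f h : M -> N -> P -> W) :
  trilin f -> trilin h -> trilin (fun s t r => f s t r + h s t r).
Proof. by move=> [f1 f2 f3] [h1 h2 h3]; split=> a b; exact: lin_add. Qed.

Lemma trilin_sub M N P W (f h : M -> N -> P -> W) :
  trilin f -> trilin h -> trilin (fun s t r => f s t r - h s t r).
Proof. by move=> [f1 f2 f3] [h1 h2 h3]; split=> a b; exact: lin_sub. Qed.

Lemma trilin_sum M N P W I (q : seq I) (f : I -> M -> N -> P -> W) :
  (forall i, trilin (f i)) -> trilin (fun s t r => \sum_(i <- q) f i s t r).
Proof.
by move=> bf; split=> a b; apply: lin_bigsum => i; case: (bf i).
Qed.

Lemma trilin_comp M N P M' N' P' W (op : M' -> N' -> P' -> W) (f : M -> M')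
    (g : N -> N') (h : P -> P') : trilin op -> linear f -> linear g -> linear h ->
  trilin (fun s t r => op (f s) (g t) (h r)).
Proof.
move=> [o1 o2 o3] lf lg lh; split=> a b.
- exact: (lin_comp (o1 _ _) lf).
- exact: (lin_comp (o2 _ _) lg).
- exact: (lin_comp (o3 _ _) lh).
Qed.

Lemma trilin_post M N P W W' (op : M -> N -> P -> W) (f : W -> W') :
  trilin op -> linear f -> trilin (fun s t r => f (op s t r)).
Proof.
by move=> [o1 o2 o3] lf; split=> a b; [exact: (lin_comp lf (o1 _ _))|
  exact: (lin_comp lf (o2 _ _))|exact: (lin_comp lf (o3 _ _))].
Qed.

Lemma alg_mul_bilin (T : algType K) : bilin ( *%R : T -> T -> T).
Proof. by split=> x; [exact: mull_linear|exact: mulr_linear]. Qed.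

Lemma alg_mul_trilin (T : algType K) : trilin (fun x y z : T => x * (y * z)).
Proof.
split=> x y; first exact: mull_linear.
  exact: lin_comp (mulr_linear x) (mull_linear y).
exact: lin_comp (mulr_linear x) (mulr_linear y).
Qed.

End Multilinear.

(** * Coordinates on the tensor product of F_1 and U *)

Section Transcription.
Context (K : fieldType) (D : nat) (eta : 'M[K]_D) (U : algType K).
Local Notation pseries := (pseries K D).
Local Notation vect := (vect K D).
Local Notation lightF := (lightF K D).
Local Notation V1s := (vect * vect * pseries)%type.
Local Notation T := (psalg D U).
Local Notation d := (@dalg K D U).
Local Notation idU := (id : U -> U).
Implicit Types (u : pseries) (i j k l : 'I_D) (x y : U).
Implicit Types (V W : V1s) (s t r : tensor V1s U) (X : tensor lightF U).

Local Opaque mu0 br0 m0 n0 QF psmul pderiv psone Qeta mu0eta n0eta.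

Lemma tmap0 (M N : lmodType K) (s : tensor M U) : tmap (fun _ => 0 : N) idU s = 0.
Proof.
have l0 := @lin_const0 K M N.
move: s; apply: tensor_lin_ext => [||a x]; [exact: tmap_linear|exact: lin_const0|].
by rewrite tmap_tens // (lin0 ((tens_bilin _ _).1 x)).
Qed.

Definition tA k s : T := tmap (cA k) idU s.
Definition tB k s : T := tmap (cB k) idU s.
Definition tv s : T := tmap (@cv K D) idU s.
Definition tX j s : T := tA j s + \sum_i eta i j *: tB i s.

Lemma tA_linear k : linear (tA k). Proof. exact: tmap_linear. Qed.
Lemma tB_linear k : linear (tB k). Proof. exact: tmap_linear. Qed.
Lemma tv_linear : linear tv. Proof. exact: tmap_linear. Qed.
Lemma tX_linear k : linear (tX k).
Proof.
apply: lin_add; first exact: tA_linear.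
by apply: lin_bigsum => i; apply: lin_scale; exact: tB_linear.
Qed.
Lemma dalg_linear i : linear (d i). Proof. exact: dtens_linear. Qed.

Lemma tA_tens k V x : tA k (tens V x) = tens (cA k V) x. Proof. exact: tmap_tens. Qed.
Lemma tB_tens k V x : tB k (tens V x) = tens (cB k V) x. Proof. exact: tmap_tens. Qed.
Lemma tv_tens V x : tv (tens V x) = tens (cv V) x. Proof. exact: tmap_tens. Qed.
Lemma tX_tens j V x : tX j (tens V x) = tens (cX eta j V) x.
Proof.
have lx := (tens_bilin pseries U).1 x.
rewrite /tX tA_tens /cX (linD lx) (lin_sum lx); apply: f_equal.
by apply: eq_bigr => i _; rewrite tB_tens (linZ lx).
Qed.

Lemma dalg_tens i u x : d i (tens u x) = tens (pderiv i u) x.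
Proof. exact: dtens_tens. Qed.

Lemma mul_tens (u v : pseries) x y : (tens u x : T) * (tens v y : T) = tens (psmul u v) (x * y).
Proof. exact: opmul_tens. Qed.

Definition injA i u : V1s := (single i u, 0, 0).
Definition injB i u : V1s := (0, single i u, 0).
Definition injv u : V1s := (0, 0, u).

Lemma single_linear i : linear (@single K D i).
Proof. by apply: lin_vect => j; case: (j == i); [exact: lin_id|exact: lin_const0]. Qed.

Lemma injA_linear i : linear (injA i).
Proof.
apply: lin_pair; last exact: lin_const0.
by apply: lin_pair; [exact: single_linear|exact: lin_const0].
Qed.

Lemma injB_linear i : linear (injB i).
Proof.
apply: lin_pair; last exact: lin_const0.
by apply: lin_pair; [exact: lin_const0|exact: single_linear].
Qed.

Lemma injv_linear : linear injv.
Proof. by apply: lin_pair; [exact: lin_const0|exact: lin_id]. Qed.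

Definition pack (a b : 'I_D -> T) (v : T) : tensor V1s U :=
  \sum_i tmap (injA i) idU (a i) + \sum_i tmap (injB i) idU (b i) + tmap injv idU v.

Lemma tmap_single i k (a : T) :
  tmap (fun u => @single K D i u k) idU a = if k == i then a else 0.
Proof.
rewrite /single; case: (k == i); [exact: tmap_id|exact: tmap0].
Qed.

Lemma sum_single k (F : 'I_D -> T) : \sum_i (if k == i then F i else 0) = F k.
Proof.
by rewrite (bigD1 k) //= eqxx big1 ?addr0 // => i /negPf ik; rewrite eq_sym ik.
Qed.

Lemma tmap_pack (M : lmodType K) (f : V1s -> M) a b (v : T) : linear f ->
  tmap f idU (pack a b v) = \sum_i tmap (fun u => f (injA i u)) idU (a i)
    + \sum_i tmap (fun u => f (injB i u)) idU (b i) + tmap (fun u => f (injv u)) idU v.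
Proof.
move=> lf; have lt := tmap_linear lf (@lin_id K U).
have h (g : pseries -> V1s) (c : T) : linear g ->
    tmap f idU (tmap g idU c) = tmap (fun u => f (g u)) idU c.
  by move=> lg; apply: tmap_comp.
rewrite (linD lt) (linD lt).
apply: (f_equal2 +%R); last exact: (h _ _ injv_linear).
apply: (f_equal2 +%R); rewrite (lin_sum lt); apply: eq_bigr => i _.
  exact: (h _ _ (injA_linear i)).
exact: (h _ _ (injB_linear i)).
Qed.

Lemma tA_pack k a b (v : T) : tA k (pack a b v) = a k.
Proof.
rewrite /tA tmap_pack //; under eq_bigr => i _ do rewrite tmap_single.
rewrite sum_single [X in _ + X + _]big1 => [|i _]; last exact: tmap0.
by rewrite tmap0 !addr0.
Qed.

Lemma tB_pack k a b (v : T) : tB k (pack a b v) = b k.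
Proof.
rewrite /tB tmap_pack //; under [X in _ + X + _]eq_bigr => i _ do rewrite tmap_single.
rewrite sum_single [X in X + _ + _]big1 => [|i _]; last exact: tmap0.
by rewrite tmap0 addr0 add0r.
Qed.

Lemma tv_pack a b (v : T) : tv (pack a b v) = v.
Proof.
rewrite /tv tmap_pack // [X in X + _ + _]big1 => [|i _]; last exact: tmap0.
rewrite [X in _ + X + _]big1 => [|i _]; last exact: tmap0.
by rewrite !add0r; exact: tmap_id.
Qed.

Lemma V1s_sum V : V = \sum_i injA i (cA i V) + \sum_i injB i (cB i V) + injv (cv V).
Proof.
have sel k (F : 'I_D -> pseries) : \sum_i single i (F i) k = F k.
  by rewrite (bigD1 k) //= /single eqxx big1 ?addr0 // => i /negPf ik; rewrite eq_sym ik.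
apply: V1s_ext => [k|k|].
- rewrite !(linD (cA_linear k)) !(lin_sum (cA_linear k)).
  rewrite [X in _ = X + _ + _](sel k (fun i => cA i V)).
  rewrite [X in _ = _ + X + _]big1 //; symmetry; rewrite addr0; exact: addr0.
- rewrite !(linD (cB_linear k)) !(lin_sum (cB_linear k)).
  rewrite [X in _ = _ + X + _](sel k (fun i => cB i V)).
  rewrite [X in _ = X + _ + _]big1 //; symmetry; rewrite add0r; exact: addr0.
rewrite !(linD (@cv_linear K D)) !(lin_sum (@cv_linear K D)).
rewrite [X in _ = X + _ + _]big1 // [X in _ = _ + X + _]big1 //.
by symmetry; rewrite !add0r.
Qed.

Lemma packK s : pack (fun k => tA k s) (fun k => tB k s) (tv s) = s.
Proof.
have lA i := tmap_linear (injA_linear i) (@lin_id K U).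
have lB i := tmap_linear (injB_linear i) (@lin_id K U).
have lv := tmap_linear injv_linear (@lin_id K U).
move: s; apply: tensor_lin_ext => [||V x]; last 1 first.
- have lx := (tens_bilin V1s U).1 x.
  rewrite /pack tv_tens tmap_tens //; last exact: injv_linear.
  rewrite [in RHS](V1s_sum V) !(linD lx) !(lin_sum lx).
  apply: (f_equal2 +%R) => //; apply: (f_equal2 +%R); apply: eq_bigr => i _.
    by rewrite tA_tens tmap_tens //; exact: injA_linear.
  by rewrite tB_tens tmap_tens //; exact: injB_linear.
- apply: lin_add; last exact: lin_comp lv tv_linear.
  apply: lin_add; apply: lin_bigsum => i.
    exact: lin_comp (lA i) (tA_linear i).
  exact: lin_comp (lB i) (tB_linear i).
exact: lin_id.
Qed.

(** Tensoring commutes with the finite direct sum V^1 + V^0, so a tensor is rebuilt from its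
    coordinates by [packK]. This is how an equation of tensors splits into three kinds of component
    equations. *)
Lemma tensor_V1s0 s : s = 0 <-> [/\ forall k, tA k s = 0, forall k, tB k s = 0 & tv s = 0].
Proof.
split=> [->|[hA hB hv]].
  by split=> [k|k|]; [exact: lin0 (tA_linear k)|exact: lin0 (tB_linear k)|exact: lin0 tv_linear].
rewrite -[s]packK (_ : (fun k => tA k s) = fun=> 0); last by apply/funext => k.
rewrite (_ : (fun k => tB k s) = fun=> 0); last by apply/funext => k.
have l0 (f : pseries -> V1s) : linear f -> tmap f idU (0 : T) = 0.
  by move=> lf; exact: lin0 (tmap_linear lf (@lin_id K U)).
rewrite hv /pack l0; last exact: injv_linear.
rewrite big1 => [|i _]; last exact: l0 (injA_linear i).
rewrite big1 => [|i _]; last exact: l0 (injB_linear i).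
by rewrite !addr0.
Qed.

End Transcription.

(** * Components of the generalized Maurer-Cartan expression *)

Section Components.
Context (K : fieldType) (D : nat) (eta : 'M[K]_D) (U : algType K).
Context (K2 : (2%:R : K) != 0).
Local Notation pseries := (pseries K D).
Local Notation vect := (vect K D).
Local Notation lightF := (lightF K D).
Local Notation V1s := (vect * vect * pseries)%type.
Local Notation T := (psalg D U).
Local Notation d := (@dalg K D U).
Local Notation idU := (id : U -> U).
Local Notation tA := (@tA K D U).
Local Notation tB := (@tB K D U).
Local Notation tv := (@tv K D U).
Local Notation tX := (@tX K D eta U).
Implicit Types (i j k l : 'I_D) (x y : U).
Implicit Types (V W Z : V1s) (s t r : tensor V1s U) (X : tensor lightF U).

Local Opaque mu0 br0 m0 n0 QF psmul pderiv psone Qeta mu0eta n0eta.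

Definition i1 s : tensor lightF U := tmap (@inc1 K D) idU s.
Definition i2 s : tensor lightF U := tmap (@inc2 K D) idU s.
Definition i0 (u : T) : tensor lightF U := tmap (@inF0 K D) idU u.

Lemma inF0_linear : linear (@inF0 K D).
Proof.
apply: lin_pair; last exact: lin_const0.
apply: lin_pair; last exact: lin_const0.
by apply: lin_pair; [exact: lin_id|exact: lin_const0].
Qed.

Lemma i1_linear : linear i1. Proof. exact: tmap_linear (@inc1_linear K D) (@lin_id K U). Qed.
Lemma i2_linear : linear i2. Proof. exact: tmap_linear (@inc2_linear K D) (@lin_id K U). Qed.
Lemma i0_linear : linear i0. Proof. exact: tmap_linear inF0_linear (@lin_id K U). Qed.

Lemma i2_inj0 s : i2 s = 0 -> s = 0.
Proof.
move/(f_equal (tmap (@F2 K D) idU)); have lF := tmap_linear (@F2_linear K D) (@lin_id K U).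
rewrite (lin0 lF) /i2 tmap_comp //; last by [exact: inc2_linear|exact: F2_linear].
by rewrite -[LHS]/(tmap id idU s) tmap_id.
Qed.

(** On elements of ghost number 1 the values lie entirely in F_2, so projecting loses nothing and
    the equation becomes one in V^1 + V^0 tensored with U. *)
Definition Q1 V : V1s := F2 (Qeta eta (inc1 V)).
Definition mu1 V W : V1s := F2 (mu0eta eta (inc1 V) (inc1 W)).
Definition n1 V W Z : V1s := F2 (n0eta (inc1 V) (inc1 W) (inc1 Z)).

Lemma Q1_linear : linear Q1.
Proof.
apply: lin_comp; first exact: F2_linear.
by apply: lin_comp; [exact: Qeta_linear|exact: inc1_linear].
Qed.

Lemma mu1_bilin : bilin mu1.
Proof.
apply: bilin_post; last exact: F2_linear.
exact: bilin_comp (mu0eta_bilin eta) (@inc1_linear K D) (@inc1_linear K D).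
Qed.

Lemma n0eta_trilin : trilin (@n0eta K D).
Proof.
Local Transparent n0eta.
by split=> a b; [exact: n0_linear1|exact: n0_linear2|exact: n0_linear3].
Qed.
Local Opaque n0eta.

Lemma n1_trilin : trilin n1.
Proof.
apply: trilin_post; last exact: F2_linear.
exact: trilin_comp n0eta_trilin (@inc1_linear K D) (@inc1_linear K D) (@inc1_linear K D).
Qed.

Lemma Qeta_inc1 V : Qeta eta (inc1 V) = inc2 (Q1 V).
Proof. by rewrite /Q1 Qeta_F1. Qed.

Lemma mu0eta_inc1 V W : mu0eta eta (inc1 V) (inc1 W) = inc2 (mu1 V W).
Proof. by rewrite /mu1 mu0eta_F1_F1. Qed.

Lemma n0eta_inc1 V W Z : n0eta (inc1 V) (inc1 W) (inc1 Z) = inc2 (n1 V W Z).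
Proof. by rewrite /n1 n0eta_F1. Qed.

Lemma mul3_trilin : trilin (fun x y z : U => x * y * z).
Proof.
have [h1 h2 h3] := @alg_mul_trilin K U.
by split=> x y; [apply: lin_ext (h1 x y)|apply: lin_ext (h2 x y)|apply: lin_ext (h3 x y)]
  => z; rewrite mulrA.
Qed.

Definition ymE s : tensor V1s U :=
  tmap Q1 idU s + tmap2 mu1 *%R s s + tmap3 n1 (fun x y z => x * y * z) s s s.

Lemma QetaU_i1 s : QetaU eta (i1 s) = i2 (tmap Q1 idU s).
Proof.
rewrite /QetaU /i1 /i2 !tmap_comp //;
  try by [exact: Q1_linear|exact: inc2_linear|exact: inc1_linear|exact: Qeta_linear].
by apply: (f_equal (fun f => tmap f idU s)); apply/funext => V; exact: Qeta_inc1.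
Qed.

Lemma mu0etaU_i1 s t : mu0etaU eta (i1 s) (i1 t) = i2 (tmap2 mu1 *%R s t).
Proof.
have bU := @mul_bilin K U; have bm := tmap2_bilin (mu0eta_bilin eta) bU.
pose f s t := mu0etaU eta (i1 s) (i1 t); rewrite -[LHS]/(f s t).
pose h s t := i2 (tmap2 mu1 *%R s t); rewrite -[RHS]/(h s t).
move: s t; apply: bilin_tensor_ext => [||V x W y].
- exact: bilin_comp bm i1_linear i1_linear.
- exact: bilin_post (tmap2_bilin mu1_bilin bU) i2_linear.
rewrite /f /h (tmap2_tens mu1_bilin bU) /i1 /i2 !tmap_tens //;
  try exact: inc1_linear; try exact: inc2_linear.
rewrite /mu0etaU (tmap2_tens (mu0eta_bilin eta) bU) mu0eta_inc1; reflexivity.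
Qed.

Lemma n0etaU_i1 s t r : n0etaU (i1 s) (i1 t) (i1 r) =
  i2 (tmap3 n1 (fun x y z => x * y * z) s t r).
Proof.
pose f s t r := n0etaU (i1 s) (i1 t) (i1 r); rewrite -[LHS]/(f s t r).
pose h s t r := i2 (tmap3 n1 (fun x y z => x * y * z) s t r); rewrite -[RHS]/(h s t r).
move: s t r; apply: trilin_tensor_ext => [||V x W y Z z].
- exact: trilin_comp (tmap3_trilin n0eta_trilin mul3_trilin) i1_linear i1_linear i1_linear.
- exact: trilin_post (tmap3_trilin n1_trilin mul3_trilin) i2_linear.
rewrite /f /h (tmap3_tens n1_trilin mul3_trilin) /i1 /i2 !tmap_tens //;
  try exact: inc1_linear; try exact: inc2_linear.
rewrite /n0etaU (tmap3_tens n0eta_trilin mul3_trilin) n0eta_inc1; reflexivity.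
Qed.

Lemma YM_i1 s : QetaU eta (i1 s) + mu0etaU eta (i1 s) (i1 s) +
  n0etaU (i1 s) (i1 s) (i1 s) = i2 (ymE s).
Proof.
by rewrite QetaU_i1 mu0etaU_i1 n0etaU_i1 /ymE !(linD i2_linear).
Qed.

Definition tc (c : V1s -> pseries) s : T := tmap c idU s.

Section OneComponent.
Variables (c : V1s -> pseries) (lc : linear c).

Lemma tc_linear : linear (tc c). Proof. exact: tmap_linear. Qed.
Lemma tc_tens V x : tc c (tens V x) = tens (c V) x. Proof. exact: tmap_tens. Qed.

Definition conv2T s t : T :=
  \sum_j (tX j s * d j (tc c t) - d j (tc c s) * tX j t)
  + (tc c s * tv t - tv s * tc c t).

Definition cubicT s t r : T :=
  \sum_l (tc c s * (tA l t * tB l r) + tc c s * (tB l t * tA l r)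
   - (tA l s * (tc c t * tB l r) + tB l s * (tc c t * tA l r))).

Lemma mul_comp_bilin (f h : tensor V1s U -> T) :
  linear f -> linear h -> bilin (fun s t => f s * h t).
Proof. by move=> lf lh; exact: bilin_comp (@alg_mul_bilin K T) lf lh. Qed.

Lemma conv2T_bilin : bilin conv2T.
Proof.
have ld j : linear (fun s => d j (tc c s)) by exact: lin_comp (dalg_linear j) tc_linear.
apply: bilin_add; [apply: bilin_sum => j|]; apply: bilin_sub; apply: mul_comp_bilin;
  by [exact: tX_linear|exact: ld|exact: tc_linear|exact: tv_linear].
Qed.

Lemma cubicT_trilin : trilin cubicT.
Proof.
have h (f g e : tensor V1s U -> T) : linear f -> linear g -> linear e ->
    trilin (fun s t r => f s * (g t * e r)).
  by move=> lf lg le; exact: trilin_comp (@alg_mul_trilin K T) lf lg le.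
apply: trilin_sum => l; apply: trilin_sub; apply: trilin_add; apply: h;
  by [exact: tA_linear|exact: tB_linear|exact: tc_linear].
Qed.

Lemma conv2T_tens V x W y :
  conv2T (tens V x) (tens W y) = tens (conv2 eta c V W) (x * y).
Proof.
have lx := (tens_bilin pseries U).1 (x * y).
rewrite /conv2T /conv2 (linD lx) (lin_sum lx); apply: (f_equal2 +%R).
  apply: eq_bigr => j _; rewrite !tX_tens !tc_tens !dalg_tens !mul_tens.
  by rewrite (linB lx).
by rewrite !tc_tens !tv_tens !mul_tens (linB lx).
Qed.

Lemma cubicT_tens V x W y Z z :
  cubicT (tens V x) (tens W y) (tens Z z) = tens (cubic2 c V W Z) (x * y * z).
Proof.
have lx := (tens_bilin pseries U).1 (x * y * z).
rewrite /cubicT /cubic2 (lin_sum lx); apply: eq_bigr => l _.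
by rewrite !tA_tens !tB_tens !tc_tens !mul_tens (linB lx) !(linD lx) !mulrA.
Qed.

End OneComponent.

Definition curr2T k s t : T :=
  \sum_l (d k (tA l s) * tB l t + d k (tB l s) * tA l t).

Lemma curr2T_bilin k : bilin (curr2T k).
Proof.
apply: bilin_sum => l; apply: bilin_add; apply: mul_comp_bilin;
  by [exact: lin_comp (dalg_linear k) (tA_linear l)|exact: tB_linear
     |exact: lin_comp (dalg_linear k) (tB_linear l)|exact: tA_linear].
Qed.

Lemma curr2T_tens k V x W y :
  curr2T k (tens V x) (tens W y) = tens (curr2 k V W) (x * y).
Proof.
have lx := (tens_bilin pseries U).1 (x * y).
rewrite /curr2T /curr2 (lin_sum lx); apply: eq_bigr => l _.
by rewrite !tA_tens !tB_tens !dalg_tens !mul_tens (linD lx).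
Qed.

Lemma box_tens (u : pseries) x : box_alg eta d (tens u x) = tens (box eta u) x.
Proof.
have lx := (tens_bilin pseries U).1 x.
rewrite /box (eta_sum_linear eta _ lx); apply: eq_bigr => i _; apply: eq_bigr => j _.
by rewrite !dalg_tens.
Qed.

Lemma tA_Q1 k s : tA k (tmap Q1 idU s) =
  box_alg eta d (tA k s) + \sum_j eta k j *: d j (tv s).
Proof.
have lQ := tmap_linear Q1_linear (@lin_id K U).
move: s; apply: tensor_lin_ext => [||V x]; first exact: lin_comp (tA_linear k) lQ.
  apply: lin_add.
    apply: lin_bigsum => i; apply: lin_bigsum => j; apply: lin_scale.
    exact: lin_comp (dalg_linear i) (lin_comp (dalg_linear j) (tA_linear k)).
  apply: lin_bigsum => j; apply: lin_scale.
  exact: lin_comp (dalg_linear j) (@tv_linear K D U).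
have lx := (tens_bilin pseries U).1 x.
rewrite tmap_tens //; last exact: Q1_linear.
rewrite !tA_tens tv_tens box_tens /Q1 Qeta_F1 // -[cA k _]/(box eta _ + _) (linD lx).
apply: f_equal; rewrite (lin_sum lx); apply: eq_bigr => j _.
by rewrite dalg_tens (linZ lx).
Qed.

Lemma tB_Q1 k s : tB k (tmap Q1 idU s) = d k (tv s) + box_alg eta d (tB k s).
Proof.
have lQ := tmap_linear Q1_linear (@lin_id K U).
move: s; apply: tensor_lin_ext => [||V x]; first exact: lin_comp (tB_linear k) lQ.
  apply: lin_add; first exact: lin_comp (dalg_linear k) (@tv_linear K D U).
  apply: lin_bigsum => i; apply: lin_bigsum => j; apply: lin_scale.
  exact: lin_comp (dalg_linear i) (lin_comp (dalg_linear j) (tB_linear k)).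
have lx := (tens_bilin pseries U).1 x.
rewrite tmap_tens //; last exact: Q1_linear.
rewrite !tB_tens tv_tens box_tens /Q1 Qeta_F1 // dalg_tens.
exact: (linD lx).
Qed.

Lemma tv_Q1 s : tv (tmap Q1 idU s) = tv s + (2%:R^-1 : K) *: \sum_j d j (tX j s).
Proof.
have lQ := tmap_linear Q1_linear (@lin_id K U).
move: s; apply: tensor_lin_ext => [||V x]; first exact: lin_comp (@tv_linear K D U) lQ.
  apply: lin_add; first exact: tv_linear.
  apply: lin_scale; apply: lin_bigsum => j; exact: lin_comp (dalg_linear j) (tX_linear eta j).
have lx := (tens_bilin pseries U).1 x.
rewrite tmap_tens //; last exact: Q1_linear.
rewrite !tv_tens /Q1 Qeta_F1 //.
apply: (etrans (linD lx _ _)); rewrite (linZ lx) (lin_sum lx); apply: f_equal; apply: f_equal.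
by apply: eq_bigr => j _; rewrite tX_tens dalg_tens.
Qed.

Lemma tA_mu1 k s t : tA k (tmap2 mu1 *%R s t) =
  conv2T (cA k) s t + \sum_j eta k j *: curr2T j s t.
Proof.
pose f s t := tA k (tmap2 mu1 *%R s t); rewrite -[LHS]/(f s t).
pose h s t := conv2T (cA k) s t + \sum_j eta k j *: curr2T j s t; rewrite -[RHS]/(h s t).
have bU := @mul_bilin K U; move: s t; apply: bilin_tensor_ext => [||V x W y].
- exact: bilin_post (tmap2_bilin mu1_bilin bU) (tA_linear k).
- apply: bilin_add; first exact: conv2T_bilin.
  by apply: bilin_sum => j; apply: bilin_scale; exact: curr2T_bilin.
have lx := (tens_bilin pseries U).1 (x * y).
rewrite /f /h (tmap2_tens mu1_bilin bU) tA_tens /mu1 mu0eta_F1_F1 conv2T_tens //.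
apply: (etrans (linD lx _ _)); apply: f_equal; rewrite (lin_sum lx).
by apply: eq_bigr => j _; rewrite curr2T_tens (linZ lx).
Qed.

Lemma tB_mu1 k s t : tB k (tmap2 mu1 *%R s t) = conv2T (cB k) s t + curr2T k s t.
Proof.
pose f s t := tB k (tmap2 mu1 *%R s t); rewrite -[LHS]/(f s t).
pose h s t := conv2T (cB k) s t + curr2T k s t; rewrite -[RHS]/(h s t).
have bU := @mul_bilin K U; move: s t; apply: bilin_tensor_ext => [||V x W y].
- exact: bilin_post (tmap2_bilin mu1_bilin bU) (tB_linear k).
- by apply: bilin_add; [exact: conv2T_bilin|exact: curr2T_bilin].
have lx := (tens_bilin pseries U).1 (x * y).
rewrite /f /h (tmap2_tens mu1_bilin bU) tB_tens /mu1 mu0eta_F1_F1 conv2T_tens // curr2T_tens.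
exact: (linD lx).
Qed.

Lemma tv_mu1 s t : tv (tmap2 mu1 *%R s t) =
  (2%:R^-1 : K) *: \sum_l (tA l s * tB l t + tB l s * tA l t).
Proof.
pose f s t := tv (tmap2 mu1 *%R s t); rewrite -[LHS]/(f s t).
pose h s t : T := (2%:R^-1 : K) *: \sum_l (tA l s * tB l t + tB l s * tA l t).
rewrite -[RHS]/(h s t).
have bU := @mul_bilin K U; move: s t; apply: bilin_tensor_ext => [||V x W y].
- exact: bilin_post (tmap2_bilin mu1_bilin bU) (@tv_linear K D U).
- apply: bilin_scale; apply: bilin_sum => l; apply: bilin_add; apply: mul_comp_bilin;
    by [exact: tA_linear|exact: tB_linear].
have lx := (tens_bilin pseries U).1 (x * y).
rewrite /f /h (tmap2_tens mu1_bilin bU) tv_tens /mu1 mu0eta_F1_F1.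
apply: (etrans (linZ lx _ _)); apply: f_equal; rewrite (lin_sum lx).
by apply: eq_bigr => l _; rewrite !tA_tens !tB_tens !mul_tens (linD lx).
Qed.

Lemma tc_n1 (c : V1s -> pseries) s t r : linear c ->
  (forall V W Z, c (n1 V W Z) = cubic2 c V W Z) ->
  tc c (tmap3 n1 (fun x y z => x * y * z) s t r) = cubicT c s t r.
Proof.
move=> lc hc; pose f s t r := tc c (tmap3 n1 (fun x y z => x * y * z) s t r).
rewrite -[LHS]/(f s t r); move: s t r; apply: trilin_tensor_ext => [||V x W y Z z].
- exact: trilin_post (tmap3_trilin n1_trilin mul3_trilin) (tc_linear lc).
- exact: cubicT_trilin.
by rewrite /f (tmap3_tens n1_trilin mul3_trilin) tc_tens // hc cubicT_tens.
Qed.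

Lemma tA_n1 k s t r : tA k (tmap3 n1 (fun x y z => x * y * z) s t r) = cubicT (cA k) s t r.
Proof. by apply: tc_n1 => // V W Z; rewrite /n1 n0eta_F1. Qed.

Lemma tB_n1 k s t r : tB k (tmap3 n1 (fun x y z => x * y * z) s t r) = cubicT (cB k) s t r.
Proof. by apply: tc_n1 => // V W Z; rewrite /n1 n0eta_F1. Qed.

Lemma tv_n1 s t r : tv (tmap3 n1 (fun x y z => x * y * z) s t r) = 0.
Proof.
pose f s t r := tv (tmap3 n1 (fun x y z => x * y * z) s t r).
pose h (_ _ _ : tensor V1s U) : T := 0.
rewrite -[LHS]/(f s t r) -[RHS]/(h s t r); move: s t r.
apply: trilin_tensor_ext => [||V x W y Z z].
- exact: trilin_post (tmap3_trilin n1_trilin mul3_trilin) (@tv_linear K D U).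
- by split=> a b; exact: lin_const0.
rewrite /f /h (tmap3_tens n1_trilin mul3_trilin) tv_tens /n1 n0eta_F1.
exact: (lin0 ((tens_bilin pseries U).1 _)).
Qed.

End Components.

(** * Equivalence with the Yang-Mills system *)

Section YangMills.
Context (K : fieldType) (D : nat) (eta : 'M[K]_D) (U : algType K).
Context (K2 : (2%:R : K) != 0) (eta_sym : eta^T = eta) (eta_inv : eta \in unitmx).
Local Notation pseries := (pseries K D).
Local Notation vect := (vect K D).
Local Notation lightF := (lightF K D).
Local Notation V1s := (vect * vect * pseries)%type.
Local Notation T := (psalg D U).
Local Notation d := (@dalg K D U).
Local Notation idU := (id : U -> U).
Local Notation tA := (@tA K D U).
Local Notation tB := (@tB K D U).
Local Notation tv := (@tv K D U).
Local Notation tX := (@tX K D eta U).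
Implicit Types (i j k l : 'I_D) (s : tensor V1s U) (v : T).

Local Opaque mu0 br0 m0 n0 QF psmul pderiv psone Qeta mu0eta n0eta ymE.

Lemma dalgM i (x y : T) : d i (x * y) = d i x * y + x * d i y.
Proof. exact: dtensM. Qed.

Lemma dalgC i j (x : T) : d i (d j x) = d j (d i x).
Proof. exact: dtensC. Qed.

Section WithConnection.
Context (c Ph : 'I_D -> T) (s : tensor V1s U).
Context (hA : forall k, tA k s = up eta c Ph k) (hB : forall k, tB k s = c k + Ph k).

Let hX j : tX j s = bX eta c Ph j.
Proof.
rewrite -[LHS]/(tA j s + \sum_i eta i j *: tB i s) hA /bX; apply: f_equal; apply: eq_bigr => i _; by rewrite hB.
Qed.

Let conv_tc (q : V1s -> pseries) (x : T) : tc q s = x ->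
  conv2T eta q s s = conv_alg eta d c Ph (tv s) x.
Proof.
move=> hx; rewrite /conv2T /conv_alg hx; apply: (f_equal2 +%R); last by [].
by apply: eq_bigr => j _; rewrite hX.
Qed.

Let curr_tc k : curr2T k s s = curr_alg eta d c Ph k.
Proof. by apply: eq_bigr => l _; rewrite hA hB. Qed.

Let cubic_tc (q : V1s -> pseries) (x : T) : tc q s = x ->
  cubicT q s s s = cubic_alg eta c Ph x.
Proof. by move=> hx; apply: eq_bigr => l _; rewrite hA hB hx. Qed.

Lemma ym_equations : ymE eta s = 0 <->
  tv s = vsol eta d c Ph /\
  (forall k, d k (vsol eta d c Ph) + curr_alg eta d c Ph k +
      wave eta d c Ph (vsol eta d c Ph) (c k) = 0 /\
    wave eta d c Ph (vsol eta d c Ph) (Ph k) = 0).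
Proof.
Local Transparent ymE.
have eA k : tA k (ymE eta s) = box_alg eta d (up eta c Ph k) +
    \sum_j eta k j *: d j (tv s) +
    (conv_alg eta d c Ph (tv s) (up eta c Ph k) +
     \sum_j eta k j *: curr_alg eta d c Ph j) + cubic_alg eta c Ph (up eta c Ph k).
  rewrite /ymE !(linD (tA_linear k)) tA_Q1 // tA_mu1 tA_n1 hA.
  rewrite (conv_tc (x := up eta c Ph k)); last exact: hA.
  rewrite (cubic_tc (x := up eta c Ph k)); last exact: hA.
  apply: (f_equal2 +%R); last reflexivity.
  do 2 apply: (f_equal (+%R _)).
  by apply: eq_bigr => j _; rewrite curr_tc.
have eB k : tB k (ymE eta s) = d k (tv s) + box_alg eta d (c k + Ph k) +
    (conv_alg eta d c Ph (tv s) (c k + Ph k) + curr_alg eta d c Ph k) +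
    cubic_alg eta c Ph (c k + Ph k).
  rewrite /ymE !(linD (tB_linear k)) tB_Q1 // tB_mu1 tB_n1 hB curr_tc.
  rewrite (conv_tc (x := c k + Ph k)); last exact: hB.
  by rewrite (cubic_tc (x := c k + Ph k)); last exact: hB.
have ev : tv (ymE eta s) = tv s - vsol eta d c Ph.
  rewrite /ymE !(linD (@tv_linear K D U)) tv_Q1 // tv_mu1 tv_n1 addr0.
  rewrite -(w_component K2 eta_sym (@dalg_linear K D U)).
  apply: (f_equal2 +%R); first apply: (f_equal (+%R _)).
    by apply: f_equal; apply: eq_bigr => j _; rewrite hX.
  by apply: f_equal; apply: eq_bigr => j _; rewrite hA hB.
have we := wave_equations K2 (@dalg_linear K D U) c Ph eta_inv.
split.
  move=> /tensor_V1s0[kA kB kv]; have vE : tv s = vsol eta d c Ph.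
    by apply/eqP; rewrite -subr_eq0 -ev kv.
  split=> //; rewrite -vE; apply/we => k.
  by rewrite -eA -eB kA kB.
move=> [vE h]; apply/tensor_V1s0; rewrite -vE in h; have {}h := (we (tv s)).2 h.
split=> [k|k|].
- by rewrite eA; case: (h k).
- by rewrite eB; case: (h k).
by rewrite ev vE subrr.
Qed.

End WithConnection.

(** [conn] and [higgs] are the images in the algebra T of the fields calA and Phi. The factors 1/2
    are such that b = conn + higgs and a = eta (conn - higgs), the parametrization used in the
    algebraic part. *)
Definition conn (a b : 'I_D -> T) i : T :=
  (2%:R^-1 : K) *: (b i + \sum_j invmx eta i j *: a j).
Definition higgs (a b : 'I_D -> T) i : T :=
  (2%:R^-1 : K) *: (b i - \sum_j invmx eta i j *: a j).

Lemma half_add (M : lmodType K) (x y : M) :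
  (2%:R^-1 : K) *: (x + y) + (2%:R^-1 : K) *: (x - y) = x.
Proof.
rewrite -scalerDr addrACA subrr addr0 -mulr2n -scaler_nat scalerA mulVf //.
exact: scale1r.
Qed.

Lemma half_sub (M : lmodType K) (x y : M) :
  (2%:R^-1 : K) *: (x + y) - (2%:R^-1 : K) *: (x - y) = y.
Proof.
rewrite -scalerBr opprB [x + y + _]addrC addrA subrK -mulr2n -scaler_nat.
by rewrite scalerA mulVf // scale1r.
Qed.

Lemma eta_invmx (M : lmodType K) (E F : 'M[K]_D) (y : 'I_D -> M) k : E *m F = 1%:M ->
  \sum_l E k l *: \sum_j F l j *: y j = y k.
Proof.
move=> EF; under eq_bigr => l _ do rewrite scaler_sumr.
rewrite exchange_big; under eq_bigr => j _.
  under eq_bigr => l _ do rewrite scalerA.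
  rewrite -scaler_suml (_ : \sum_l E k l * F l j = (E *m F) k j); last by rewrite mxE.
  over.
rewrite EF (bigD1 k) //= mxE eqxx scale1r big1 ?addr0 // => j /negPf jk.
by rewrite mxE eq_sym jk scale0r.
Qed.

Lemma up_conn a b k : up eta (conn a b) (higgs a b) k = a k.
Proof.
rewrite /up; under eq_bigr => l _ do rewrite half_sub.
by apply: eta_invmx; rewrite mulmxV.
Qed.

Lemma ym_pack a b v : ymE eta (pack a b v) = 0 <->
  v = vsol eta d (conn a b) (higgs a b) /\
  (forall k,
    (forall r : T, \sum_i \sum_j eta i j *:
        opcomm (nabla_op d (conn a b) i)
          (opcomm (nabla_op d (conn a b) j) (nabla_op d (conn a b) k)) r =
      \sum_i \sum_j eta i j *:
        opcomm (opcomm (nabla_op d (conn a b) k) (phi_op (higgs a b) i))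
          (phi_op (higgs a b) j) r) /\
    (forall r : T, \sum_i \sum_j eta i j *:
        opcomm (nabla_op d (conn a b) i)
          (opcomm (nabla_op d (conn a b) j) (phi_op (higgs a b) k)) r =
      \sum_i \sum_j eta i j *:
        opcomm (phi_op (higgs a b) i)
          (opcomm (phi_op (higgs a b) j) (phi_op (higgs a b) k)) r)).
Proof.
have hA k : tA k (pack a b v) = up eta (conn a b) (higgs a b) k.
  by rewrite tA_pack up_conn.
have hB k : tB k (pack a b v) = conn a b k + higgs a b k.
  by rewrite tB_pack half_add.
have e1 := ym_equations hA hB; rewrite tv_pack in e1.
have e2 := operator_equations K2 eta_sym (@dalg_linear K D U) dalgM dalgC (conn a b) (higgs a b).
by rewrite e1 e2.
Qed.

End YangMills.

(** * Gauge transformations *)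

Section Gauge.
Context (K : fieldType) (D : nat) (eta : 'M[K]_D) (U : algType K).
Local Notation pseries := (pseries K D).
Local Notation vect := (vect K D).
Local Notation lightF := (lightF K D).
Local Notation V1s := (vect * vect * pseries)%type.
Local Notation T := (psalg D U).
Local Notation d := (@dalg K D U).
Local Notation idU := (id : U -> U).
Local Notation tA := (@tA K D U).
Local Notation tB := (@tB K D U).
Implicit Types (i j k l : 'I_D) (s : tensor V1s U) (u : T) (V : V1s) (f : pseries).

Local Opaque mu0 br0 m0 n0 QF psmul pderiv psone Qeta mu0eta n0eta.

Definition gQ f : V1s := F1 (Qeta eta (inF0 f)).
Definition gR V f : V1s := F1 (mu0eta eta (inc1 V) (inF0 f)).
Definition gL f V : V1s := F1 (mu0eta eta (inF0 f) (inc1 V)).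

Lemma gQ_linear : linear gQ.
Proof.
apply: lin_comp; first exact: F1_linear.
by apply: lin_comp; [exact: Qeta_linear|exact: inF0_linear].
Qed.

Lemma gR_bilin : bilin gR.
Proof.
apply: bilin_post; last exact: F1_linear.
exact: bilin_comp (mu0eta_bilin eta) (@inc1_linear K D) (@inF0_linear K D).
Qed.

Lemma gL_bilin : bilin gL.
Proof.
apply: bilin_post; last exact: F1_linear.
exact: bilin_comp (mu0eta_bilin eta) (@inF0_linear K D) (@inc1_linear K D).
Qed.

Definition gaugeE s u : tensor V1s U :=
  tmap gQ idU u + tmap2 gR *%R s u - tmap2 gL *%R u s.

Lemma gauge_i1 s u : QetaU eta (i0 u) + mu0etaU eta (i1 s) (i0 u)
  - mu0etaU eta (i0 u) (i1 s) = i1 (gaugeE s u).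
Proof.
have bU := @mul_bilin K U; have bm := tmap2_bilin (mu0eta_bilin eta) bU.
have l1 := @i1_linear K D U; have l0 := @i0_linear K D U.
have e1 : QetaU eta (i0 u) = i1 (tmap gQ idU u).
  rewrite /QetaU /i0 /i1 !tmap_comp //;
    try by [exact: gQ_linear|exact: inF0_linear|exact: inc1_linear|exact: Qeta_linear].
  apply: (f_equal (fun h : pseries -> lightF => tmap h idU u)); apply/funext => f.
  by rewrite /gQ Qeta_F0.
have e2 : mu0etaU eta (i1 s) (i0 u) = i1 (tmap2 gR *%R s u).
  pose f s u := mu0etaU eta (i1 s) (i0 u); rewrite -[LHS]/(f s u).
  pose h s u := i1 (tmap2 gR *%R s u); rewrite -[RHS]/(h s u).
  move: s u {e1}; apply: bilin_tensor_ext => [||V x w y].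
  - exact: bilin_comp bm l1 l0.
  - exact: bilin_post (tmap2_bilin gR_bilin bU) l1.
  rewrite /f /h (tmap2_tens gR_bilin bU) /i1 /i0 !tmap_tens //;
    try by [exact: inc1_linear|exact: inF0_linear].
  rewrite /mu0etaU (tmap2_tens (mu0eta_bilin eta) bU) /gR mu0eta_F1_F0; reflexivity.
have e3 : mu0etaU eta (i0 u) (i1 s) = i1 (tmap2 gL *%R u s).
  pose f u s := mu0etaU eta (i0 u) (i1 s); rewrite -[LHS]/(f u s).
  pose h u s := i1 (tmap2 gL *%R u s); rewrite -[RHS]/(h u s).
  move: u s {e1 e2}; apply: bilin_tensor_ext => [||w y V x].
  - exact: bilin_comp bm l0 l1.
  - exact: bilin_post (tmap2_bilin gL_bilin bU) l1.
  rewrite /f /h (tmap2_tens gL_bilin bU) /i1 /i0 !tmap_tens //;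
    try by [exact: inc1_linear|exact: inF0_linear].
  rewrite /mu0etaU (tmap2_tens (mu0eta_bilin eta) bU) /gL mu0eta_F0_F1; reflexivity.
by rewrite e1 e2 e3 /gaugeE (linB l1) (linD l1).
Qed.

(** The A- and B-components both vary by an inhomogeneous derivative term plus a commutator with u.
    The auxiliary component v does not fit this scheme, as its variation contains X^j d_j u. *)
Lemma gauge_component (c : V1s -> pseries) (q : pseries -> pseries) (Q : T -> T) s u :
  linear c -> linear Q -> (forall f x, Q (tens f x) = tens (q f) x) ->
  (forall f, c (gQ f) = q f) -> (forall V f, c (gR V f) = psmul (c V) f) ->
  (forall V f, c (gL f V) = psmul f (c V)) ->
  tc c (gaugeE s u) = Q u + tc c s * u - u * tc c s.
Proof.
move=> lc lQ hQ hq hR hL; have lt := @tc_linear K D U c lc.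
have bU := @mul_bilin K U.
have e1 : tc c (tmap gQ idU u) = Q u.
  move: u; apply: tensor_lin_ext => [||f x] //.
    exact: lin_comp lt (tmap_linear gQ_linear (@lin_id K U)).
  by rewrite tmap_tens ?tc_tens ?hq ?hQ //; exact: gQ_linear.
have e2 : tc c (tmap2 gR *%R s u) = tc c s * u.
  pose f s u := tc c (tmap2 gR *%R s u); rewrite -[LHS]/(f s u).
  pose h s u : T := tc c s * u; rewrite -[RHS]/(h s u).
  move: s u {e1}; apply: bilin_tensor_ext => [||V x w y].
  - exact: bilin_post (tmap2_bilin gR_bilin bU) lt.
  - exact: bilin_comp (@alg_mul_bilin K T) lt (@lin_id K T).
  by rewrite /f /h (tmap2_tens gR_bilin bU) !tc_tens // mul_tens hR.
have e3 : tc c (tmap2 gL *%R u s) = u * tc c s.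
  pose f u s := tc c (tmap2 gL *%R u s); rewrite -[LHS]/(f u s).
  pose h u s : T := u * tc c s; rewrite -[RHS]/(h u s).
  move: u s {e1 e2}; apply: bilin_tensor_ext => [||w y V x].
  - exact: bilin_post (tmap2_bilin gL_bilin bU) lt.
  - exact: bilin_comp (@alg_mul_bilin K T) (@lin_id K T) lt.
  by rewrite /f /h (tmap2_tens gL_bilin bU) !tc_tens // mul_tens hL.
by rewrite /gaugeE (linB lt) (linD lt) e1 e2 e3.
Qed.

Lemma tA_gauge k s u : tA k (gaugeE s u) =
  \sum_j eta k j *: d j u + tA k s * u - u * tA k s.
Proof.
apply: (gauge_component (q := fun f => \sum_j eta k j *: pderiv j f)
  (Q := fun u => \sum_j eta k j *: d j u)) => //.
- by apply: lin_bigsum => j; apply: lin_scale; exact: dalg_linear.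
- move=> f x; have lx := (tens_bilin pseries U).1 x.
  by rewrite (lin_sum lx); apply: eq_bigr => j _; rewrite dalg_tens (linZ lx).
- by move=> f; rewrite /gQ Qeta_F0.
- by move=> V f; rewrite /gR mu0eta_F1_F0.
by move=> V f; rewrite /gL mu0eta_F0_F1.
Qed.

Lemma tB_gauge k s u : tB k (gaugeE s u) = d k u + tB k s * u - u * tB k s.
Proof.
apply: (gauge_component (q := pderiv k) (Q := d k)) => //.
- exact: dalg_linear.
- by move=> f x; rewrite dalg_tens.
- by move=> f; rewrite /gQ Qeta_F0.
- by move=> V f; rewrite /gR mu0eta_F1_F0.
by move=> V f; rewrite /gL mu0eta_F0_F1.
Qed.

Section LieValued.
Context (g : lmodType K) (br : lieBracket g) (iota : {linear g -> U}).
Context (hiota : lie_to_assoc br iota).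
Local Notation Tg := (tensor pseries g).
Implicit Types (a : Tg) (A B : 'I_D -> Tg).

Let li : linear (iota : g -> U).
Proof. by move=> c x y; rewrite linearP. Qed.

Lemma embU_linear : linear (@embU K D g U iota).
Proof. exact: tmap_linear (@lin_id K pseries) li. Qed.

Lemma embU_tens f (x : g) : embU iota (tens f x) = tens f (iota x).
Proof. exact: tmap_tens _ _ (@lin_id K pseries) li. Qed.

Lemma embU_dtens i a : embU iota (dtens i a) = d i (embU iota a).
Proof.
move: a; apply: tensor_lin_ext => [||f x].
- exact: lin_comp embU_linear (dtens_linear i).
- exact: lin_comp (dalg_linear i) embU_linear.
by rewrite dtens_tens !embU_tens dalg_tens.
Qed.

Lemma liemul_bilin : bilin (@liemul K D g br).
Proof. exact: tmap2_bilin (psmul_bilin K D) (lie_bilin br). Qed.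

(** Power series commute, so the commutator in T acts on the U-factors only, and there [iota]
    identifies it with the Lie bracket. *)
Lemma embU_liemul a b : embU iota (liemul br a b) =
  (embU iota a : T) * embU iota b - (embU iota b : T) * embU iota a.
Proof.
pose f a b := embU iota (liemul br a b); rewrite -[LHS]/(f a b).
pose h a b : T := (embU iota a : T) * embU iota b - (embU iota b : T) * embU iota a.
have bm := @alg_mul_bilin K T.
rewrite -[RHS]/(h a b); move: a b; apply: bilin_tensor_ext => [||v x w y].
- exact: bilin_post liemul_bilin embU_linear.
- apply: bilin_sub; first exact: bilin_comp bm embU_linear embU_linear.
  by have [m1 m2] := bilin_comp bm embU_linear embU_linear; split; [exact: m2|exact: m1].
have -> : f (tens v x) (tens w y) = tens (psmul v w) (iota (br x y)).
  by rewrite /f /liemul (tmap2_tens (psmul_bilin K D) (lie_bilin br)) embU_tens.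
rewrite /h !embU_tens !mul_tens hiota psmulC; exact: (linB ((tens_bilin _ _).2 _)).
Qed.

Lemma Psi_pack A B (v : T) : Psi iota A B v =
  i1 (pack (fun k => embU iota (A k)) (fun k => embU iota (B k)) v).
Proof.
have l1 := @i1_linear K D U; rewrite /pack (linD l1) (linD l1).
apply: (f_equal2 +%R); last first.
  by rewrite /i1 tmap_comp //; try by [exact: injv_linear|exact: inc1_linear].
apply: (f_equal2 +%R); rewrite (lin_sum l1); apply: eq_bigr => i _;
  by rewrite /i1 tmap_comp //;
    try by [exact: injA_linear|exact: injB_linear|exact: inc1_linear].
Qed.

Lemma embU_calA A B i : embU iota (calA eta A B i) =
  conn eta (fun k => embU iota (A k)) (fun k => embU iota (B k)) i.
Proof.
rewrite /calA (linZ embU_linear) (linD embU_linear) (lin_sum embU_linear).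
apply: f_equal; apply: f_equal; apply: eq_bigr => j _; exact: (linZ embU_linear).
Qed.

Lemma embU_Phi A B i : embU iota (Phi eta A B i) =
  higgs eta (fun k => embU iota (A k)) (fun k => embU iota (B k)) i.
Proof.
rewrite /Phi (linZ embU_linear) (linB embU_linear) (lin_sum embU_linear).
apply: f_equal; apply: f_equal; apply: f_equal; apply: eq_bigr => j _.
exact: (linZ embU_linear).
Qed.

Definition gaugedA A a (e : K) k : Tg :=
  A k + e *: (\sum_j eta k j *: dtens j a + liemul br (A k) a).
Definition gaugedB B a (e : K) k : Tg := B k + e *: (dtens k a + liemul br (B k) a).

Lemma gauge_Psi A B v a e : exists v' : T,
  Psi iota A B v + e *: (QetaU eta (gauge0 iota a)
    + mu0etaU eta (Psi iota A B v) (gauge0 iota a)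
    - mu0etaU eta (gauge0 iota a) (Psi iota A B v)) =
  Psi iota (gaugedA A a e) (gaugedB B a e) v'.
Proof.
rewrite !Psi_pack; set s := pack _ _ v; set u : T := embU iota a.
rewrite -[gauge0 iota a]/(i0 u) gauge_i1 -(linZ (@i1_linear K D U)).
rewrite -(linD (@i1_linear K D U)).
set G := _ + e *: _; exists (tv G); rewrite Psi_pack -[G in LHS]packK.
have -> : (fun k => tA k G) = (fun k => embU iota (gaugedA A a e k)).
  apply/funext => k; rewrite /G (linD (tA_linear k)) (linZ (tA_linear k)) tA_gauge tA_pack.
  rewrite /gaugedA (linD embU_linear) (linZ embU_linear) (linD embU_linear) embU_liemul.
  rewrite (lin_sum embU_linear) addrA; apply: (f_equal (fun x => _ + e *: (x + _ - _))).
  by apply: eq_bigr => j _; rewrite (linZ embU_linear) embU_dtens.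
have -> : (fun k => tB k G) = (fun k => embU iota (gaugedB B a e k)).
  apply/funext => k; rewrite /G (linD (tB_linear k)) (linZ (tB_linear k)) tB_gauge tB_pack.
  rewrite /gaugedB (linD embU_linear) (linZ embU_linear) (linD embU_linear) embU_liemul.
  by rewrite embU_dtens addrA.
by [].
Qed.

Context (K2 : (2%:R : K) != 0) (eta_inv : eta \in unitmx).

(* Raising and lowering the index of A by eta turns its variation into that of B. *)
Lemma lowered_gaugedA A a e i : \sum_j invmx eta i j *: gaugedA A a e j =
  \sum_j invmx eta i j *: A j +
    e *: (dtens i a + liemul br (\sum_j invmx eta i j *: A j) a).
Proof.
have ll := liemul_bilin.1 a.
under eq_bigr => j _ do rewrite scalerDr scalerA mulrC -scalerA scalerDr -(linZ ll).
rewrite big_split; apply: f_equal; rewrite -scaler_sumr big_split; apply: f_equal.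
rewrite -(lin_sum ll); apply: (f_equal (fun x => x + _)).
by apply: eta_invmx; rewrite mulVmx.
Qed.

(** B and the lowered A acquire the same inhomogeneous term d_i u. The half-sum retains it once,
    which makes calA a connection, and in the difference it cancels, which makes Phi transform in
    the adjoint way. *)
Lemma calA_gauged A B a e i : calA eta (gaugedA A a e) (gaugedB B a e) i =
  calA eta A B i + e *: (dtens i a + liemul br (calA eta A B i) a).
Proof.
rewrite /calA lowered_gaugedA /gaugedB; set y := \sum_j _.
have ll := liemul_bilin.1 a.
rewrite addrACA -scalerDr addrACA -(linD ll) scalerDr; apply: f_equal.
rewrite scalerA mulrC -scalerA; apply: f_equal; rewrite scalerDr (linZ ll).
by rewrite -mulr2n -scaler_nat scalerA mulVf // scale1r.
Qed.

Lemma Phi_gauged A B a e i : Phi eta (gaugedA A a e) (gaugedB B a e) i =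
  Phi eta A B i + e *: liemul br (Phi eta A B i) a.
Proof.
rewrite /Phi lowered_gaugedA /gaugedB; set y := \sum_j _.
have ll := liemul_bilin.1 a.
rewrite opprD addrACA -scalerBr [dtens i a + _]addrC addrKA -(linB ll) scalerDr.
by apply: f_equal; rewrite scalerA mulrC -scalerA (linZ ll).
Qed.

End LieValued.
End Gauge.

Local Open Scope complex_scope.

Theorem proposition5p6 (R : realType) (D : nat)
    (g : lmodType R[i]) (br : lieBracket g)
    (U : algType R[i]) (iota : {linear g -> U}) (hU : enveloping br iota)
    (eta : 'M[R[i]]_D) (eta_sym : eta^T = eta) (eta_inv : eta \in unitmx)
    (A B : 'I_D -> tensor (pseries R[i] D) g) :
  let YM v :=
    QetaU eta (Psi iota A B v)
    + mu0etaU eta (Psi iota A B v) (Psi iota A B v)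
    + n0etaU (Psi iota A B v) (Psi iota A B v) (Psi iota A B v) = 0 in
  let nabla := opnabla (fun i => embU iota (calA eta A B i)) in
  let phi i := opmul (embU iota (Phi eta A B i)) in
  [/\ (exists v : tensor (pseries R[i] D) U, YM v) <->
      (forall k : 'I_D,
        (forall s,
          \sum_i \sum_j eta i j *:
            opcomm (nabla i) (opcomm (nabla j) (nabla k)) s =
          \sum_i \sum_j eta i j *:
            opcomm (opcomm (nabla k) (phi i)) (phi j) s) /\
        (forall s,
          \sum_i \sum_j eta i j *:
            opcomm (nabla i) (opcomm (nabla j) (phi k)) s =
          \sum_i \sum_j eta i j *:
            opcomm (phi i) (opcomm (phi j) (phi k)) s)),
      forall v v' : tensor (pseries R[i] D) U, YM v -> YM v' -> v = v' &
      forall (v : tensor (pseries R[i] D) U) (u : tensor (pseries R[i] D) g)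
             (eps : R[i]),
        exists A' B' v',
          Psi iota A B v + eps *:
            (QetaU eta (gauge0 iota u)
             + mu0etaU eta (Psi iota A B v) (gauge0 iota u)
             - mu0etaU eta (gauge0 iota u) (Psi iota A B v))
          = Psi iota A' B' v' /\
          forall i : 'I_D,
            calA eta A' B' i = calA eta A B i
              + eps *: (dtens i u + liemul br (calA eta A B i) u) /\
            Phi eta A' B' i = Phi eta A B i
              + eps *: liemul br (Phi eta A B i) u].
Proof.
have K2 : (2%:R : R[i]) != 0 by rewrite pnatr_eq0.
have hi : lie_to_assoc br iota by exact: hU.1.
set a : 'I_D -> psalg D U := fun k => embU iota (A k).
set b : 'I_D -> psalg D U := fun k => embU iota (B k).
move=> YM nabla phi.
have calAE : (fun i => embU iota (calA eta A B i)) = conn eta a b.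
  by apply/funext => i; exact: embU_calA.
have nablaE : nabla = nabla_op (@dalg _ D U) (conn eta a b).
  by rewrite /nabla calAE.
have phiE : phi = phi_op (higgs eta a b).
  by apply/funext => i; rewrite /phi embU_Phi.
have YME v : YM v <-> ymE eta (pack a b v) = 0.
  rewrite /YM Psi_pack YM_i1 //; split=> [|->]; first exact: i2_inj0.
  exact: (lin0 (@i2_linear _ D U)).
have eqs v := ym_pack K2 eta_sym eta_inv a b v.
split.
- rewrite nablaE phiE; split=> [[v /YME/eqs[_ h]] //|h].
  (* The c d^2c component forces this value of v in terms of A and B, which also gives uniqueness in
     the next item. *)
  by exists (vsol eta (@dalg _ D U) (conn eta a b) (higgs eta a b)); apply/YME/eqs.
- by move=> v v' /YME/eqs[-> _] /YME/eqs[-> _].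
move=> v u eps; have [v' hv'] := gauge_Psi eta hi A B v u eps.
exists (gaugedA eta br A u eps), (gaugedB br B u eps), v'; split=> // i.
by split; [exact: calA_gauged|exact: Phi_gauged].
Qed.
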